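(* Suppose $\Pi=K(S)\cup K(T)$ where $S\neq T\in\mathrm{SYT}(n)$. The following are equivalent: (i) $\Pi$ is pattern-Knuth closed; (ii) $\Pi$ is swap closed; (iii) $\Pi=D_J^{-1}\cup D_L^{-1}$ where either $J\neq L$ and each of $J,L$ is a subset of $[n-1]$ of the form $[1,k]$ or $[k,n-1]$ for some $k$ (the empty set being allowed), or $J=L$ is one of the sets $[k,n-2]$ with $2\le k\le n-2$, $[2,k-2]$ with $4\le k\le n$, or the complement in $[n-1]$ of one of these sets; (iv) $S$ and $T$ are either distinct superstandard hooks, or the pair $\{S,T\}$ is one of the exceptional pairs of type A or type B, or is obtained by transposing both tableaux of such a pair.
   Context: $\mathfrak S_n$ is the set of permutations $\pi=\pi_1\cdots\pi_n$ of $[n]=\{1,\dots,n\}$, and $[a,b]=\{a,a+1,\dots,b\}$. A permutation $\sigma$ contains $\pi$ if some (not necessarily contiguous) subsequence of $\sigma$ is order isomorphic to $\pi$; otherwise it avoids $\pi$. $\mathfrak S_k(\Pi)$ is the set of $\sigma\in\mathfrak S_k$ avoiding every $\pi\in\Pi$. $\mathrm{SYT}(n)$ is the set of standard Young tableaux with $n$ boxes (English notation, first row on top). $P(\pi)$ is the insertion tableau of $\pi$ under the Robinson–Schensted correspondence, and $K(S)=\{\pi\mid P(\pi)=S\}$ is the Knuth class of $S$. A set $\Pi$ of permutations is pattern-Knuth closed if $\mathfrak S_k(\Pi)$ is a union of Knuth classes for all $k$. A swap in $\pi\in\mathfrak S_n$ is the operation of interchanging adjacent elements $\pi_i,\pi_{i+1}$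 where $|\pi_i-\pi_{i+1}|>1$. A set of permutations is swap closed if it is closed under swaps. For $J\subseteq[n-1]$, $D_J=\{\pi\in\mathfrak S_n\mid \mathrm{Des}(\pi)=J\}$, where $\mathrm{Des}(\pi)=\{i\mid\pi_i>\pi_{i+1}\}$, and $D_J^{-1}=\{\pi^{-1}\mid\pi\in D_J\}$. A standard tableau of shape $\lambda$ is row superstandard if its first row is $1,\dots,\lambda_1$, its second row is $\lambda_1+1,\dots,\lambda_1+\lambda_2$, and so on; column superstandard is defined analogously using columns. Superstandard means row or column superstandard. A superstandard hook is a superstandard tableau of hook shape $(a,1^b)$ (single rows and columns included). Exceptional pairs in $\mathrm{SYT}(n)$: Type A, for $2\le k\le n-2$: one tableau has first row $1,2,\dots,k,n$ and the remaining entries $k+1,\dots,n-1$ down the first column below the entry $1$ (a hook); the other has first row $1,2,\dots,k$, the entries $k+1,\dots,n-1$ down the first column below $1$, and $n$ in box $(2,2)$. Type B, for $4\le k\le n$: one tableau has first row $1,2,k,k+1,\dots,n$ and the entries $3,\dots,k-1$ down the first column below $1$ (a hook); the other has first row $1,2,k+1,\dots,n$, the entries $3,\dots,k-1$ down the first column below $1$, and $k$ in box $(2,2)$. *)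

(* Defs.v *)
From HB Require Import structures.
From mathcomp Require Import all_boot all_fingroup.

Set Implicit Arguments.
Unset Strict Implicit.
Unset Printing Implicit Defensive.

(* A permutation pi_1 ... pi_n of [n] is an element of 'S_n = {perm 'I_n},
   with positions and values both shifted down by one: the letter pi_(i+1) of
   the one-line notation is (pi i).+1 for i : 'I_n. *)
Definition one_line (n : nat) (pi : 'S_n) : seq nat :=
  [seq (pi i).+1 | i <- enum 'I_n].

(* The ffun f lists the positions of an occurrence of pi in sigma. *)
Definition pattern_in (m k : nat) (pi : 'S_m) (sigma : 'S_k) : bool :=
  [exists f : {ffun 'I_m -> 'I_k},
    [forall i : 'I_m, forall j : 'I_m,
      ((i < j) ==> (f i < f j))
      && ((pi i < pi j) == (sigma (f i) < sigma (f j)))]].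

Definition avoiders (n : nat) (Pi : {set 'S_n}) (k : nat) : {set 'S_k} :=
  [set sigma | [forall pi in Pi, ~~ pattern_in pi sigma]].

(* The rows of the tableau, from top to bottom. *)
Definition tableau := seq (seq nat).

Definition entry (T : tableau) (i j : nat) : nat := nth 0 (nth [::] T i) j.

Definition is_SYT (n : nat) (T : tableau) : Prop :=
  [/\ [::] \notin T,
      sorted geq (shape T),
      all (sorted ltn) T,
      forall i j, i.+1 < size T -> j < size (nth [::] T i.+1) ->
        entry T i j < entry T i.+1 j
    & perm_eq (flatten T) (iota 1 n)].

Definition transpose (T : tableau) : tableau :=
  mkseq (fun j => [seq nth 0 r j | r <- T & j < size r]) (size (head [::] T)).

Fixpoint row_insert (T : tableau) (x : nat) : tableau :=
  if T is r :: T' then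
    let i := find (fun y => x < y) r in
    if i < size r then set_nth 0 r i x :: row_insert T' (nth 0 r i)
    else rcons r x :: T'
  else [:: [:: x]].

Definition insertion_tableau (n : nat) (pi : 'S_n) : tableau :=
  foldl row_insert [::] (one_line pi).

Definition knuth_class (n : nat) (S : tableau) : {set 'S_n} :=
  [set pi | insertion_tableau pi == S].

Definition pattern_knuth_closed (n : nat) (Pi : {set 'S_n}) : Prop :=
  forall k : nat, exists C : seq tableau,
    (forall U, U \in C -> is_SYT k U) /\
    avoiders Pi k = \bigcup_(U <- C) knuth_class k U.

(* tperm i j * pi is pi with the letters in positions i and j interchanged. *)
Definition swap_closed (n : nat) (Pi : {set 'S_n}) : Prop :=
  forall (pi : 'S_n) (i j : 'I_n),
    pi \in Pi -> j = i.+1 :> nat ->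
    ((pi i).+1 < pi j) || ((pi j).+1 < pi i) ->
    (tperm i j * pi)%g \in Pi.

(* Subsets of [n-1] are the J : {set 'I_n} not containing 0; here an
   ordinal stands for its own value, without any shift. *)
Definition interval (n a b : nat) : {set 'I_n} := [set i : 'I_n | a <= i <= b].

(* With j.+1 = i, the ordinal j is the zero-based position of the letter pi_i
   and i that of pi_(i+1). *)
Definition Des (n : nat) (pi : 'S_n) : {set 'I_n} :=
  [set i : 'I_n | [exists j : 'I_n, (j.+1 == i) && (pi i < pi j)]].

Definition descent_class (n : nat) (J : {set 'I_n}) : {set 'S_n} :=
  [set pi | Des pi == J].

Definition inv_descent_class (n : nat) (J : {set 'I_n}) : {set 'S_n} :=
  [set (pi^-1)%g | pi in descent_class J].

(* k = 0 in the first case and k = n in the second give the empty set. *)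
Definition end_interval (n : nat) (J : {set 'I_n}) : Prop :=
  (exists2 k, k <= n.-1 & J = interval n 1 k) \/
  (exists2 k, 1 <= k <= n & J = interval n k n.-1).

Definition inner_interval (n : nat) (J : {set 'I_n}) : Prop :=
  (exists2 k, 2 <= k <= n - 2 & J = interval n k (n - 2)) \/
  (exists2 k, 4 <= k <= n & J = interval n 2 (k - 2)).

Definition exceptional_descent_set (n : nat) (J : {set 'I_n}) : Prop :=
  inner_interval J \/
  (exists2 J', inner_interval J' & J = interval n 1 n.-1 :\: J').

(* For a standard tableau: the rows read from top to bottom give 1, ..., n. *)
Definition row_superstandard (T : tableau) : Prop :=
  flatten T = iota 1 (size (flatten T)).

Definition column_superstandard (T : tableau) : Prop :=
  row_superstandard (transpose T).

Definition is_hook (T : tableau) : Prop :=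
  exists a b : nat, shape T = a :: nseq b 1.

Definition superstandard_hook (T : tableau) : Prop :=
  is_hook T /\ (row_superstandard T \/ column_superstandard T).

(* The entries a, ..., b - 1 down a column of boxes, one per row. *)
Definition column (a b : nat) : tableau := [seq [:: x] | x <- index_iota a b].

Definition typeA_hook (n k : nat) : tableau :=
  rcons (index_iota 1 k.+1) n :: column k.+1 n.
Definition typeA_nonhook (n k : nat) : tableau :=
  [:: index_iota 1 k.+1, [:: k.+1; n] & column k.+2 n].

Definition typeB_hook (n k : nat) : tableau :=
  [:: 1, 2 & index_iota k n.+1] :: column 3 k.
Definition typeB_nonhook (n k : nat) : tableau :=
  [:: [:: 1, 2 & index_iota k.+1 n.+1], [:: 3; k] & column 4 k].

Definition unordered_pair_eq (S T U V : tableau) : Prop :=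
  (S = U /\ T = V) \/ (S = V /\ T = U).

Definition exceptional_pair (n : nat) (S T : tableau) : Prop :=
  (exists2 k, 2 <= k <= n - 2 &
     unordered_pair_eq S T (typeA_hook n k) (typeA_nonhook n k)) \/
  (exists2 k, 4 <= k <= n &
     unordered_pair_eq S T (typeB_hook n k) (typeB_nonhook n k)).

(* Main.v *)
Require Import Defs.
From HB Require Import structures.
From mathcomp Require Import all_boot all_fingroup.
From mathcomp Require Import zify.
From Stdlib Require Import Classical.

(** Permutations are handled as standard words, one for each one-line notation,
    and a Knuth class as the class of a word under Knuth moves. Neither Knuth
    moves nor swaps change the inverse descents of a word.

    From swaps to patterns ([contains_knuth]). Let [w] contain a word of the
    swap closed set and let [w'] arise from [w] by a Knuth move. The occurrence
    survives unless it uses the two letters that the move exchanges. If it also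
    uses the third letter of the move, apply the same move to the occurrence.
    Otherwise the two letters are adjacent in it: either some letter of the
    occurrence lies strictly between them in value, so that exchanging them is a
    swap, or the third letter of the move can stand in for one of them.

    Descent sets and tableaux. Building an insertion tableau one box at a time,
    the inverse descents say whether the next box lies below the last one. For
    the end intervals this leaves one tableau, a superstandard hook; for the
    inner intervals and their complements it leaves a single choice between two
    boxes, and the two outcomes are an exceptional pair or its transpose
    ([classify_row] and the lemmas after it). Since swaps preserve inverse
    descents, the sets described by descents are swap closed.

    From patterns to tableaux. Write [forces a b] if every word that is Knuth
    equivalent to a word containing [a] up to Knuth equivalence itself contains
    [a] or [b] up to Knuth equivalence; closedness says that the two reading
    words force each other. The test words are built from layered words, which
    are increasing concatenations of decreasing runs, and from their reversals.
    A layered word is determined by its run lengths, a composition, and its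
    subwords are again layered. Every word occurs in a word that is Knuth
    equivalent to a layered one ([layered_universal]); hence a word [a] in no
    layered class forces [b] into a layered class. If [a] is in no reversed
    layered class either, then [b] is in classes of both kinds, so it is a hook
    ([layered_skew_layered_hook]), and counting runs excludes this
    ([forces_hook]). Unless [a] itself is a hook, this leaves, up to reversal,
    [a] in the class of the reversed layered word of a composition [c] and [b]
    in the class of the layered word of a composition [e].

    If [c] is not a hook, it contains a core, namely consecutive parts
    [1, k, 1] or [k, 1, ..., 1, l] with [k, l >= 2]. For each core some layered
    word is equivalent to a word containing the reversed layered word of the
    core. Sandwiched between the reversed layered words of the remaining parts
    of [c] it becomes a word that cannot contain the class of [a], because the
    class of the core is not layered while the middle part is; so it contains
    the class of [b] ([core_fits]). This leaves so few choices for [e] that,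
    after applying the same to complements and with [e] in place of [c], one of
    the two compositions is [1, ..., 1, k, 1, ..., 1] with a single 1 on at
    least one side, and the other has the complementary partial sums
    ([forces_paired]). Then both words have the inverse descents of an
    exceptional pair. *)

Set Implicit Arguments.
Unset Strict Implicit.
Unset Printing Implicit Defensive.

(** * Knuth equivalence of words *)

Lemma filter_none (p : pred nat) w : (forall x, x \in w -> ~~ p x) -> filter p w = [::].
Proof.
move=> h; apply/eqP; rewrite -size_eq0 size_filter -leqn0 leqNgt -has_count.
exact/hasPn.
Qed.

Inductive knuth : seq nat -> seq nat -> Prop :=
| KnuthL u v x y z : x < y < z ->
    knuth (u ++ [:: y; x; z] ++ v) (u ++ [:: y; z; x] ++ v)
| KnuthR u v x y z : x < y < z ->
    knuth (u ++ [:: x; z; y] ++ v) (u ++ [:: z; x; y] ++ v)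
| KnuthRefl w : knuth w w
| KnuthSym w w' : knuth w w' -> knuth w' w
| KnuthTrans w1 w2 w3 : knuth w1 w2 -> knuth w2 w3 -> knuth w1 w3.

#[local] Hint Resolve KnuthRefl : core.

Lemma knuth_ctx u v w w' : knuth w w' -> knuth (u ++ w ++ v) (u ++ w' ++ v).
Proof.
elim=> {w w'} [p q x y z xyz|p q x y z xyz|w|w w' _ /KnuthSym //|w1 w2 w3 _ h _].
- by have := KnuthL (u ++ p) (q ++ v) xyz; rewrite -!catA.
- by have := KnuthR (u ++ p) (q ++ v) xyz; rewrite -!catA.
- by [].
- exact: KnuthTrans.
Qed.

Lemma knuth_catl u w w' : knuth w w' -> knuth (u ++ w) (u ++ w').
Proof. by move/(knuth_ctx u [::]); rewrite !cats0. Qed.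

Lemma knuth_catr v w w' : knuth w w' -> knuth (w ++ v) (w' ++ v).
Proof. exact: (@knuth_ctx [::]). Qed.

Lemma knuth_cons x w w' : knuth w w' -> knuth (x :: w) (x :: w').
Proof. exact: (@knuth_catl [:: x]). Qed.

Lemma knuth_cat u u' v v' :
  knuth u u' -> knuth v v' -> knuth (u ++ v) (u' ++ v').
Proof.
by move=> /(knuth_catr v) h /(knuth_catl u'); apply: KnuthTrans.
Qed.

Lemma knuth_perm w w' : knuth w w' -> perm_eq w w'.
Proof.
elim=> {w w'} [p q x y z _|p q x y z _|w|w w' _|w1 w2 w3 _ h _ h'].
- by apply/seq.permP => q'; rewrite !count_cat /=; lia.
- by apply/seq.permP => q'; rewrite !count_cat /=; lia.
- by [].
- by rewrite perm_sym.
- exact: perm_trans h'.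
Qed.

Lemma knuth_size w w' : knuth w w' -> size w = size w'.
Proof. by move/knuth_perm/perm_size. Qed.

Lemma knuth_uniq w w' : knuth w w' -> uniq w = uniq w'.
Proof. by move/knuth_perm/perm_uniq. Qed.

Lemma knuth_mem w w' : knuth w w' -> w =i w'.
Proof. by move/knuth_perm/perm_mem. Qed.

Lemma knuth_rev w w' : knuth w w' -> knuth (rev w) (rev w').
Proof.
elim=> {w w'} [p q x y z xyz|p q x y z xyz|w|w w' _ /KnuthSym //|w1 w2 w3 _ h _].
- rewrite !rev_cat -!catA /=; apply: KnuthSym.
  exact: (@KnuthR (rev q) (rev p) x y z).
- rewrite !rev_cat -!catA /=; apply: KnuthSym.
  exact: (@KnuthL (rev q) (rev p) x y z).
- by [].
- exact: KnuthTrans.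
Qed.

Lemma knuth_map (f : nat -> nat) w w' :
  knuth w w' -> {in w &, {homo f : x y / x < y}} -> knuth (map f w) (map f w').
Proof.
elim=> {w w'} [p q x y z /andP[xy yz] fM|p q x y z /andP[xy yz] fM|w|w w' k h fM|w1 w2 w3 k h _ h' fM].
- rewrite !map_cat /=; apply: KnuthL.
  by rewrite !fM // !(mem_cat, inE) eqxx ?orbT.
- rewrite !map_cat /=; apply: KnuthR.
  by rewrite !fM // !(mem_cat, inE) eqxx ?orbT.
- by [].
- apply/KnuthSym/h => x y; rewrite !(knuth_mem k); exact: fM.
- apply: KnuthTrans (h fM) (h' _) => x y; rewrite -!(knuth_mem k); exact: fM.
Qed.

Lemma knuth_map_anti (f : nat -> nat) w w' :
  knuth w w' -> {in w &, {homo f : x y /~ x < y}} -> knuth (map f w) (map f w').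
Proof.
elim=> {w w'} [p q x y z /andP[xy yz] fM|p q x y z /andP[xy yz] fM|w|w w' k h fM|w1 w2 w3 k h _ h' fM].
- rewrite !map_cat /=; apply/KnuthSym/KnuthL.
  by rewrite !fM // !(mem_cat, inE) eqxx ?orbT.
- rewrite !map_cat /=; apply/KnuthSym/KnuthR.
  by rewrite !fM // !(mem_cat, inE) eqxx ?orbT.
- by [].
- apply/KnuthSym/h => x y; rewrite !(knuth_mem k); exact: fM.
- apply: KnuthTrans (h fM) (h' _) => x y; rewrite -!(knuth_mem k); exact: fM.
Qed.

(** The letters that survive may be cut at both ends but not thinned out: the
    witness [y] of a Knuth move on [x] and [z] lies between them. *)
Lemma knuth_filter (p : pred nat) w w' :
  (forall x y z, x < y < z -> p x -> p z -> p y) ->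
  knuth w w' -> knuth (filter p w) (filter p w').
Proof.
move=> pC; elim=> {w w'} [u v x y z xyz|u v x y z xyz|w|w w' _ /KnuthSym //|w1 w2 w3 _ h _].
- rewrite !filter_cat; apply: knuth_ctx => /=.
  have := pC _ _ _ xyz; case: (p x) (p z) => -[]; last by [].
  + by move=> ->//; apply: (@KnuthL [::] [::]).
  + by [].
  + by [].
- rewrite !filter_cat; apply: knuth_ctx => /=.
  have := pC _ _ _ xyz; case: (p x) (p z) => -[]; last by [].
  + by move=> ->//; apply: (@KnuthR [::] [::]).
  + by [].
  + by [].
- by [].
- exact: KnuthTrans.
Qed.

(** Above an increasing run, the larger of two letters can jump over the run
    because the smaller one witnesses each move. *)
Lemma knuth_max_left I m n v : sorted ltn I -> all (ltn^~ n) I -> n < m ->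
  knuth (I ++ m :: n :: v) (m :: I ++ n :: v).
Proof.
move=> + + nm; elim/last_ind: I n nm v => [|I x IH] n nm v //.
rewrite all_rcons /= -cats1 (sorted_pairwise ltn_trans) pairwise_cat allrel1r.
case/and3P=> aIx; rewrite -(sorted_pairwise ltn_trans) => sI _ /andP[xn aI].
have xnm : x < n < m by rewrite xn.
rewrite -!catA; apply: KnuthTrans (KnuthR I v xnm) _.
by apply: IH => //; apply: ltn_trans nm.
Qed.

(** The letter [a] to the left of the decreasing run witnesses the last move, and
    the letters of the run witness the others. *)
Lemma knuth_max_right a E m v : sorted gtn E -> all (ltn^~ a) E -> a < m ->
  knuth (a :: E ++ m :: v) (a :: m :: E ++ v).
Proof.
elim: E a => [|e E IH] a // sE /= /andP[ea aE] am.
have em : e < m by apply: ltn_trans am.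
have sE' : sorted gtn E by apply: path_sorted sE.
have aE' : all (ltn^~ e) E.
  by have := order_path_min (rev_trans ltn_trans) sE.
apply: KnuthTrans (knuth_cons a (IH e sE' aE' em)) _.
by apply: (@KnuthL [::]); rewrite ea.
Qed.

Lemma knuth_min_left a B x v : sorted ltn (a :: B) -> x < a ->
  knuth (a :: B ++ x :: v) (a :: x :: B ++ v).
Proof.
elim: B a => [|b B IH] a // /= /andP[ab sB] xa.
apply: KnuthTrans (knuth_cons a (IH b sB _)) _; first exact: ltn_trans ab.
by apply/KnuthSym/(@KnuthL [::]); rewrite xa.
Qed.

(** * Schensted insertion *)

(** Insertion into one row. The bumped letter is kept as a word of length at most
    one, so that the bumped letters of successive insertions concatenate to the
    word inserted into the next row. *)
Fixpoint row_step (r : seq nat) (x : nat) : seq nat * seq nat :=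
  if r is a :: r' then
    if x < a then (x :: r', [:: a])
    else let p := row_step r' x in (a :: p.1, p.2)
  else ([:: x], [::]).

Fixpoint row_steps (r w : seq nat) : seq nat * seq nat :=
  if w is x :: w' then
    let p := row_step r x in
    let q := row_steps p.1 w' in (q.1, p.2 ++ q.2)
  else (r, [::]).

Definition insert_word (w : seq nat) : tableau := foldl row_insert [::] w.

Lemma row_insert_step r T x :
  row_insert (r :: T) x =
  (row_step r x).1 :: foldl row_insert T (row_step r x).2.
Proof.
rewrite /=; set p := fun y => x < y.
suff [e1 e2] : (if find p r < size r then set_nth 0 r (find p r) x else rcons r x)
      = (row_step r x).1
    /\ (if find p r < size r then [:: nth 0 r (find p r)] else [::])
      = (row_step r x).2.
  by rewrite -e1 -e2; case: ifP.
elim: r => [|a r [IH1 IH2]] //=.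
have -> : p a = (x < a) by [].
case: (x < a) => //=; rewrite ltnS -IH1 -IH2.
by case: (find p r < size r).
Qed.

Lemma foldl_row_insert r T w :
  foldl row_insert (r :: T) w =
  (row_steps r w).1 :: foldl row_insert T (row_steps r w).2.
Proof.
elim: w r T => [|x w IH] r T //.
by rewrite [foldl _ _ _]/= -/(row_insert (r :: T) x) row_insert_step IH /= foldl_cat.
Qed.

Lemma row_steps_cat r u v :
  row_steps r (u ++ v) =
  ((row_steps (row_steps r u).1 v).1,
   (row_steps r u).2 ++ (row_steps (row_steps r u).1 v).2).
Proof.
elim: u r => [|x u IH] r /=; first by case: row_steps.
by rewrite IH catA.
Qed.

Lemma row_step_perm r x :
  perm_eq ((row_step r x).1 ++ (row_step r x).2) (x :: r).
Proof.
elim: r => [|a r IH] //=; case: ltnP => _ /=.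
  by rewrite perm_cons perm_catC.
apply/seq.permP => q; have /seq.permP/(_ q) := IH.
by rewrite /= !count_cat /=; lia.
Qed.

Lemma row_steps_perm r w :
  perm_eq ((row_steps r w).1 ++ (row_steps r w).2) (r ++ w).
Proof.
apply/seq.permP => q; elim: w r => [|x w IH] r /=; first by rewrite !cats0.
have /seq.permP/(_ q) := row_step_perm r x; have := IH (row_step r x).1.
by rewrite /= !count_cat /=; lia.
Qed.

Lemma row_step_mem r x y : y \in (row_step r x).1 -> (y == x) || (y \in r).
Proof.
move=> h; have /perm_mem/(_ y) := row_step_perm r x.
by rewrite mem_cat h inE.
Qed.

Lemma row_step_sorted r x : sorted ltn r -> x \notin r ->
  sorted ltn (row_step r x).1.
Proof.
elim: r => [|a r IH] //= pr; rewrite inE negb_or => /andP[xa xr].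
case: ltnP => [xlt|ax] /=.
  by case: r pr {IH xr} => //= b r /andP[ab ->]; rewrite (ltn_trans xlt ab).
have alt : a < x by rewrite ltn_neqAle eq_sym xa.
rewrite path_sortedE; last exact: ltn_trans.
rewrite IH ?(path_sorted pr) // andbT; apply/allP=> y /row_step_mem.
case/orP=> [/eqP->//|yr].
by move: pr; rewrite path_sortedE => [/andP[/allP/(_ y yr)]|]; last exact: ltn_trans.
Qed.

Lemma uniq_row_step r x s : uniq (r ++ x :: s) -> uniq ((row_step r x).1 ++ s).
Proof.
move=> h; apply: (subseq_uniq (s2 := ((row_step r x).1 ++ (row_step r x).2) ++ s)).
  by rewrite -catA; apply: cat_subseq => //; apply: suffix_subseq.
have /perm_uniq <- // : perm_eq (r ++ x :: s)
   (((row_step r x).1 ++ (row_step r x).2) ++ s).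
apply/seq.permP => q; have /seq.permP/(_ q) := row_step_perm r x.
by rewrite /= !count_cat /=; lia.
Qed.

Lemma row_steps_sorted r w : sorted ltn r -> uniq (r ++ w) ->
  sorted ltn (row_steps r w).1.
Proof.
elim: w r => [|x w IH] r //= sr u; apply: IH; last exact: uniq_row_step.
apply: row_step_sorted => //.
by move: u; rewrite cat_uniq /= negb_or => /and3P[_ /andP[]].
Qed.

Lemma row_step_bump r x : sorted ltn r ->
  (row_step r x).2 = [::] \/
  exists2 b, (row_step r x).2 = [:: b] & b \in r /\ x < b.
Proof.
elim: r => [|a r IH] /= pr; first by left.
case: ltnP => [xa|_] /=; first by right; exists a => //; rewrite inE eqxx.
case: (IH (path_sorted pr)) => [->|[b -> [br xb]]]; first by left.
by right; exists b => //; rewrite inE br orbT.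
Qed.

(** The larger letter stops to the right of the smaller one, where the entries are
    larger. *)
Lemma row_step_incr r y z : sorted ltn r -> uniq (r ++ [:: y; z]) -> y < z ->
  (row_step (row_step r y).1 z).2 = [::] \/
  exists b d, [/\ (row_step r y).2 = [:: b],
    (row_step (row_step r y).1 z).2 = [:: d], b < d, y < b & b \in r].
Proof.
elim: r => [|a r IH] /= sr u yz; first by rewrite ltnNge ltnW //=; left.
have sr' := path_sorted sr.
case: (ltnP y a) => [ya|ay] /=.
  rewrite ltnNge ltnW //=.
  case: (row_step_bump z sr') => [->|[d -> [dr _]]]; [by left|right].
  exists a, d; split=> //; last by rewrite inE eqxx.
  by move: sr; rewrite path_sortedE => [/andP[/allP/(_ d dr)]|]; last exact: ltn_trans.
have za : (z < a) = false by rewrite ltnNge (leq_trans ay) // ltnW.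
rewrite za /=; case: IH => [|||->|[b [d [-> -> bd yb br]]]] //; [|by left|right].
  by case/andP: u.
by exists b, d; split=> //; rewrite inE br orbT.
Qed.

(** The larger letter, inserted first, leaves an entry above the smaller one. *)
Lemma row_step_decr r y z : sorted ltn r -> uniq (r ++ [:: y; z]) -> y < z ->
  exists e, [/\ (row_step (row_step r z).1 y).2 = [:: e], e <= z, y < e
    & (e == z) || (e \in r)].
Proof.
elim: r => [|a r IH] /= sr u yz; first by rewrite yz /=; exists z; split; rewrite ?eqxx.
have sr' := path_sorted sr.
case: (ltnP z a) => [za|az] /=; first by rewrite yz /=; exists z; split; rewrite ?eqxx.
have ay : y != a.
  by move: u; rewrite mem_cat !inE !negb_or => /andP[/and3P[_ /negbTE h _] _]; rewrite eq_sym h.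
case: (ltnP y a) => [ya|ay'] /=; first by exists a; split; rewrite ?inE ?eqxx ?orbT.
case: IH => [|||e [-> ez ye eM]] //; first by case/andP: u.
by exists e; split; rewrite // inE orbCA eM orbT.
Qed.

Lemma sorted_cons_lt a r b : sorted ltn (a :: r) -> b \in r -> a < b.
Proof.
by rewrite /= path_sortedE => [/andP[/allP h _ /h]|]; last exact: ltn_trans.
Qed.

Lemma row_step_size r x : (size r <= size (row_step r x).1) && (0 < size (row_step r x).1).
Proof.
elim: r => [|a r /andP[IH _]] //=; case: ifP => _ /=; first by rewrite ltnSn.
by rewrite andbT ltnS.
Qed.

Lemma row_steps_size r w :
  (size r <= size (row_steps r w).1) && ((w == [::]) || (0 < size (row_steps r w).1)).
Proof.
elim: w r => [|x w IH] r /=; first by rewrite leqnn.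
have /andP[h1 h2] := row_step_size r x.
have /andP[h3 _] := IH (row_step r x).1.
by rewrite (leq_trans h1 h3) (leq_trans h2 h3).
Qed.

(** Induction along the row: as long as all three letters pass an entry nothing
    happens, and once [x] stops the bumped letters form again an elementary
    Knuth move, or become equal because one of them was never bumped. *)
Lemma row_steps_knuthL r x y z : sorted ltn r -> uniq (r ++ [:: x; y; z]) ->
  x < y < z ->
  (row_steps r [:: y; x; z]).1 = (row_steps r [:: y; z; x]).1 /\
  knuth (row_steps r [:: y; x; z]).2 (row_steps r [:: y; z; x]).2.
Proof.
move=> sr u /andP[xy yz]; have xz := ltn_trans xy yz.
elim: r sr u => [|a r IH] sr u.
  by rewrite /= xy /= [z < y]ltnNge (ltnW yz) /= xy [z < x]ltnNge (ltnW xz).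
have sr' := path_sorted sr; have u' : uniq (r ++ [:: x; y; z]) by case/andP: u.
have uyz : uniq (r ++ [:: y; z]).
  apply: subseq_uniq u'; apply: cat_subseq => //=.
  by rewrite ifN ?eqxx // neq_ltn xy orbT.
have ax : a != x.
  by move: u; rewrite cons_uniq mem_cat !inE !negb_or => /andP[/and3P[_ h _] _].
have [xa|xa] := ltnP x a; last first.
  have ax' : a < x by rewrite ltn_neqAle ax.
  have nya : (y < a) = false by rewrite ltnNge ltnW // (ltn_trans ax').
  have nza : (z < a) = false by rewrite ltnNge ltnW // (ltn_trans ax').
  have nxa : (x < a) = false by rewrite ltnNge ltnW.
  case: (IH sr' u') => /= e k; rewrite nya /= nxa /= nza /= nxa /= ?cats0.
  by move: e k; rewrite /= ?cats0 => -> k; split.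
have [ya|ya] := ltnP y a.
  have nzy : (z < y) = false by rewrite ltnNge ltnW.
  have nzx : (z < x) = false by rewrite ltnNge ltnW.
  rewrite /= ya /= xy /= nzx /= nzy /= xy /= ?cats0; split=> //.
  case: (row_step_bump z sr') => [->//|[d -> [dr _]]].
  have ad := sorted_cons_lt sr dr.
  by apply: (@KnuthL [::] [::]); rewrite ya.
have nya : (y < a) = false by rewrite ltnNge ya.
have nza : (z < a) = false by rewrite ltnNge ltnW // (leq_ltn_trans ya).
have nzx : (z < x) = false by rewrite ltnNge ltnW.
rewrite /= nya /= xa /= nzx /= nza /= xa /= ?cats0; split=> //.
case: (row_step_incr sr' uyz yz) => [->|[b [d [-> -> bd yb br]]]]; first by [].
apply: (@KnuthL [::] [::]).
by rewrite bd (sorted_cons_lt sr br).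
Qed.

Lemma row_steps_knuthR r x y z : sorted ltn r -> uniq (r ++ [:: x; y; z]) ->
  x < y < z ->
  (row_steps r [:: x; z; y]).1 = (row_steps r [:: z; x; y]).1 /\
  knuth (row_steps r [:: x; z; y]).2 (row_steps r [:: z; x; y]).2.
Proof.
move=> sr u /andP[xy yz]; have xz := ltn_trans xy yz.
have nyx : (y < x) = false by rewrite ltnNge ltnW.
have nzx : (z < x) = false by rewrite ltnNge ltnW.
elim: r sr u => [|a r IH] sr u.
  by rewrite /= nzx /= nyx /= yz /= xz /= nyx.
have sr' := path_sorted sr; have u' : uniq (r ++ [:: x; y; z]) by case/andP: u.
have uyz : uniq (r ++ [:: y; z]).
  apply: subseq_uniq u'; apply: cat_subseq => //=.
  by rewrite ifN ?eqxx // neq_ltn xy orbT.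
have [ax az] : a != x /\ a != z.
  by move: u; rewrite cons_uniq mem_cat !inE !negb_or => /andP[/and4P[_ h _ h'] _].
have [xa|xa] := ltnP x a; last first.
  have ax' : a < x by rewrite ltn_neqAle ax.
  have nya : (y < a) = false by rewrite ltnNge ltnW // (ltn_trans ax').
  have nza : (z < a) = false by rewrite ltnNge ltnW // (ltn_trans ax').
  have nxa : (x < a) = false by rewrite ltnNge ltnW.
  case: (IH sr' u') => /= e k; rewrite nxa /= nza /= nya /= nxa /= nya /= ?cats0.
  by move: e k; rewrite /= ?cats0 => -> k; split.
have [za|za] := ltnP z a.
  rewrite /= xa za /= nzx xz /= nyx /=.
  case: r sr sr' {IH u u' uyz} => [|d r] /= sr sr'; first by rewrite yz /=.
  have [ad dr] := andP sr; have zd := ltn_trans za ad.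
  rewrite zd /= yz (ltn_trans yz zd) /=; split=> //.
  by apply/KnuthSym/(@KnuthL [::] [::]); rewrite za.
have nza : (z < a) = false by rewrite ltnNge za.
rewrite /= xa /= nzx /= nyx /= nza /= xa /= nyx /= ?cats0; split=> //.
case: (row_step_decr sr' uyz yz) => e [-> ez ye eM].
case: (row_step_bump z sr') => [->//|[d -> [dr zd]]].
have ae : a < e.
  case/orP: eM => [/eqP->|er]; last exact: sorted_cons_lt sr er.
  by rewrite ltn_neqAle az.
by apply: (@KnuthR [::] [::]); rewrite ae (leq_ltn_trans ez).
Qed.

Lemma row_steps_uniq r p t v : uniq (r ++ p ++ t ++ v) -> uniq ((row_steps r p).1 ++ t).
Proof.
rewrite !catA cat_uniq => /and3P[U _ _].
apply: (@subseq_uniq _ _ (((row_steps r p).1 ++ (row_steps r p).2) ++ t)).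
  by rewrite -catA; apply: cat_subseq => //; apply: suffix_subseq.
by rewrite (perm_uniq (s2 := (r ++ p) ++ t)) // perm_cat2r row_steps_perm.
Qed.

Lemma row_steps_knuth r u v : sorted ltn r -> uniq (r ++ u) -> knuth u v ->
  (row_steps r u).1 = (row_steps r v).1 /\
  knuth (row_steps r u).2 (row_steps r v).2.
Proof.
move=> sr + k; elim: k => {u v} [p q x y z xyz|p q x y z xyz|w|w w' k h|w1 w2 w3 k h k' h'] U //.
- have sp : sorted ltn (row_steps r p).1.
    by apply: row_steps_sorted => //; move: U; rewrite catA cat_uniq => /and3P[].
  have U1 : uniq ((row_steps r p).1 ++ [:: x; y; z]).
    rewrite (perm_uniq (s2 := (row_steps r p).1 ++ [:: y; x; z])); first exact: row_steps_uniq U.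
    by rewrite perm_cat2l; apply/permPl; apply: (perm_catCA [:: x] [:: y] [:: z]).
  have [e k] := row_steps_knuthL sp U1 xyz.
  by rewrite !row_steps_cat -e; split=> //=; apply/knuth_catl/knuth_catr.
- have sp : sorted ltn (row_steps r p).1.
    by apply: row_steps_sorted => //; move: U; rewrite catA cat_uniq => /and3P[].
  have U1 : uniq ((row_steps r p).1 ++ [:: x; y; z]).
    rewrite (perm_uniq (s2 := (row_steps r p).1 ++ [:: x; z; y])); first exact: row_steps_uniq U.
    by rewrite perm_cat2l perm_cons; apply/permPl; apply: (perm_catC [:: y] [:: z]).
  have [e k] := row_steps_knuthR sp U1 xyz.
  by rewrite !row_steps_cat -e; split=> //=; apply/knuth_catl/knuth_catr.
- case: h => [|-> k']; last by split=> //; apply: KnuthSym.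
  by rewrite (perm_uniq (perm_cat (perm_refl r) (knuth_perm k))).
- case: (h U) => -> k1; case: h' => [|-> k2]; last by split=> //; apply: KnuthTrans k2.
  by rewrite -(perm_uniq (perm_cat (perm_refl r) (knuth_perm k))).
Qed.

(** Each row turns Knuth equivalent words into Knuth equivalent words of bumped
    letters, so the equality of insertion tableaux descends row by row. *)
Lemma foldl_row_insert_knuth T u v :
  all (sorted ltn) T -> uniq (flatten T ++ u) -> knuth u v ->
  foldl row_insert T u = foldl row_insert T v.
Proof.
have [n] := ubnP (size T + size u); elim: n T u v => // n IH [|r T] u v.
  case: u => [|x u] leN _ U k.
    by move/knuth_size: k; case: v.
  case: v k => [/knuth_size//|y v] k.
  have e w (z : nat) : foldl row_insert [::] (z :: w) =
     (row_steps [::] (z :: w)).1 :: foldl row_insert [::] (row_steps [::] (z :: w)).2.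
    by rewrite -[LHS]/(foldl row_insert [:: [:: z]] w) foldl_row_insert.
  rewrite !e; have [-> k'] := row_steps_knuth (r := [::]) isT U k.
  congr cons; apply: IH => //.
    have /perm_size := row_steps_perm [::] (x :: u).
    have := row_steps_size [::] (x :: u); move: leN; rewrite size_cat /=; lia.
  have /perm_uniq := row_steps_perm [::] (x :: u); rewrite cat_uniq U => /and3P[] //.
move=> leN /= /andP[sr sT] U k; rewrite !foldl_row_insert.
have U1 : uniq (r ++ u).
  by apply: subseq_uniq U; rewrite -catA; apply: cat_subseq => //; apply: suffix_subseq.
have [-> k'] := row_steps_knuth sr U1 k; congr cons; apply: IH => //.
  have /perm_size := row_steps_perm r u; have := row_steps_size r u.
  by move: leN; rewrite !size_cat /=; lia.
have /perm_uniq := perm_cat (perm_refl (flatten T)) (row_steps_perm r u).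
have -> : uniq (flatten T ++ r ++ u).
  by move: U; rewrite -catA uniq_catCA.
rewrite uniq_catCA cat_uniq => /and3P[_ _ ->] //.
Qed.

(** * Tableaux and their row words *)

(** Column strictness between consecutive rows, together with the decrease of
    their lengths. *)
Fixpoint dominates (r s : seq nat) {struct s} : bool :=
  match s, r with
  | [::], _ => true
  | b :: s', a :: r' => (a < b) && dominates r' s'
  | _ :: _, [::] => false
  end.

Fixpoint is_tableau (T : tableau) : bool :=
  if T is r :: T' then
    [&& r != [::], sorted ltn r, dominates r (head [::] T') & is_tableau T']
  else true.

Definition row_word (T : tableau) : seq nat := flatten (rev T).

Lemma row_word_cons r T : row_word (r :: T) = row_word T ++ r.
Proof. by rewrite /row_word rev_cons flatten_rcons. Qed.

Lemma perm_row_word T : perm_eq (row_word T) (flatten T).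
Proof.
elim: T => // r T IH; rewrite row_word_cons perm_catC /=.
by rewrite perm_cat2l.
Qed.

Lemma is_tableau_sorted T : is_tableau T -> all (sorted ltn) T.
Proof. by elim: T => //= r T IH /and4P[_ -> _ /IH]. Qed.

Lemma dominates_row_step r x s : sorted ltn r -> x \notin r -> dominates r s ->
  dominates (row_step r x).1 s.
Proof.
elim: r s => [|a r IH] [|b s] //= pr; rewrite inE negb_or => /andP[xa xr].
case/andP=> ab rs; case: ltnP => [xlt|ax] /=.
  by rewrite (ltn_trans xlt).
by rewrite ab IH // (path_sorted pr).
Qed.

(** The bumped letter lands weakly to the left in the next row, below an entry
    that has become smaller. *)
Lemma dominates_bump r x s b : sorted ltn r -> x \notin r -> dominates r s ->
  sorted ltn s -> b \notin s ->
  (row_step r x).2 = [:: b] -> dominates (row_step r x).1 (row_step s b).1.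
Proof.
elim: r s => [|a r IH] s //= pr; rewrite inE negb_or => /andP[xa xr].
case: ltnP => [xlt|ax] /=.
  move=> + ss bs [eb]; rewrite -eb in bs *.
  case: s bs ss => [|c s] //=; first by rewrite xlt.
  by move=> _ _ /andP[-> rs] /=; rewrite xlt.
have sr := path_sorted pr.
move=> rs ss bs eb.
have [e|[b' eb' [br xb]]] := row_step_bump x sr; first by rewrite e in eb.
move: eb'; rewrite eb => -[e]; rewrite -{b'}e in br xb *.
have ab : a < b by apply: sorted_cons_lt pr br.
case: s rs ss bs => [|c s] //=; first by rewrite ab.
case/andP=> ac rs ps; rewrite inE negb_or => /andP[bc bs].
case: ltnP => [blt|cb] /=.
  by rewrite ab dominates_row_step.
by rewrite ac IH // (path_sorted ps).
Qed.

Lemma row_step_neq0 r x : (row_step r x).1 != [::].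
Proof. by case: r => //= a r; case: ifP. Qed.

(** Within one row, moving the new letter to the place of the letter that it bumps
    is a sequence of Knuth moves on the row read before the bumped letter. *)
Lemma row_insert_tableau T x : is_tableau T -> uniq (x :: flatten T) ->
  is_tableau (row_insert T x) /\
  knuth (row_word (row_insert T x)) (row_word T ++ [:: x]).
Proof.
elim: T x => [|r T IH] x; first by [].
rewrite row_insert_step => /= /and4P[r0 sr rT tT].
rewrite cat_uniq mem_cat negb_or => /and4P[/andP[xr xT] ur /hasPn rd uT].
have rowk : knuth (r ++ [:: x]) ((row_step r x).2 ++ (row_step r x).1).
  elim: r sr xr {r0 rT ur rd} => [|a r IHr] //= pr; rewrite inE negb_or => /andP[xa xr].
  case: ltnP => [xlt|ax] /=; first by have := knuth_min_left [::] pr xlt; rewrite cats0.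
  have sr := path_sorted pr.
  have := knuth_cons a (IHr sr xr).
  have [->//|[b eb [br xb]]] := row_step_bump x sr; rewrite eb /=.
  move=> k; apply: KnuthTrans k _.
  have sr' := row_step_sorted sr xr.
  have : perm_eq ((row_step r x).1 ++ [:: b]) (x :: r) by rewrite -eb row_step_perm.
  case er : (row_step r x).1 sr' => [|h r'] sr' pe.
    by have := row_step_neq0 r x; rewrite er.
  apply: (@KnuthR [::] r' a h b).
  have hx : h <= x.
    have : x \in (h :: r') ++ [:: b] by rewrite (perm_mem pe) inE eqxx.
    rewrite mem_cat !inE => /orP[/orP[/eqP->//|xr']|/eqP e].
      exact: ltnW (sorted_cons_lt sr' xr').
    by rewrite e ltnn in xb.
  rewrite (leq_ltn_trans hx xb) andbT.
  have : h \in x :: r by rewrite -(perm_mem pe) inE eqxx.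
  rewrite inE => /orP[/eqP->|]; last exact: sorted_cons_lt pr.
  by rewrite ltn_neqAle ax eq_sym xa.
have [e|[b eb [br xb]]] := row_step_bump x sr.
  rewrite e /= row_word_cons row_step_neq0 row_step_sorted // dominates_row_step //.
  by split=> //; rewrite row_word_cons -catA; apply/knuth_catl/KnuthSym; move: rowk; rewrite e.
have bT : b \notin flatten T by apply/negP => /rd; rewrite br.
case: (IH b tT) => [|tTb kTb]; first by rewrite /= bT.
rewrite eb /= row_step_neq0 row_step_sorted // tTb !andbT; split.
  move: rT tT bT {IH kTb tTb rd uT xT}; case: T => [|s T].
    by move=> _ _ _; rewrite /= ; exact: (@dominates_bump r x [::] b).
  rewrite row_insert_step /= => rs /and4P[_ ss _ _]; rewrite mem_cat negb_or => /andP[bs _].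
  exact: dominates_bump.
rewrite !row_word_cons -catA; apply: KnuthTrans (knuth_catr _ kTb) _.
by rewrite -catA; apply/knuth_catl/KnuthSym; move: rowk; rewrite eb.
Qed.

Lemma insert_word_rcons w x : insert_word (rcons w x) = row_insert (insert_word w) x.
Proof. by rewrite /insert_word foldl_rcons. Qed.

Lemma insert_word_tableau w : uniq w ->
  is_tableau (insert_word w) /\ knuth (row_word (insert_word w)) w.
Proof.
elim/last_ind: w => [|w x IH]; first by [].
rewrite rcons_uniq insert_word_rcons => /andP[xw uw]; have [t k] := IH uw.
have U : uniq (x :: flatten (insert_word w)).
  by rewrite cons_uniq -(perm_mem (perm_row_word _)) (knuth_mem k) xw
     -(perm_uniq (perm_row_word _)) (knuth_uniq k).
have [t' k'] := row_insert_tableau t U.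
split=> //; apply: KnuthTrans k' _; rewrite -cats1; exact: knuth_catr.
Qed.

Lemma insert_word_knuth u v : uniq u -> knuth u v -> insert_word u = insert_word v.
Proof. by move=> U; apply: foldl_row_insert_knuth. Qed.

Lemma insert_word_eq u v : uniq u -> uniq v ->
  insert_word u = insert_word v -> knuth u v.
Proof.
move=> /insert_word_tableau[_ ku] /insert_word_tableau[_ kv] e.
by apply: KnuthTrans kv; rewrite -e; apply: KnuthSym.
Qed.

(** A row inserted over a dominated row bumps it entry by entry; [p] is the part
    already placed. *)
Lemma row_steps_dominated p r s : sorted ltn (p ++ r) -> dominates r s ->
  row_steps (p ++ s) r = (p ++ r, s).
Proof.
elim: r p s => [|x r IH] p [|b s] //= spr.
  rewrite !cats0; set t := p.
  have -> : row_step p x = (rcons p x, [::]).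
    elim: p {t} spr => //= a p IHp pa.
    have ax : a < x.
      by apply: sorted_cons_lt pa _; rewrite mem_cat inE eqxx orbT.
    by rewrite ltnNge ltnW //= IHp // (path_sorted pa).
  by have := IH (rcons p x) [::]; rewrite cats0 cat_rcons => ->.
case/andP=> xb rs.
have -> : row_step (p ++ b :: s) x = (rcons p x ++ s, [:: b]).
  elim: p spr => [|a p IHp] /= pa; first by rewrite xb.
  have ax : a < x.
    by apply: sorted_cons_lt pa _; rewrite mem_cat inE eqxx orbT.
  by rewrite ltnNge ltnW //= IHp // (path_sorted pa).
by rewrite /= IH ?cat_rcons.
Qed.

Lemma insert_row T r : is_tableau (r :: T) -> foldl row_insert T r = r :: T.
Proof.
elim: T r => [|s T IH] r tT0; have /and4P[r0 sr rs tT] := tT0.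
  case: r r0 sr {rs tT tT0} => // x r _ sr.
  rewrite -[LHS]/(foldl row_insert [:: [:: x]] r) foldl_row_insert.
  by have := @row_steps_dominated [:: x] r [::] sr; rewrite cats0 => ->.
by rewrite foldl_row_insert (@row_steps_dominated [::]) //= IH.
Qed.

Lemma insert_row_word T : is_tableau T -> insert_word (row_word T) = T.
Proof.
elim: T => // r T IH tT; rewrite row_word_cons /insert_word foldl_cat.
by rewrite -/(insert_word _) IH ?insert_row //; case/and4P: tT.
Qed.

Lemma dominates_size r s : dominates r s -> size s <= size r.
Proof. by elim: s r => [|b s IH] [|a r] //= /andP[_ /IH]. Qed.

Lemma dominatesP r s :
  reflect (size s <= size r /\ forall j, j < size s -> nth 0 r j < nth 0 s j)
          (dominates r s).
Proof.
apply: (iffP idP) => [h|[+ h]].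
  split; first exact: dominates_size.
  by elim: s r h => [|b s IH] [|a r] //= /andP[ab /IH h] [|j] //=; apply: h.
elim: s r h => [|b s IH] [|a r] //= h sz; rewrite (h 0) //=.
by apply: IH => // j js; apply: (h j.+1).
Qed.

Lemma is_SYT_tableau n T : is_SYT n T <->
  is_tableau T && perm_eq (flatten T) (iota 1 n).
Proof.
split=> [[n0 sh sT cT pT]|/andP[tT pT]]; rewrite ?pT.
  rewrite andbT; elim: T n0 sh sT cT {pT} => //= r T IH.
  rewrite inE negb_or eq_sym => /andP[-> n0] sh /andP[-> sT] cT /=.
  rewrite IH ?(path_sorted sh) //; last by move=> i j; apply: (cT i.+1).
  rewrite andbT; apply/dominatesP; case: T n0 sh sT cT {IH} => [|s T] //= _ sh _ cT.
  by split=> [|j js]; [case/andP: sh|apply: (cT 0)].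
split=> //; clear pT; last 1 first.
- elim: T tT => [|r T IH] //= /and4P[_ _ rT tT] [|i] j //=; last by move/IH: tT; apply.
  case: T rT tT {IH} => [|s T] //= /dominatesP[_ h] _ _; exact: h.
- by elim: T tT => //= r T IH /and4P[r0 _ _ /IH]; rewrite inE negb_or eq_sym r0.
- elim: T tT => //= r T IH /and4P[_ _ rT /IH] {IH}.
  by case: T rT => //= s T /dominates_size -> ->.
- exact: is_tableau_sorted.
Qed.

(** * Restricting a tableau to its small entries *)

Definition restrict (m : nat) (T : tableau) : tableau :=
  [seq r <- [seq filter (ltn^~ m) r | r <- T] | r != [::]].

Lemma restrict_cons m r T : restrict m (r :: T) =
  if filter (ltn^~ m) r == [::] then restrict m T
  else filter (ltn^~ m) r :: restrict m T.
Proof. by rewrite /restrict /=; case: eqP. Qed.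

Lemma filter_sorted_nil m r : sorted ltn r -> filter (ltn^~ m) r = [::] ->
  all (leq m) r.
Proof.
move=> _; elim: r => //= a r IH; case: ltnP => // am /IH ->; by rewrite andbT.
Qed.

Lemma restrict_dominated m r T : is_tableau (r :: T) -> all (leq m) r ->
  restrict m T = [::].
Proof.
elim: T r => //= s T IH r /and4P[_ sr rs tT] mr.
have ms : all (leq m) s.
  elim: s r rs mr {sr tT IH} => [|b s IHs] [|a r] //= /andP[ab rs] /andP[ma mr].
  by rewrite (leq_trans ma (ltnW ab)) (IHs r).
rewrite restrict_cons (IH _ tT ms); suff -> : filter (ltn^~ m) s = [::] by [].
by elim: s ms {rs tT} => //= b s IHs /andP[mb /IHs ->]; rewrite ltnNge mb.
Qed.

Lemma filter_row_step m r x : sorted ltn r ->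
  filter (ltn^~ m) (row_step r x).1 =
    (if x < m then (row_step (filter (ltn^~ m) r) x).1 else filter (ltn^~ m) r) /\
  filter (ltn^~ m) (row_step r x).2 =
    (if x < m then (row_step (filter (ltn^~ m) r) x).2 else [::]).
Proof.
elim: r => [|a r IH] /= pr; first by case: ifP.
have ge b : m <= a -> b \in r -> (b < m) = false.
  move=> ma br; apply/negbTE; rewrite -leqNgt (leq_trans ma) // ltnW //.
  exact: sorted_cons_lt pr br.
have fr : m <= a -> filter (ltn^~ m) r = [::].
  move=> ma; rewrite (eq_in_filter (a2 := pred0)) ?filter_pred0 // => b br; exact: ge.
case: ltnP => [xa|ax] /=; case: (ltnP a m) => am /=.
- by rewrite (ltn_trans xa am) /= xa.
- by rewrite fr //; case: ltnP.
- have [e1 e2] := IH (path_sorted pr); rewrite e1 e2.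
  by case: (x < m); rewrite /= ?[x < a]ltnNge ?ax.
- have [e1 e2] := IH (path_sorted pr); by rewrite e1 e2 fr.
Qed.

Lemma restrict_row_insert m T x : is_tableau T -> uniq (x :: flatten T) ->
  restrict m (row_insert T x) =
  if x < m then row_insert (restrict m T) x else restrict m T.
Proof.
elim: T x => [|r T IH] x; first by move=> _ _; rewrite /= /restrict /=; case: ltnP.
move=> tT; have /and4P[r0 sr rT tT'] := tT.
rewrite /= cat_uniq mem_cat negb_or => /and4P[/andP[xr xT] ur /hasPn rd uT].
have := filter_row_step m x sr; rewrite -/(row_insert (r :: T) x) row_insert_step.
have sr' := row_step_sorted sr xr.
rewrite !restrict_cons => -[-> e2].
have IH2 : restrict m (foldl row_insert T (row_step r x).2) =
   foldl row_insert (restrict m T) (filter (ltn^~ m) (row_step r x).2).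
  have [->//|[b -> [br xb]] /=] := row_step_bump x sr.
  rewrite IH //; last by rewrite /= uT andbT; apply/negP=> /rd; rewrite br.
  by case: ifP.
rewrite IH2 e2; case: ltnP => // xm.
case: eqP => [/eqP|_]; first by rewrite (negPf (row_step_neq0 _ _)).
case: eqP => [fr|_]; last by rewrite row_insert_step.
by rewrite fr /= (restrict_dominated tT (filter_sorted_nil sr fr)).
Qed.

Lemma restrict_insert_word m w : uniq w ->
  restrict m (insert_word w) = insert_word (filter (ltn^~ m) w).
Proof.
elim/last_ind: w => [|w x IH]; first by [].
rewrite rcons_uniq => /andP[xw uw]; have [t k] := insert_word_tableau uw.
rewrite insert_word_rcons restrict_row_insert //; last first.
  by rewrite cons_uniq -(perm_mem (perm_row_word _)) (knuth_mem k) xw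
     -(perm_uniq (perm_row_word _)) (knuth_uniq k).
by rewrite filter_rcons IH //=; case: (x < m); rewrite ?insert_word_rcons.
Qed.

(** * Inverse descents and growing tableaux *)

Definition standard (n : nat) (w : seq nat) : bool := perm_eq w (iota 1 n).

(** The letter [i.+1] stands to the left of [i]; phrased as the subword on these
    two letters because Knuth equivalence passes to such subwords. *)
Definition inv_desc (w : seq nat) (i : nat) : bool :=
  [seq x <- w | i <= x <= i.+1] == [:: i.+1; i].

Lemma knuth_small w w' : knuth w w' -> size w <= 2 -> w = w'.
Proof.
elim=> {w w'} [u v x y z _|u v x y z _|//|w w' k h s|w1 w2 w3 k h _ h' s].
- by rewrite !size_cat /=; lia.
- by rewrite !size_cat /=; lia.
- by rewrite h // (knuth_size k).
- by rewrite h // h' // -(knuth_size k).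
Qed.

Lemma filter_pair w i : uniq w -> size [seq x <- w | i <= x <= i.+1] <= 2.
Proof.
move=> uw; have : {subset [seq x <- w | i <= x <= i.+1] <= [:: i; i.+1]}.
  by move=> x; rewrite mem_filter !inE => /andP[? _]; lia.
by move/(uniq_leq_size (filter_uniq _ uw)).
Qed.

(** The two letters [i] and [i.+1] are consecutive, so deleting all others is
    compatible with Knuth moves, and no move applies to two letters. *)
Lemma inv_desc_knuth w w' i : uniq w -> knuth w w' -> inv_desc w i = inv_desc w' i.
Proof.
move=> uw k; rewrite /inv_desc.
suff -> : [seq x <- w | i <= x <= i.+1] = [seq x <- w' | i <= x <= i.+1] by [].
apply: knuth_small; last exact: filter_pair.
by apply: knuth_filter k => x y z; lia.
Qed.

Lemma standard_uniq n w : standard n w -> uniq w.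
Proof. by move/perm_uniq->; apply: iota_uniq. Qed.

Lemma standard_mem n w x : standard n w -> (x \in w) = (0 < x <= n).
Proof. by move/perm_mem->; rewrite mem_iota add1n ltnS. Qed.

Lemma standard_size n w : standard n w -> size w = n.
Proof. by move/perm_size->; rewrite size_iota. Qed.

Lemma standard_knuth n w w' : knuth w w' -> standard n w = standard n w'.
Proof. by move/knuth_perm => k; rewrite /standard; apply: permPl. Qed.

Fixpoint add_row (i m : nat) (U : tableau) : tableau :=
  match U, i with
  | [::], _ => [:: [:: m]]
  | r :: U', 0 => rcons r m :: U'
  | r :: U', i'.+1 => r :: add_row i' m U'
  end.

Lemma restrict_all m T : is_tableau T -> all (ltn^~ m) (flatten T) -> restrict m T = T.
Proof.
elim: T => //= r T IH /and4P[r0 _ _ tT]; rewrite all_cat => /andP[ar aT].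
by rewrite restrict_cons (all_filterP ar) (negPf r0) IH.
Qed.

(** The largest entry of a tableau ends a row; removing it leaves a tableau from
    which the original is recovered by adding one box. *)
Lemma restrict_max T m : is_tableau T -> uniq (flatten T) -> m \in flatten T ->
  all (leq^~ m) (flatten T) ->
  exists2 i, i <= size (restrict m T) & T = add_row i m (restrict m T).
Proof.
elim: T => //= r T IH tT; have /and4P[r0 sr rT tT'] := tT.
rewrite cat_uniq mem_cat all_cat => /and3P[ur /hasPn rd uT] mT /andP[ar aT].
rewrite restrict_cons; have [mr|mr] := boolP (m \in r); last first.
  have {}mT : m \in flatten T by rewrite (negPf mr) in mT.
  have [i le_i e] := IH tT' uT mT aT.
  have -> : filter (ltn^~ m) r = r.
    apply/all_filterP/allP => x xr /=; rewrite ltn_neqAle (allP ar _ xr) andbT.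
    by apply: contraNneq mr => <-.
  by rewrite (negPf r0); exists i.+1; rewrite //= -e.
have aT' : all (ltn^~ m) (flatten T).
  apply/allP => x xT /=; rewrite ltn_neqAle (allP aT _ xT) andbT.
  by apply: contraTneq mr => <-; apply: rd.
exists 0 => //; rewrite (restrict_all tT' aT').
case/lastP: r => [//|r x] in tT r0 sr rT ur mr rd ar mT *.
have xm : x = m.
  apply/eqP; rewrite eqn_leq (allP ar) ?mem_rcons ?inE ?eqxx //=.
  move: mr; rewrite mem_rcons inE => /orP[/eqP->//|mr].
  move: sr; rewrite -cats1 (sorted_pairwise ltn_trans) pairwise_cat allrel1r.
  by case/andP=> /allP/(_ m mr)/ltnW.
rewrite xm in tT sr rT ur *.
have -> : filter (ltn^~ m) (rcons r m) = r.
  rewrite filter_rcons /= ltnn; apply/all_filterP/allP => y yr /=.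
  move: sr; rewrite -cats1 (sorted_pairwise ltn_trans) pairwise_cat allrel1r.
  by case/andP=> /allP/(_ y yr).
case: eqP => // r_0; rewrite {}r_0 in rT *.
case: T rT tT' aT' {IH tT uT mT aT rd} => //= -[|b s] T //= /andP[mb _] _.
by rewrite ltnNge (ltnW mb).
Qed.

Lemma inv_desc_add_row i j m U : 0 < m -> i <= size U -> uniq (flatten U) ->
  all (ltn^~ m) (flatten U) -> m.-1 \in nth [::] U j ->
  inv_desc (row_word (add_row i m U)) m.-1 = (j < i).
Proof.
move=> m0; rewrite /inv_desc prednK //.
have fr r : uniq r -> all (ltn^~ m) r ->
   [seq x <- r | m.-1 <= x <= m] = if m.-1 \in r then [:: m.-1] else [::].
  move=> ur /allP ar.
  have -> : [seq x <- r | m.-1 <= x <= m] = filter (pred1 m.-1) r.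
    by apply: eq_in_filter => x /ar /=; lia.
  case: ifPn => [|mr]; first exact: filter_pred1_uniq.
  by apply/eqP; rewrite -size_eq0 size_filter -leqn0 leqNgt -has_count has_pred1.
have frw U' : uniq (flatten U') -> all (ltn^~ m) (flatten U') ->
   [seq x <- row_word U' | m.-1 <= x <= m]
   = if m.-1 \in flatten U' then [:: m.-1] else [::].
  move=> uU' aU'; rewrite fr ?(perm_uniq (perm_row_word _)) //.
    by rewrite (perm_mem (perm_row_word _)).
  by rewrite (perm_all _ (perm_row_word _)).
elim: U i j => [|r U IH] i j; first by rewrite nth_nil.
case: i => [|i] le_i /=.
  move=> uU aU jU; rewrite row_word_cons -cats1 catA filter_cat -row_word_cons.
  rewrite frw //= leq_pred leqnn; case: ifP => _; case: eqP => // -[]; lia.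
rewrite cat_uniq all_cat => /and3P[ur /hasPn rd uU] /andP[ar aU].
rewrite row_word_cons filter_cat; case: j => [|j] /= jU; last first.
  have jU' : m.-1 \in flatten U.
    apply/flattenP; exists (nth [::] U j) => //; apply: mem_nth.
    by case: ltnP => // h; rewrite nth_default in jU.
  by rewrite (fr r) // (negPf (rd _ jU')) cats0 (IH i j).
rewrite (fr r) // jU.
have mU : m.-1 \notin flatten U by apply/negP=> /rd; rewrite jU.
suff -> : [seq x <- row_word (add_row i m U) | m.-1 <= x <= m] = [:: m] by rewrite eqxx.
elim: U i mU uU aU {IH rd le_i} => [|s U IH] [|i] /=; rewrite ?leq_pred ?leqnn //.
  move=> mU uU aU; rewrite row_word_cons -cats1 catA filter_cat -row_word_cons frw //.
  by rewrite /= (negPf mU) leq_pred leqnn.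
rewrite mem_cat negb_or cat_uniq all_cat => /andP[ms mU] /and3P[us _ uU] /andP[as_ aU].
by rewrite row_word_cons filter_cat (fr s) // (negPf ms) cats0 IH.
Qed.

Section Growth.
Variables (n : nat) (w : seq nat).
Hypothesis w_std : standard n w.

(** The insertion tableaux of the subwords on the letters [1, ..., m] grow by
    one box at a time, and the inverse descents tell whether the next box lies
    below the last one. *)
Definition grown (m : nat) : tableau := insert_word [seq x <- w | x <= m].

Lemma grown_tableau m : is_tableau (grown m).
Proof. by have [] := insert_word_tableau (filter_uniq (leq^~ m) (standard_uniq w_std)). Qed.

Lemma grown_full : grown n = insert_word w.
Proof.
congr insert_word; apply/all_filterP/allP => x.
by rewrite (standard_mem _ w_std) => /andP[].
Qed.

Lemma grown0 : grown 0 = [::].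
Proof.
rewrite /grown (_ : filter _ w = [::]) //.
by apply: filter_none => x; rewrite (standard_mem _ w_std) -ltnNge => /andP[].
Qed.

Lemma grownS m : m < n ->
  exists i, [/\ i <= size (grown m), grown m.+1 = add_row i m.+1 (grown m)
   & forall j, m \in nth [::] (grown m) j -> inv_desc w m = (j < i)].
Proof.
move=> mn; have uw := standard_uniq w_std.
have := insert_word_tableau (filter_uniq (leq^~ m.+1) uw).
rewrite -/(grown m.+1) => -[t k].
have mem x : (x \in flatten (grown m.+1)) = (x <= m.+1) && (x \in w).
  by rewrite -(perm_mem (perm_row_word _)) (knuth_mem k) mem_filter.
have e : restrict m.+1 (grown m.+1) = grown m.
  rewrite restrict_insert_word ?filter_uniq // -filter_predI; congr insert_word.
  by apply: eq_filter => x /=; lia.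
case: (restrict_max (m := m.+1) t) => [|||i].
- by rewrite -(perm_uniq (perm_row_word _)) (knuth_uniq k) filter_uniq.
- by rewrite mem leqnn (standard_mem _ w_std).
- by apply/allP=> x; rewrite mem => /andP[].
rewrite e => le_i ei; exists i; split=> // j jm.
have [t' k'] := insert_word_tableau (filter_uniq (leq^~ m) uw).
rewrite -/(grown m) in t' k'.
rewrite -(inv_desc_add_row (m := m.+1) (U := grown m)) //; last 2 first.
- by rewrite -(perm_uniq (perm_row_word _)) (knuth_uniq k') filter_uniq.
- apply/allP=> x; rewrite -(perm_mem (perm_row_word _)) (knuth_mem k') mem_filter.
  by case/andP.
rewrite -ei /= -(inv_desc_knuth _ _ (KnuthSym k)) ?filter_uniq //; last first.
rewrite /inv_desc -filter_predI; congr (_ == _); apply: eq_filter => x /=; lia.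
Qed.

Lemma grown_row r V a b : a \in r -> a <= b <= n ->
  grown a = r :: V -> (forall i, a <= i < b -> ~~ inv_desc w i) ->
  grown b = (r ++ iota a.+1 (b - a)) :: V.
Proof.
move=> + /andP[ab bn]; rewrite -(subnKC ab) in bn *; move: (b - a) bn => d.
rewrite addKn; elim: d a r {b ab} => [|d IH] a r bn ar ea ndesc.
  by rewrite addn0 /= cats0.
have an : a < n by lia.
have [i [le_i ei di]] := grownS an.
have i0 : i = 0.
  have := ndesc a; rewrite (di 0) ?ea // -leqNgt leqn0 => h; apply/eqP/h; lia.
rewrite addnS -addSn (IH a.+1 (rcons r a.+1)) ?cat_rcons //.
- by lia.
- by rewrite mem_rcons inE eqxx.
- by rewrite ei i0 ea.
by move=> k h; apply: ndesc; lia.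
Qed.

Lemma grown_column U r a b : a \in r -> a <= b <= n ->
  grown a = rcons U r -> (forall i, a <= i < b -> inv_desc w i) ->
  grown b = rcons U r ++ [seq [:: x] | x <- iota a.+1 (b - a)].
Proof.
move=> + /andP[ab bn]; rewrite -(subnKC ab) in bn *; move: (b - a) bn => d.
rewrite addKn; elim: d a U r {b ab} => [|d IH] a U r bn ar ea desc.
  by rewrite addn0 /= cats0.
have an : a < n by lia.
have [i [le_i ei di]] := grownS an.
have i0 : i = size (grown a).
  have := desc a; rewrite (di (size U)); last by rewrite ea nth_rcons ltnn eqxx.
  move: le_i; rewrite ea size_rcons => ? h; apply/eqP; rewrite eqn_leq h; lia.
have addE (V : tableau) m : add_row (size V) m V = rcons V [:: m].
  by elim: V => //= s V ->.
rewrite addnS -addSn (IH a.+1 (rcons U r) [:: a.+1]) ?inE //.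
- by rewrite cat_rcons.
- by lia.
- by rewrite ei i0 ea addE.
by move=> k h; apply: desc; lia.
Qed.
End Growth.

Notation singles C := [seq [:: x : nat] | x <- C].

(** A hook has three places for a new box: the end of the arm, the inner corner
    and the foot of the leg. *)
Lemma hook_corner i m r C : is_tableau (add_row i m (r :: singles C)) ->
  i <= (size C).+1 -> [\/ i = 0, [/\ i = 1, 1 < size r & C != [::]] | i = (size C).+1].
Proof.
case: i => [|i]; first by constructor 1.
move=> /= /and4P[_ _ rC tC]; rewrite ltnS; case: i rC tC => [|i].
  case: C => [|c C] /=; first by constructor 3.
  move=> rC _ _; constructor 2; split=> //.
  by case: r rC => [|a [|b r]] //=; rewrite andbF.
move=> _ tC iC; constructor 3; congr S.
elim: C i tC iC => [|c C IH] // i /= /andP[cC tC]; rewrite ltnS.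
case: i cC tC => [|i] cC tC iC; last by congr S; apply: IH.
by case: C cC {tC IH iC} => //= d C; rewrite andbF.
Qed.

Lemma rcons_singles C x : rcons (singles C) [:: x] = singles (rcons C x).
Proof. by rewrite map_rcons. Qed.

Lemma iota_rcons a m : iota a m.+1 = rcons (iota a m) (a + m).
Proof. by rewrite -cats1 -addn1 iotaD. Qed.

Lemma iota_lastE a m : 0 < m -> iota a m = rcons (iota a m.-1) (a + m.-1).
Proof. by case: m => // m _; rewrite iota_rcons. Qed.

Lemma add_row_last U m : add_row (size U) m U = rcons U [:: m].
Proof. by elim: U => //= r U ->. Qed.

Lemma last_singles r C x : x \in nth [::] (r :: singles (rcons C x)) (size C).+1.
Proof. by rewrite /= map_rcons nth_rcons size_map ltnn eqxx inE. Qed.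

Lemma transpose_hook h r C : transpose ((h :: r) :: singles C) = (h :: C) :: singles r.
Proof.
have e j : [seq nth 0 s j.+1 | s <- singles C & j.+1 < size s] = [::].
  by elim: C => //= c C ->.
rewrite /transpose /mkseq -[iota 0 _]/(0 :: iota (1 + 0) (size r)).
rewrite map_cons iotaDl -map_comp.
congr (_ :: _).
  by rewrite /=; congr (_ :: _); elim: C {e} => //= c C ->.
have -> : singles r = [seq [:: nth 0 r j] | j <- iota 0 (size r)].
  by rewrite -[in LHS](mkseq_nth 0 r) /mkseq -map_comp.
apply/eq_in_map => j; rewrite mem_iota /= => jr.
by rewrite /= !add1n ltnS jr /= e.
Qed.

Lemma transpose_near h a r c d C :
  transpose ((h :: a :: r) :: [:: c; d] :: singles C)
  = (h :: c :: C) :: [:: a; d] :: singles r.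
Proof.
have e j : [seq nth 0 s j.+1 | s <- singles C & j.+1 < size s] = [::].
  by elim: C => //= x C ->.
have e0 : [seq nth 0 s 0 | s <- singles C & 0 < size s] = C.
  by elim: C {e} => //= x C ->.
rewrite /transpose /mkseq -[iota 0 _]/(0 :: 1 :: iota (2 + 0) (size r)).
rewrite !map_cons iotaDl -map_comp /= e e0; congr [:: _, _ & _].
have -> : singles r = [seq [:: nth 0 r j] | j <- iota 0 (size r)].
  by rewrite -[in LHS](mkseq_nth 0 r) /mkseq -map_comp.
apply/eq_in_map => j; rewrite mem_iota /= => jr.
by rewrite /= !add2n !ltnS jr /= e.
Qed.

Lemma transpose_typeA_hook n k : 2 <= k <= n - 2 ->
  transpose (typeA_hook n k) =
  (1 :: iota k.+1 (n - k.+1)) :: singles (rcons (iota 2 k.-1) n).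
Proof.
move=> kn; rewrite /typeA_hook /column /index_iota subn1.
by case: k kn => // k _; rewrite /= transpose_hook.
Qed.

Lemma transpose_typeA_nonhook n k : 2 <= k <= n - 2 ->
  transpose (typeA_nonhook n k) =
  (1 :: iota k.+1 (n - k.+1)) :: [:: 2; n] :: singles (iota 3 (k - 2)).
Proof.
move=> kn; rewrite /typeA_nonhook /column /index_iota subn1.
case: k kn => [|[|k]] // kn; rewrite /= transpose_near subn2 /=.
by rewrite (_ : n - k.+3 = (n - k.+4).+1) //; lia.
Qed.

Lemma transpose_typeB_hook n k : 4 <= k <= n ->
  transpose (typeB_hook n k) =
  (1 :: iota 3 (k - 3)) :: singles (2 :: iota k (n.+1 - k)).
Proof. by move=> kn; rewrite /typeB_hook /column /index_iota transpose_hook. Qed.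

Lemma transpose_typeB_nonhook n k : 4 <= k <= n ->
  transpose (typeB_nonhook n k) =
  (1 :: iota 3 (k - 3)) :: [:: 2; k] :: singles (iota k.+1 (n - k)).
Proof.
move=> kn; rewrite /typeB_nonhook /column /index_iota transpose_near subSS.
by rewrite (_ : k - 3 = (k - 4).+1) //; lia.
Qed.

Section Classify.
Variables (n : nat) (w : seq nat).
Hypothesis w_std : standard n w.

Lemma grown1 : 0 < n -> grown w 1 = [:: [:: 1]].
Proof.
move=> n0; have [i [+ -> _]] := grownS w_std n0.
by rewrite (grown0 w_std) /= leqn0 => /eqP->.
Qed.

(** The box after a single column can only go to the right of the column's top
    unless it lengthens the column. *)
Lemma grown_turn h C a : last h C = a -> a < n ->
  grown w a = [:: h] :: singles C -> ~~ inv_desc w a ->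
  grown w a.+1 = [:: h; a.+1] :: singles C.
Proof.
move=> la an ea nd; have [i [le_i ei di]] := grownS w_std an.
have tT := grown_tableau w_std a.+1.
rewrite ea /= size_map in le_i; rewrite ei ea in tT *.
case: (hook_corner tT le_i) => [-> //|[]//|i_e]; case/negP: nd.
rewrite (di (size C)) ?i_e // ea.
elim/last_ind: C la {ea le_i ei tT i_e di} => [|C x _] /=; first by move=> ->; rewrite inE.
by rewrite last_rcons size_rcons map_rcons /= nth_rcons size_map ltnn eqxx inE => ->.
Qed.

Lemma classify_row k : 0 < k <= n ->
  (forall i, 0 < i < n -> inv_desc w i = (k <= i)) ->
  insert_word w = iota 1 k :: singles (iota k.+1 (n - k)).
Proof.
case/andP=> k0 kn D; have n0 : 0 < n by apply: leq_trans kn.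
rewrite -(grown_full w_std).
have e1 : grown w k = [:: iota 1 k].
  rewrite (grown_row w_std (a := 1) (b := k) (V := [::]) (r := [:: 1])) ?inE ?k0 ?grown1 //.
    by case: (k) k0 => // k' _; rewrite subn1.
  by move=> i h; rewrite D; lia.
rewrite (grown_column w_std (a := k) (b := n) (U := [::]) (r := iota 1 k)) ?kn ?leqnn //.
  by rewrite mem_iota; lia.
by move=> i h; rewrite D; lia.
Qed.

Lemma grown_first_column k : 0 < k <= n ->
  (forall i, 0 < i < k -> inv_desc w i) ->
  grown w k = [:: 1] :: singles (iota 2 k.-1).
Proof.
case/andP=> k0 kn D; have n0 : 0 < n by apply: leq_trans kn.
rewrite (grown_column w_std (a := 1) (b := k) (U := [::]) (r := [:: 1])) ?inE ?k0 ?grown1 //.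
by rewrite subn1.
Qed.

Lemma classify_column k : 0 < k <= n ->
  (forall i, 0 < i < n -> inv_desc w i = (i < k)) ->
  insert_word w = (1 :: iota k.+1 (n - k)) :: singles (iota 2 k.-1).
Proof.
case/andP=> k0 kn D; rewrite -(grown_full w_std).
have e1 : grown w k = [:: 1] :: singles (iota 2 k.-1).
  by apply: grown_first_column => [|i h]; [rewrite k0|rewrite D; lia].
move: kn; rewrite leq_eqVlt => /orP[/eqP kn|kn].
  by rewrite -kn e1 subnn.
have e2 : grown w k.+1 = [:: 1; k.+1] :: singles (iota 2 k.-1).
  apply: grown_turn => //; last by rewrite D; lia.
  by case: (k) k0 => [|[|k']] // _; rewrite [k'.+2.-1]/= iota_rcons last_rcons.
rewrite (grown_row w_std (a := k.+1) (b := n) _ _ e2) ?inE ?eqxx ?orbT //; last 2 first.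
- by rewrite kn leqnn.
- by move=> i h; rewrite D; lia.
by rewrite /= -(subnKC kn) addKn addSn -addnS addKn.
Qed.

(** Up to the letter [n - 1] the tableau is a hook. As [n - 1] is no inverse
    descent, [n] does not go to the foot of the leg, which leaves the end of the
    arm and the inner corner. *)
Lemma classify_typeA k : 2 <= k <= n - 2 ->
  (forall i, 0 < i < n -> inv_desc w i = (k <= i <= n - 2)) ->
  insert_word w = typeA_hook n k \/ insert_word w = typeA_nonhook n k.
Proof.
move=> kn D; rewrite -(grown_full w_std).
have e1 : grown w k = [:: iota 1 k].
  rewrite (grown_row w_std (a := 1) (b := k) (V := [::]) (r := [:: 1])) ?inE ?grown1 //;
    try by lia.
  - by case: (k) kn => // k' _; rewrite subn1.
  - by move=> i h; rewrite D; lia.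
have e2 : grown w n.-1 = iota 1 k :: singles (iota k.+1 (n.-1 - k)).
  rewrite (grown_column w_std (a := k) (b := n.-1) (U := [::]) (r := iota 1 k)) //.
  - by rewrite mem_iota; lia.
  - lia.
  - by move=> i h; rewrite D; lia.
have n1 : n.-1 < n by lia.
have [i [le_i ei di]] := grownS w_std n1; rewrite prednK in ei; last by lia.
have tT := grown_tableau w_std n; rewrite ei e2 in tT.
rewrite e2 /= size_map in le_i.
have ix1 : index_iota 1 k.+1 = iota 1 k by rewrite /index_iota subn1.
have ix2 : index_iota k.+1 n = iota k.+1 (n.-1 - k) by rewrite /index_iota; congr iota; lia.
case: (hook_corner tT le_i) => [i0|[i1 _ _]|i_e].
- by left; rewrite ei e2 i0 /typeA_hook /column ix1 ix2.
- right; rewrite ei e2 i1 /typeA_nonhook /column ix1.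
  have -> : n.-1 - k = (n.-1 - k).-1.+1 by lia.
  by rewrite /= /index_iota; congr (_ :: _ :: [seq [:: x] | x <- iota _ _]); lia.
have := D n.-1; rewrite (di (n.-1 - k)) ?i_e ?size_iota ?ltnS ?leqnn.
  move=> h; suff e : true = (k <= n.-1 <= n - 2) by exfalso; lia. apply: h; lia.
have e3 : iota k.+1 (n.-1 - k) = rcons (iota k.+1 (n.-1 - k).-1) n.-1.
  by rewrite iota_lastE; [congr rcons|]; lia.
have := last_singles (iota 1 k) (iota k.+1 (n.-1 - k).-1) n.-1.
by rewrite -e3 size_iota prednK -?e2 //; lia.
Qed.

(** The choice between arm and inner corner occurs at [k]. No inverse descent comes
    later, so the boxes never move down; after the inner corner they return to
    the first row, because no third box fits below a row of two boxes. *)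
Lemma classify_typeB k : 4 <= k <= n ->
  (forall i, 0 < i < n -> inv_desc w i = (2 <= i <= k - 2)) ->
  insert_word w = typeB_hook n k \/ insert_word w = typeB_nonhook n k.
Proof.
move=> kn D; rewrite -(grown_full w_std).
have e1 : grown w 2 = [:: [:: 1; 2]].
  rewrite (grown_row w_std (a := 1) (b := 2) (V := [::]) (r := [:: 1])) ?inE ?grown1 //;
    try by lia.
  by move=> i h; rewrite D; lia.
have e2 : grown w k.-1 = [:: 1; 2] :: singles (iota 3 (k - 3)).
  rewrite (grown_column w_std (a := 2) (b := k.-1) (U := [::]) (r := [:: 1; 2])) //.
  - by congr (_ :: [seq [:: x] | x <- iota _ _]); lia.
  - lia.
  - by move=> i h; rewrite D; lia.
have n1 : k.-1 < n by lia.
have [i [le_i ei di]] := grownS w_std n1; rewrite prednK in ei; last by lia.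
have tT := grown_tableau w_std k; rewrite ei e2 in tT.
rewrite e2 /= size_map in le_i.
have ix1 : index_iota 3 k = iota 3 (k - 3) by [].
case: (hook_corner tT le_i) => [i0|[i1 _ _]|i_e].
- left.
  have ek : grown w k = [:: 1; 2; k] :: singles (iota 3 (k - 3)) by rewrite ei e2 i0.
  rewrite (grown_row w_std (a := k) (b := n) _ _ ek) ?inE ?eqxx ?orbT //; last 2 first.
  + lia.
  + by move=> j h; rewrite D; lia.
  by rewrite /typeB_hook /column ix1 /index_iota subSn //; lia.
- right.
  have ek : grown w k = [:: 1; 2] :: [:: 3; k] :: singles (iota 4 (k - 4)).
    rewrite ei e2 i1; have -> : k - 3 = (k - 4).+1 by lia.
    by [].
  have : k = n \/ k < n by lia.
  case=> [kn'|kn'].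
    rewrite -kn' ek /typeB_nonhook /column /index_iota subnn /=.
    by [].
  have [j [le_j ej dj]] := grownS w_std kn'.
  have tT' := grown_tableau w_std k.+1; rewrite ej ek in tT'.
  have : inv_desc w k = false by rewrite D; lia.
  rewrite (dj 1) ?ek ?inE ?eqxx ?orbT //= => j1.
  have j0 : j = 0.
    move: j1 tT' {ej dj le_j}; case: j => [|[|j]] // _.
    by rewrite /= !andbF.
  have ek1 : grown w k.+1 = [:: 1; 2; k.+1] :: [:: 3; k] :: singles (iota 4 (k - 4)).
    by rewrite ej ek j0.
  rewrite (grown_row w_std (a := k.+1) (b := n) _ _ ek1) ?inE ?eqxx ?orbT //; last 2 first.
  + lia.
  + by move=> j' h; rewrite D; lia.
  rewrite /typeB_nonhook /column /index_iota.
  by rewrite (_ : n.+1 - k.+1 = (n - k.+1).+1) //; lia.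
have := D k.-1; rewrite (di (k - 3)) ?i_e ?size_iota ?ltnS ?leqnn.
  move=> h; suff e : true = (2 <= k.-1 <= k - 2) by exfalso; lia. apply: h; lia.
have e3 : iota 3 (k - 3) = rcons (iota 3 (k - 3).-1) k.-1.
  by rewrite iota_lastE; [congr rcons|]; lia.
have := last_singles [:: 1; 2] (iota 3 (k - 3).-1) k.-1.
by rewrite -e3 size_iota prednK -?e2 //; lia.
Qed.

Lemma classify_typeA_tr k : 2 <= k <= n - 2 ->
  (forall i, 0 < i < n -> inv_desc w i = ~~ (k <= i <= n - 2)) ->
  insert_word w = transpose (typeA_hook n k) \/
  insert_word w = transpose (typeA_nonhook n k).
Proof.
move=> kn D; rewrite -(grown_full w_std) transpose_typeA_hook ?transpose_typeA_nonhook //.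
have e1 : grown w k = [:: 1] :: singles (iota 2 k.-1).
  by apply: grown_first_column => [|i h]; [lia|rewrite D; lia].
have e2 : grown w k.+1 = [:: 1; k.+1] :: singles (iota 2 k.-1).
  apply: grown_turn => //; try lia.
  - by case: (k) kn => [|[|k']] // _; rewrite [k'.+2.-1]/= iota_rcons last_rcons.
  - by rewrite D; lia.
have e3 : grown w n.-1 = (1 :: iota k.+1 (n - k.+1)) :: singles (iota 2 k.-1).
  rewrite (grown_row w_std (a := k.+1) (b := n.-1) _ _ e2) ?inE ?eqxx ?orbT //; last 2 first.
  - lia.
  - by move=> i h; rewrite D; lia.
  by rewrite (_ : n - k.+1 = (n.-1 - k.+1).+1) //; lia.
have n1 : n.-1 < n by lia.
have [i [le_i ei di]] := grownS w_std n1; rewrite prednK in ei; last by lia.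
have tT := grown_tableau w_std n; rewrite ei e3 in tT.
rewrite e3 /= size_map in le_i.
have i0 : 0 < i.
  rewrite -(di 0) ?D; [lia|lia|].
  by rewrite e3 /= inE mem_iota; lia.
case: (hook_corner tT le_i) => [i_0|[i1 _ _]|i_e]; first by rewrite i_0 in i0.
- right; rewrite ei e3 i1; have -> : k.-1 = (k - 2).+1 by lia.
  by [].
- by left; rewrite ei e3 i_e -(size_map (fun x => [:: x])) /= add_row_last rcons_singles.
Qed.

Lemma classify_typeB_tr k : 4 <= k <= n ->
  (forall i, 0 < i < n -> inv_desc w i = ~~ (2 <= i <= k - 2)) ->
  insert_word w = transpose (typeB_hook n k) \/
  insert_word w = transpose (typeB_nonhook n k).
Proof.
move=> kn D; rewrite -(grown_full w_std) transpose_typeB_hook ?transpose_typeB_nonhook //.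
have e1 : grown w 2 = [:: 1] :: singles [:: 2].
  by rewrite grown_first_column => [||i h] //; rewrite ?D; lia.
have e2 : grown w 3 = [:: 1; 3] :: singles [:: 2].
  by apply: grown_turn; rewrite ?D //; lia.
have e3 : grown w k.-1 = (1 :: iota 3 (k - 3)) :: singles [:: 2].
  rewrite (grown_row w_std (a := 3) (b := k.-1) _ _ e2) ?inE ?eqxx ?orbT //; last 2 first.
  - lia.
  - by move=> i h; rewrite D; lia.
  by rewrite (_ : k - 3 = (k.-1 - 3).+1) //; lia.
have n1 : k.-1 < n by lia.
have [i [le_i ei di]] := grownS w_std n1; rewrite prednK in ei; last by lia.
have tT := grown_tableau w_std k; rewrite ei e3 in tT.
rewrite e3 /= in le_i.
have i0 : 0 < i.
  rewrite -(di 0) ?D; [lia|lia|].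
  by rewrite e3 /= inE mem_iota; lia.
case: (hook_corner tT le_i) => [i_0|[i1 _ _]|i_e]; first by rewrite i_0 in i0.
- right; have ek : grown w k = rcons [:: 1 :: iota 3 (k - 3)] [:: 2; k].
    by rewrite ei e3 i1.
  rewrite (grown_column w_std (a := k) (b := n) _ _ ek) ?inE ?eqxx ?orbT //; first lia.
  by move=> j h; rewrite D; lia.
- left; have ek : grown w k = rcons [:: 1 :: iota 3 (k - 3); [:: 2]] [:: k].
    by rewrite ei e3 i_e.
  rewrite (grown_column w_std (a := k) (b := n) _ _ ek) ?inE ?eqxx ?orbT //; first last.
  + by move=> j h; rewrite D; lia.
  + lia.
  by rewrite (_ : n.+1 - k = (n - k).+1) //; lia.
Qed.
End Classify.

(** * Standardization *)

Definition rank (u : seq nat) (x : nat) : nat := count (leq^~ x) u.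
Definition std (u : seq nat) : seq nat := map (rank u) u.

Lemma rank_lt u x y : y \in u -> x < y -> rank u x < rank u y.
Proof.
rewrite /rank => yu xy; elim: u yu => //= a u IH; rewrite inE => /orP[/eqP<-|yu].
  rewrite leqnn [y <= x]leqNgt xy /= add0n add1n ltnS; apply: sub_count => b /= bx.
  exact: leq_trans bx (ltnW xy).
have := IH yu; case: (leqP a x) => [ax|_]; last by move=> h; apply: ltn_addl.
by rewrite (leq_trans ax (ltnW xy)) ltn_add2l.
Qed.

Lemma rank_mono u : {in u &, {mono rank u : x y / x < y}}.
Proof.
move=> x y xu yu; have [xy|yx] := ltnP x y; first exact: rank_lt.
apply/negbTE; rewrite -leqNgt; apply: sub_count => b /= h; exact: leq_trans yx.
Qed.

Lemma mono_lt_inj (u : seq nat) (f : nat -> nat) :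
  {in u &, {homo f : x y / x < y}} -> {in u &, injective f}.
Proof.
by move=> fM x y xu yu e; case: (ltngtP x y) => // /fM => [/(_ xu yu)|/(_ yu xu)]; rewrite e ltnn.
Qed.

Lemma homo_mono (u : seq nat) (f : nat -> nat) :
  {in u &, {homo f : x y / x < y}} -> {in u &, {mono f : x y / x < y}}.
Proof.
move=> fM x y xu yu; have [xy|yx] := ltnP x y; first exact: fM.
apply/negbTE; rewrite -leqNgt; move: yx; rewrite leq_eqVlt => /orP[/eqP->//|/fM h].
by apply/ltnW/h.
Qed.

Lemma std_map f u : {in u &, {homo f : x y / x < y}} -> std (map f u) = std u.
Proof.
move=> /homo_mono fM; rewrite /std -map_comp; apply/eq_in_map => x xu /=.
rewrite /rank count_map; apply: eq_in_count => y yu /=.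
by rewrite leqNgt fM // -leqNgt.
Qed.

Lemma size_std u : size (std u) = size u.
Proof. exact: size_map. Qed.

Lemma std_uniq u : uniq (std u) = uniq u.
Proof. by apply/map_inj_in_uniq/mono_lt_inj => x y xu yu; rewrite rank_mono. Qed.

Lemma rank_bounds u x : x \in u -> 0 < rank u x <= size u.
Proof.
by move=> xu; rewrite count_size andbT -has_count; apply/hasP; exists x => /=.
Qed.

Lemma std_standard u : uniq u -> standard (size u) (std u).
Proof.
rewrite -std_uniq => U; apply: uniq_perm => //; first exact: iota_uniq.
have [//||//] := uniq_min_size (s2 := iota 1 (size u)) U => [x /mapP[y yu ->]|].
  by rewrite mem_iota; have := rank_bounds yu; lia.
by rewrite size_iota size_std.
Qed.

Lemma std_std u : std (std u) = std u.
Proof. by apply: std_map => x y xu yu; rewrite rank_mono. Qed.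

Lemma count_iota_le n x : x <= n -> count (leq^~ x) (iota 1 n) = x.
Proof.
move=> xn; rewrite -[n](subnKC xn) iotaD count_cat.
rewrite (eq_in_count (a2 := predT)) ?count_predT ?size_iota; last first.
  by move=> y; rewrite mem_iota /=; lia.
rewrite (eq_in_count (a2 := pred0)) ?count_pred0 ?addn0 //.
by move=> y; rewrite mem_iota /=; lia.
Qed.

Lemma std_id n w : standard n w -> std w = w.
Proof.
move=> sw; rewrite -[RHS]map_id; apply/eq_in_map => x xw.
rewrite /rank (seq.permP sw) count_iota_le //.
by move: xw; rewrite (standard_mem _ sw) => /andP[].
Qed.

Lemma std_rev u : std (rev u) = rev (std u).
Proof.
rewrite /std -map_rev; apply/eq_in_map => x _.
by rewrite /rank count_rev.
Qed.

Lemma knuth_std u v : uniq u -> knuth u v -> knuth (std u) (std v).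
Proof.
move=> U k; have e : std v = map (rank u) v.
  by apply/eq_in_map => x _; rewrite /rank (seq.permP (knuth_perm k)).
by rewrite e; apply: knuth_map k _ => x y xu yu; rewrite rank_mono.
Qed.

Definition above (u v : seq nat) : Prop := forall x y, x \in u -> y \in v -> y < x.

Lemma std_skew u v : above u v -> std (u ++ v) = map (addn (size v)) (std u) ++ std v.
Proof.
move=> uv; rewrite /std map_cat -map_comp; congr cat; apply/eq_in_map => x xu /=;
  rewrite /rank count_cat.
  rewrite addnC; congr addn; rewrite -(count_predT v); apply: eq_in_count => y yv /=.
  exact/ltnW/uv.
rewrite (eq_in_count (a2 := pred0)) ?count_pred0 // => y yu /=.
by apply/negbTE; rewrite -ltnNge uv.
Qed.

Lemma std_sum u v : above v u -> std (u ++ v) = std u ++ map (addn (size u)) (std v).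
Proof.
move=> vu; rewrite /std map_cat -map_comp; congr cat; apply/eq_in_map => x xu /=;
  rewrite /rank count_cat.
  rewrite [X in _ + X](eq_in_count (a2 := pred0)) ?count_pred0 ?addn0 // => y yv /=.
  by apply/negbTE; rewrite -ltnNge vu.
congr addn; rewrite -(count_predT u); apply: eq_in_count => y yu /=.
exact/ltnW/vu.
Qed.

(** Equality of classes up to the names of the letters. *)
Definition keq (u v : seq nat) : Prop := knuth (std u) (std v).

Lemma keq_refl u : keq u u. Proof. exact: KnuthRefl. Qed.
Lemma keq_sym u v : keq u v -> keq v u. Proof. exact: KnuthSym. Qed.
Lemma keq_trans v u w : keq u v -> keq v w -> keq u w. Proof. exact: KnuthTrans. Qed.

Lemma keq_size u v : keq u v -> size u = size v.
Proof. by move/knuth_size; rewrite !size_std. Qed.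

Lemma keq_uniq u v : keq u v -> uniq u = uniq v.
Proof. by move/knuth_uniq; rewrite !std_uniq. Qed.

Lemma knuth_keq u v : uniq u -> knuth u v -> keq u v.
Proof. exact: knuth_std. Qed.

Lemma keq_std u : keq (std u) u.
Proof. by rewrite /keq std_std. Qed.

Lemma keq_map f u : {in u &, {homo f : x y / x < y}} -> keq (map f u) u.
Proof. by move=> fM; rewrite /keq std_map. Qed.

Lemma keq_rev u v : keq u v -> keq (rev u) (rev v).
Proof. by rewrite /keq !std_rev; apply: knuth_rev. Qed.

Lemma addn_homo (u : seq nat) m : {in u &, {homo addn m : x y / x < y}}.
Proof. by move=> x y _ _; rewrite ltn_add2l. Qed.

Lemma keq_skew u u' v v' : above u v -> above u' v' ->
  keq u u' -> keq v v' -> keq (u ++ v) (u' ++ v').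
Proof.
move=> uv uv' ku kv; rewrite /keq !std_skew // (keq_size kv); apply: knuth_cat => //.
apply: knuth_map ku _; exact: addn_homo.
Qed.

Lemma keq_standard n u v : standard n u -> standard n v -> keq u v <-> knuth u v.
Proof. by move=> su sv; rewrite /keq (std_id su) (std_id sv). Qed.

(** The constant exceeds all letters and does not change when they are permuted. *)
Definition neg (w : seq nat) : seq nat := [seq (sumn w).+1 - x | x <- w].

Lemma leq_sumn (w : seq nat) x : x \in w -> x <= sumn w.
Proof.
elim: w => //= a w IH; rewrite inE => /orP[/eqP->|/IH h]; first exact: leq_addr.
exact: leq_trans h (leq_addl _ _).
Qed.

Lemma perm_sumn (w w' : seq nat) : perm_eq w w' -> sumn w = sumn w'.
Proof. by rewrite !sumnE => h; apply: perm_big. Qed.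

Lemma neg_anti w : {in w &, {homo (fun x => (sumn w).+1 - x) : x y /~ x < y}}.
Proof. by move=> x y xw yw xy; have := leq_sumn xw; have := leq_sumn yw; lia. Qed.

Lemma neg_uniq w : uniq w -> uniq (neg w).
Proof.
move=> U; rewrite map_inj_in_uniq // => x y /leq_sumn + /leq_sumn; lia.
Qed.

Lemma knuth_neg w w' : knuth w w' -> knuth (neg w) (neg w').
Proof.
move=> k; rewrite /neg -(perm_sumn (knuth_perm k)).
apply: knuth_map_anti k _; exact: neg_anti.
Qed.

Lemma std_anti (f g : nat -> nat) u :
  {in u &, {homo f : x y /~ x < y}} -> {in u &, {homo g : x y /~ x < y}} ->
  std (map f u) = std (map g u).
Proof.
move=> fM gM; rewrite /std -!map_comp; apply/eq_in_map => x xu /=.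
rewrite /rank !count_map; apply: eq_in_count => y yu /=.
have h (h' : nat -> nat) : {in u &, {homo h' : x y /~ x < y}} -> (h' y <= h' x) = (x <= y).
  move=> hM; case: (ltngtP x y) => [xy|yx|->]; [exact: ltnW (hM _ _ yu xu xy)| |exact: leqnn].
  by apply/negbTE; rewrite -ltnNge hM.
by rewrite !h.
Qed.

Lemma std_neg u : std (neg (std u)) = std (neg u).
Proof.
rewrite {1}/neg {2}/std -map_comp; apply: std_anti; last exact: neg_anti.
move=> x y xu yu xy /=.
apply: (@neg_anti (std u)); rewrite ?map_f //; exact: rank_lt.
Qed.

Lemma keq_neg u v : uniq u -> keq u v -> keq (neg u) (neg v).
Proof.
rewrite /keq => U k; rewrite -std_neg -(std_neg v).
by apply: knuth_std; [apply: neg_uniq; rewrite std_uniq|apply: knuth_neg].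
Qed.

Lemma keq_neg_map N u : uniq u -> (forall x, x \in u -> x <= N) ->
  keq [seq N - x | x <- u] (neg u).
Proof.
move=> U uN; rewrite /keq (std_anti (g := fun x => (sumn u).+1 - x)) //.
  by move=> x y /uN + /uN + xy; lia.
exact: neg_anti.
Qed.

Lemma keq_negK u : uniq u -> keq (neg (neg u)) u.
Proof.
move=> U; rewrite /neg -map_comp; apply: keq_map => x y xu yu xy /=.
have h z : z \in u -> (sumn u).+1 - z <= sumn [seq (sumn u).+1 - x | x <- u].
  by move=> zu; apply: leq_sumn; apply: map_f.
have := h _ xu; have := h _ yu; have := leq_sumn xu; have := leq_sumn yu; lia.
Qed.

(** * Occurrences of classes of patterns *)

Definition has_pattern (w a : seq nat) : Prop := exists2 s, subseq s w & keq s a.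

(** The hypothesis extracted from pattern-Knuth closedness, kept one-sided
    because most arguments start from occurrences of a single class. *)
Definition forces (a b : seq nat) : Prop := forall w w', uniq w -> knuth w w' ->
  has_pattern w' a -> has_pattern w a \/ has_pattern w b.

Lemma has_pattern_keq w a b : keq a b -> has_pattern w a -> has_pattern w b.
Proof. by move=> ab [s sw sa]; exists s => //; apply: keq_trans ab. Qed.

Lemma forces_keq a a' b b' : keq a a' -> keq b b' -> forces a b -> forces a' b'.
Proof.
move=> ka kb F w w' U k h; case: (F w w' U k) => [|h'|h'].
- exact: has_pattern_keq (keq_sym ka) h.
- left; exact: has_pattern_keq ka h'.
- right; exact: has_pattern_keq kb h'.
Qed.

Lemma has_pattern_rev w a : has_pattern w a -> has_pattern (rev w) (rev a).
Proof. by move=> [s sw sa]; exists (rev s); [rewrite subseq_rev|apply: keq_rev]. Qed.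

Lemma has_pattern_neg w a : uniq w -> has_pattern w a -> has_pattern (neg w) (neg a).
Proof.
move=> U [s sw sa]; exists [seq (sumn w).+1 - x | x <- s]; first exact: map_subseq.
have Us := subseq_uniq sw U.
apply: keq_trans (keq_neg Us sa); apply: keq_neg_map => // x /(mem_subseq sw)/leq_sumn.
by move/leqW.
Qed.

Lemma forces_rev a b : forces a b -> forces (rev a) (rev b).
Proof.
move=> F w w' U k /has_pattern_rev; rewrite revK => h.
case: (F (rev w) (rev w') _ (knuth_rev k) h); first by rewrite rev_uniq.
- by move/has_pattern_rev; rewrite revK; left.
- by move/has_pattern_rev; rewrite revK; right.
Qed.

Lemma has_pattern_negK w a : uniq w -> has_pattern (neg (neg w)) a -> has_pattern w a.
Proof.
move=> U [s]; rewrite /neg -map_comp => /subseqP[m].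
rewrite size_map -map_mask => sm -> sa; exists (mask m w); first exact: mask_subseq.
apply: keq_trans sa; apply: keq_sym; apply: keq_map => x y /mem_mask xw /mem_mask yw xy /=.
have h z : z \in w -> (sumn w).+1 - z <= sumn [seq (sumn w).+1 - x | x <- w].
  by move=> zu; apply: leq_sumn; apply: map_f.
have := h _ xw; have := h _ yw; have := leq_sumn xw; have := leq_sumn yw; lia.
Qed.

Lemma forces_neg a b : uniq a -> uniq b -> forces a b -> forces (neg a) (neg b).
Proof.
move=> Ua Ub F w w' U k h; have U' : uniq w' by rewrite -(knuth_uniq k).
have {}h := has_pattern_keq (keq_negK Ua) (has_pattern_neg U' h).
case: (F (neg w) (neg w') (neg_uniq U) (knuth_neg k) h) => h'; [left|right].
  exact: has_pattern_negK (has_pattern_neg (neg_uniq U) h').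
exact: has_pattern_negK (has_pattern_neg (neg_uniq U) h').
Qed.

(** * Monotone subsequences *)

Definition inc_sub (w : seq nat) (k : nat) : Prop :=
  exists s, [/\ subseq s w, sorted ltn s & size s = k].
Definition dec_sub (w : seq nat) (k : nat) : Prop :=
  exists s, [/\ subseq s w, sorted gtn s & size s = k].

Lemma subseq_catP (s u v : seq nat) : subseq s (u ++ v) ->
  exists s1 s2, [/\ s = s1 ++ s2, subseq s1 u & subseq s2 v].
Proof.
case/subseqP=> m sm ->; exists (mask (take (size u) m) u), (mask (drop (size u) m) v).
split; try exact: mask_subseq.
by rewrite -mask_cat ?cat_take_drop // size_takel // sm size_cat leq_addr.
Qed.

Lemma sorted_ltn_cat u v : sorted ltn (u ++ v) =
  [&& sorted ltn u, sorted ltn v & allrel ltn u v].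
Proof. by rewrite !(sorted_pairwise ltn_trans) pairwise_cat andbC andbA. Qed.

Lemma gtn_trans : transitive gtn. Proof. exact: (rev_trans ltn_trans). Qed.

Lemma sorted_gtn_cat u v : sorted gtn (u ++ v) =
  [&& sorted gtn u, sorted gtn v & allrel gtn u v].
Proof. by rewrite !(sorted_pairwise gtn_trans) pairwise_cat andbC andbA. Qed.

(** A subword of the triple that a move replaces may be exchanged for any increasing
    word of the same length within the same bounds. *)
Lemma inc_sub_replace u v t t' k :
  (forall m, subseq m t -> sorted ltn m -> exists m',
     [/\ subseq m' t', sorted ltn m', size m' = size m,
        forall a, all (ltn a) m -> all (ltn a) m'
      & forall a, all (ltn^~ a) m -> all (ltn^~ a) m']) ->
  inc_sub (u ++ t ++ v) k -> inc_sub (u ++ t' ++ v) k.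
Proof.
move=> H [s [/subseq_catP[s1 [s23 [-> s1u /subseq_catP[m [s2 [-> mt s2v]]]]]] + <-]].
rewrite !sorted_ltn_cat allrel_catr => /and3P[so1 /and3P[som so2 ms2] /andP[s1m s12]].
have [m' [m't som' sz lo up]] := H m mt som.
exists (s1 ++ m' ++ s2); split; last by rewrite !size_cat sz.
- by rewrite !cat_subseq.
- rewrite !sorted_ltn_cat allrel_catr so1 som' so2 s12 andbT /=.
  apply/andP; split.
    apply/allrelP => a b am bs; apply: (allP (up b _) _ am).
    by apply/allP => c cm; apply: (allrelP ms2).
  apply/allrelP => a b as1 bm; apply: (allP (lo a _) _ bm).
  by apply/allP => c cm; apply: (allrelP s1m).
Qed.

Ltac witness e L :=
  solve [exists L; split; do 3! rewrite /= ?e ?eqxx //=; move=> a; lia].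

Lemma inc_sub_knuth w w' k : knuth w w' -> inc_sub w k <-> inc_sub w' k.
Proof.
have trip (p q r : nat) (m : seq nat) : subseq m [:: p; q; r] ->
   exists b0 b1 b2, m = mask [:: b0; b1; b2] [:: p; q; r].
  by case/subseqP=> -[|b0 [|b1 [|b2 []]]] // _ ->; exists b0, b1, b2.
elim=> {w w'} [u v x y z /andP[xy yz]|u v x y z /andP[xy yz]|//|w w' _ ->//|w1 w2 w3 _ -> _ ->//];
  have xz := ltn_trans xy yz; split; apply: inc_sub_replace => m /trip[b0 [b1 [b2 ->]]];
  have nyx : (y < x) = false by [rewrite ltnNge ltnW];
  have nzy : (z < y) = false by [rewrite ltnNge ltnW];
  have nzx : (z < x) = false by [rewrite ltnNge ltnW];
  have e1 : (x == y) = false by [rewrite ltn_eqF];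
  have e2 : (y == z) = false by [rewrite ltn_eqF];
  have e3 : (x == z) = false by [rewrite ltn_eqF];
  have e4 : (y == x) = false by [rewrite gtn_eqF];
  have e5 : (z == y) = false by [rewrite gtn_eqF];
  have e6 : (z == x) = false by [rewrite gtn_eqF];
  have e := (e1, e2, e3, e4, e5, e6, xy, yz, xz);
  case: b0 b1 b2 => -[] []; rewrite /= ?nyx ?nzy ?nzx ?andbF //= => _;
  solve [witness e (Nil nat)|witness e [:: x]|witness e [:: y]|witness e [:: z]
    |witness e [:: x; y]|witness e [:: y; z]|witness e [:: x; z]].
Qed.

(** * Layered words *)

(** Decreasing runs, each above the previous one. Arbitrary letters are allowed
    because subwords of a layered word are layered with other letters. *)
Definition layers (bs : seq (seq nat)) : bool :=
  [&& [::] \notin bs, all (sorted gtn) bs & pairwise (allrel ltn) bs].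

Fixpoint blocks (o : nat) (e : seq nat) : seq (seq nat) :=
  if e is x :: e' then rev (iota o.+1 x) :: blocks (o + x) e' else [::].

Definition layered (e : seq nat) : seq nat := flatten (blocks 0 e).
Definition skew_layered (c : seq nat) : seq nat := rev (layered c).

(** The run lengths of the subwords of a layered word with run lengths [a]. *)
Definition embeds (e a : seq nat) : Prop := exists2 a', subseq a' a & all2 leq e a'.

Definition composition (e : seq nat) : bool := 0 \notin e.

Lemma layers_cons b bs : layers (b :: bs) =
  [&& b != [::], sorted gtn b, all (allrel ltn b) bs & layers bs].
Proof.
rewrite /layers /= inE negb_or eq_sym; case: (b != [::]) => //=.
by case: (sorted gtn b); case: (all (allrel ltn b) bs); rewrite ?andbF ?andbT.
Qed.

Lemma layers_above b bs : layers (b :: bs) -> above (flatten bs) b.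
Proof.
rewrite layers_cons => /and4P[_ _ /allP h _] x y /flattenP[c cb xc] yb.
exact: (allrelP (h c cb)).
Qed.

Lemma std_dec b : sorted gtn b -> std b = rev (iota 1 (size b)).
Proof.
move=> sb; have U : uniq b by apply: (sorted_uniq gtn_trans) sb => x; rewrite /= ltnn.
apply: (irr_sorted_eq gtn_trans) => [x||| x]; first by rewrite /= ltnn.
- apply: (homo_sorted_in (P := mem b) (e := gtn)) sb => [x y xb yb xy|].
    exact: rank_lt.
  exact/allP.
- by rewrite rev_sorted; exact: iota_ltn_sorted.
by rewrite mem_rev (perm_mem (std_standard U)).
Qed.

Lemma blocks_shift o p e : blocks (o + p) e = map (map (addn o)) (blocks p e).
Proof.
elim: e p => //= x e IH p; rewrite -addnA IH map_rev -addnS iotaDl.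
by [].
Qed.

Lemma layered_cons x e : layered (x :: e) = rev (iota 1 x) ++ map (addn x) (layered e).
Proof. by rewrite /layered /= -[0 + x]addnC blocks_shift map_flatten. Qed.

Lemma composition_cons x e : composition (x :: e) = (0 < x) && composition e.
Proof. by rewrite /composition inE negb_or lt0n eq_sym. Qed.

Lemma layered_standard e : standard (sumn e) (layered e).
Proof.
elim: e => // x e IH; rewrite layered_cons /standard /= iotaD perm_cat //.
  by rewrite perm_rev.
by rewrite [1 + x]addnC iotaDl perm_map.
Qed.

Lemma skew_layered_standard c : standard (sumn c) (skew_layered c).
Proof. by rewrite /standard perm_rev; apply: layered_standard. Qed.

Lemma layered_cat c1 c2 :
  layered (c1 ++ c2) = layered c1 ++ map (addn (sumn c1)) (layered c2).
Proof.
elim: c1 => [|x c1 IH]; first by rewrite map_id_in.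
rewrite cat_cons !layered_cons IH map_cat -map_comp catA; congr cat.
by apply: eq_map => y /=; rewrite addnA.
Qed.

Lemma skew_layered_cat c1 c2 : skew_layered (c1 ++ c2) =
  map (addn (sumn c1)) (skew_layered c2) ++ skew_layered c1.
Proof. by rewrite /skew_layered layered_cat rev_cat map_rev. Qed.

Lemma blocks_layers e o : composition e -> layers (blocks o e).
Proof.
elim: e o => //= x e IH o; rewrite composition_cons => /andP[x0 ce].
rewrite layers_cons IH // andbT; apply/and3P; split.
- by rewrite -size_eq0 size_rev size_iota -lt0n.
- by rewrite rev_sorted; apply: iota_ltn_sorted.
apply/allP => b bb; apply/allrelP => y z; rewrite mem_rev mem_iota => yx zb.
have : z \in flatten (blocks (o + x) e) by apply/flattenP; exists b.
rewrite -[o + x]addn0 blocks_shift -map_flatten => /mapP[t].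
by rewrite (standard_mem _ (layered_standard e)); lia.
Qed.

Lemma shape_blocks o e : shape (blocks o e) = e.
Proof. by elim: e o => //= x e IH o; rewrite size_rev size_iota IH. Qed.

Lemma layers_uniq bs : layers bs -> uniq (flatten bs).
Proof.
elim: bs => //= b bs IH L; have := layers_above L.
move: L; rewrite layers_cons => /and4P[_ sb _ L] ab.
rewrite cat_uniq IH // andbT (sorted_uniq gtn_trans) //=; last by move=> x; rewrite /= ltnn.
by apply/hasPn => x xbs; apply/negP => xb; have := ab _ _ xbs xb; rewrite ltnn.
Qed.

Lemma std_layers bs : layers bs -> std (flatten bs) = layered (shape bs).
Proof.
elim: bs => //= b bs IH L; have := layers_above L; move: L.
rewrite layers_cons => /and4P[_ sb _ L] ab.
by rewrite std_sum // IH // layered_cons std_dec.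
Qed.

Lemma layers_composition bs : layers bs -> composition (shape bs).
Proof.
elim: bs => //= b bs IH; rewrite layers_cons composition_cons lt0n size_eq0.
by case/and4P=> -> _ _ /IH.
Qed.

Lemma embeds_nil a : embeds [::] a.
Proof. by exists [::] => //; apply: sub0seq. Qed.

Lemma embeds_skip e x a : embeds e a -> embeds e (x :: a).
Proof. by case=> a' sa le; exists a' => //; apply: subseq_trans sa (subseq_cons _ _). Qed.

Lemma embeds_cons x y e a : x <= y -> embeds e a -> embeds (x :: e) (y :: a).
Proof. by move=> xy [a' sa le]; exists (y :: a'); rewrite /= ?eqxx ?xy. Qed.

Lemma layers_subseq s bs : layers bs -> subseq s (flatten bs) ->
  exists bs', [/\ layers bs', s = flatten bs' & embeds (shape bs') (shape bs)].
Proof.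
elim: bs s => [|b bs IH] s L /=.
  by case: s => // _; exists [::]; split=> //; apply: embeds_nil.
case/subseq_catP=> s1 [s2 [-> s1b s2bs]]; have ab := layers_above L.
move: L; rewrite layers_cons => /and4P[_ sb _ L].
have [bs' [L' e2 em]] := IH s2 L s2bs.
have [s10|s10] := eqVneq s1 [::].
  by exists bs'; split; [|rewrite s10|apply: embeds_skip].
exists (s1 :: bs'); split; last by apply: embeds_cons => //; apply: size_subseq.
  rewrite layers_cons s10 L' (subseq_sorted gtn_trans s1b) // !andbT.
  apply/allP=> c cb; apply/allrelP => x y xs yc; apply: ab.
    by apply: (mem_subseq s2bs); rewrite e2; apply/flattenP; exists c.
  exact: (mem_subseq s1b).
by rewrite e2.
Qed.

Lemma inv_desc_subseq w i : uniq w -> subseq [:: i.+1; i] w -> inv_desc w i.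
Proof.
move=> U s; rewrite /inv_desc eq_sym.
have h : subseq [:: i.+1; i] [seq x <- w | i <= x <= i.+1].
  by rewrite subseq_filter s /= !leqnn !leqnSn.
by rewrite -(size_subseq_leqif h) eqn_leq (size_subseq h) filter_pair.
Qed.

Lemma inv_asc_subseq w i : uniq w -> subseq [:: i; i.+1] w -> inv_desc w i = false.
Proof.
move=> U s; rewrite /inv_desc.
have h : subseq [:: i; i.+1] [seq x <- w | i <= x <= i.+1].
  by rewrite subseq_filter s /= !leqnn !leqnSn.
suff /eqP <- : [:: i; i.+1] == [seq x <- w | i <= x <= i.+1] by apply/eqP => -[]; lia.
by rewrite -(size_subseq_leqif h) eqn_leq (size_subseq h) filter_pair.
Qed.

Lemma inv_desc_rev n w i : standard n w -> 0 < i < n ->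
  inv_desc (rev w) i = ~~ inv_desc w i.
Proof.
move=> sw hi; have U := standard_uniq sw.
have mi : i \in w by rewrite (standard_mem _ sw); lia.
have mi1 : i.+1 \in w by rewrite (standard_mem _ sw); lia.
have [u [v ew]] : exists u v, w = u ++ i :: v.
  by case/splitPr: mi => u v; exists u, v.
have : (i.+1 \in u) || (i.+1 \in v).
  by move: mi1; rewrite ew mem_cat inE; case/or3P=> [->|/eqP|->]; rewrite ?orbT //; lia.
have Ur : uniq (rev w) by rewrite rev_uniq.
case/orP=> h; case/splitPr: h ew => p q ew.
  have s : subseq [:: i.+1; i] w.
    rewrite ew -catA; apply: subseq_trans (suffix_subseq _ _) => /=; rewrite eqxx.
    by rewrite sub1seq mem_cat inE eqxx orbT.
  rewrite (inv_desc_subseq U s); apply: inv_asc_subseq => //.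
  by rewrite -[[:: i; i.+1]]/(rev [:: i.+1; i]) subseq_rev.
have s : subseq [:: i; i.+1] w.
  rewrite ew; apply: subseq_trans (suffix_subseq _ _) => /=; rewrite eqxx.
  by rewrite sub1seq mem_cat inE eqxx orbT.
rewrite (inv_asc_subseq U s); apply: inv_desc_subseq => //.
by rewrite -[[:: i.+1; i]]/(rev [:: i; i.+1]) subseq_rev.
Qed.

Lemma inv_desc_map w m i : inv_desc (map (addn m) w) (m + i) = inv_desc w i.
Proof.
rewrite /inv_desc filter_map -addnS.
have -> : [:: m + i.+1; m + i] = map (addn m) [:: i.+1; i] by [].
rewrite (inj_eq (inj_map (@addnI m))); congr (_ == _); apply: eq_filter => x /=.
by rewrite !leq_add2l.
Qed.

Lemma inv_desc_filter (p : pred nat) w i : (forall x, i <= x <= i.+1 -> p x) ->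
  inv_desc (filter p w) i = inv_desc w i.
Proof.
move=> pP; rewrite /inv_desc -filter_predI; congr (_ == _); apply: eq_filter => x /=.
by case: (boolP (i <= x <= i.+1)) => // /pP ->.
Qed.

(** * Compositions and their partial sums *)

(** The partial sums of a composition, which are the values at which a new run of
    the layered word begins. *)
Fixpoint bnd (e : seq nat) (i : nat) : bool :=
  if e is x :: e' then (i == x) || (x < i) && bnd e' (i - x) else false.

Lemma inv_desc_layered e i : composition e -> 0 < i < sumn e ->
  inv_desc (layered e) i = ~~ bnd e i.
Proof.
elim: e i => [|x e IH] i; first by move=> _ /=; lia.
rewrite composition_cons => /andP[x0 ce] hi /=; have U := standard_uniq (layered_standard (x :: e)).
have sL := layered_standard e.
case: (ltngtP i x) => ix /=.
- apply: inv_desc_subseq => //; rewrite layered_cons; apply: subseq_trans (prefix_subseq _ _).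
  rewrite -[[:: i.+1; i]]/(rev [:: i; i.+1]) subseq_rev.
  have -> : x = i.-1 + (2 + (x - i.+1)) by lia.
  rewrite iotaD; apply: subseq_trans (suffix_subseq _ _).
  have -> : 1 + i.-1 = i by lia.
  by rewrite iotaD; apply: prefix_subseq.
- rewrite -IH //; last by move: hi => /=; lia.
  rewrite -(inv_desc_map (layered e) x) subnKC; last exact: ltnW.
  rewrite -(inv_desc_filter (p := fun y => x < y)); last by move=> y; lia.
  congr inv_desc; rewrite layered_cons filter_cat.
  rewrite (_ : filter _ (rev _) = [::]).
    apply/all_filterP/allP => y /mapP[t]; rewrite (standard_mem _ sL) => ? ->; lia.
  apply: filter_none => y.
  by rewrite mem_rev mem_iota; lia.
apply: inv_asc_subseq => //; rewrite layered_cons ix.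
rewrite -[[:: x; x.+1]]/([:: x] ++ [:: x.+1]); apply: cat_subseq; rewrite sub1seq.
  by rewrite mem_rev mem_iota; lia.
apply/mapP; exists 1; last by rewrite addn1.
by rewrite (standard_mem _ sL); move: hi => /=; lia.
Qed.

Lemma bnd_inj e e' : composition e -> composition e' -> sumn e = sumn e' ->
  (forall i, 0 < i < sumn e -> bnd e i = bnd e' i) -> e = e'.
Proof.
elim: e e' => [|x e IH] [|y e'] //; rewrite ?composition_cons.
- by move=> _ /andP[y0 _] /=; lia.
- by move=> /andP[x0 _] _ /=; lia.
move=> /andP[x0 ce] /andP[y0 ce'] /= es H.
have posum (c : seq nat) : composition c -> sumn c = 0 -> c = [::].
  by case: c => // z c; rewrite composition_cons /= => /andP[z0 _]; lia.
have xy : x = y.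
  case: (ltngtP x y) => // xy.
    have := H x; rewrite eqxx (ltn_eqF xy) [y < x]ltnNge (ltnW xy) /= => h.
    by have : true = false by apply: h; lia.
  have := H y; rewrite eqxx (ltn_eqF xy) [x < y]ltnNge (ltnW xy) /= => h.
  by have : false = true by apply: h; lia.
rewrite -{y}xy in y0 es H *; congr cons; apply: IH => //; first lia.
move=> i hi; have := H (x + i); rewrite addKn.
have -> : (x + i == x) = false by lia.
have -> : x < x + i by lia.
by apply; lia.
Qed.

Lemma layered_inj e e' : composition e -> composition e' ->
  knuth (layered e) (layered e') -> e = e'.
Proof.
move=> ce ce' k; have es : sumn e = sumn e'.
  by rewrite -(standard_size (layered_standard e)) (knuth_size k)
    (standard_size (layered_standard e')).
apply: bnd_inj => // i hi; apply: negb_inj; rewrite -!inv_desc_layered -?es //.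
exact: inv_desc_knuth (standard_uniq (layered_standard e)) k.
Qed.

Lemma bnd_split e a : composition e -> 0 < a < sumn e -> ~~ bnd e a ->
  exists e1 u v e2, [/\ e = e1 ++ (u + v) :: e2, 0 < u, 0 < v & a = sumn e1 + u].
Proof.
elim: e a => [|x e IH] a; first by move=> _ /=; lia.
rewrite composition_cons => /andP[x0 ce] ha /=; rewrite negb_or => /andP[ax].
have [xa|ax' _] := ltnP x a; last first.
  exists [::], a, (x - a), e; split=> //; rewrite ?subnKC //; lia.
case/(IH _ ce) => [|e1 [u [v [e2 [-> u0 v0 e3]]]]]; first by move: ha => /=; lia.
by exists (x :: e1), u, v, e2; split=> //=; lia.
Qed.

Lemma layered_split e1 u v e2 :
  filter (leq^~ (sumn e1 + u)) (layered (e1 ++ (u + v) :: e2)) = layered (rcons e1 u) /\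
  filter (ltn (sumn e1 + u)) (layered (e1 ++ (u + v) :: e2))
    = map (addn (sumn e1 + u)) (layered (v :: e2)).
Proof.
have sL := layered_standard e1; have sL2 := layered_standard e2.
rewrite -cats1 !layered_cat !layered_cons cats0 iotaD rev_cat [1 + u]addnC iotaDl -map_rev.
rewrite !filter_cat !map_cat !filter_cat -!map_comp.
have none (p : pred nat) w : (forall x, x \in w -> p x = false) -> filter p w = [::].
  by move=> h; apply: filter_none => x /h ->.
have allf (p : pred nat) w : (forall x, x \in w -> p x) -> filter p w = w.
  by move=> h; apply/all_filterP/allP.
split.
  rewrite (allf _ (layered e1)); last by move=> x; rewrite (standard_mem _ sL); lia.
  rewrite [X in _ ++ (X ++ _) ++ _]none; last first.
    by move=> x /mapP[y]; rewrite mem_rev mem_iota => hy -> /=; lia.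
  rewrite [X in _ ++ _ ++ X]none; last first.
    by move=> x /mapP[y]; rewrite (standard_mem _ sL2) => hy -> /=; lia.
  by rewrite allf ?cats0 // => x /mapP[y]; rewrite mem_rev mem_iota => hy -> /=; lia.
rewrite [X in X ++ _]none ?cat0s; last first.
  by move=> x; rewrite (standard_mem _ sL) => hx /=; lia.
rewrite [X in (_ ++ X) ++ _]none ?cats0; last first.
  by move=> x /mapP[y]; rewrite mem_rev mem_iota => hy -> /=; lia.
congr cat.
  rewrite allf; last by move=> x /mapP[y]; rewrite mem_rev mem_iota => hy -> /=; lia.
  by apply: eq_map => y /=; lia.
rewrite allf; last by move=> x /mapP[y]; rewrite (standard_mem _ sL2) => hy -> /=; lia.
by apply: eq_map => y /=; lia.
Qed.

(** * Monotone subsequences of layered words *)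

Lemma inc_sub_layered e k : inc_sub (layered e) k -> k <= size e.
Proof.
rewrite /layered; elim: e 0 k => [|x e IH] o k /= [s [ss so <-]].
  by case: s ss {so}.
case/subseq_catP: ss so => s1 [s2 [-> h1 h2]].
rewrite sorted_ltn_cat size_cat => /and3P[so1 so2 _].
have h : size s2 <= size e by apply: (IH (o + x)); exists s2.
have : size s1 <= 1; last by move=> h3; exact: (leq_add h3 h).
have : sorted gtn s1 by apply: (subseq_sorted gtn_trans h1); rewrite rev_sorted iota_ltn_sorted.
by case: s1 so1 {h1} => [|a [|b s1]] //= /andP[ab _] /andP[ba _]; lia.
Qed.

Lemma layered_inc_sub e : composition e -> inc_sub (layered e) (size e).
Proof.
elim: e => [|x e IH]; first by exists [::].
rewrite composition_cons => /andP[x0 /IH[s [ss so sz]]].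
exists (x :: map (addn x) s); split; last by rewrite /= size_map sz.
  rewrite layered_cons -cat1s; apply: cat_subseq; last exact: map_subseq.
  by rewrite sub1seq mem_rev mem_iota; lia.
rewrite /= path_sortedE; last exact: ltn_trans.
apply/andP; split.
  apply/allP => y /mapP[z zs ->]; have := mem_subseq ss zs.
  by rewrite (standard_mem _ (layered_standard e)); lia.
by rewrite sorted_map; apply: sub_sorted so => y z /=; rewrite ltn_add2l.
Qed.

Lemma dec_sub_layered e k : dec_sub (layered e) k -> k = 0 \/ has (leq k) e.
Proof.
elim: e k => [|x e IH] k [s [+ so <-]]; first by case: s {so} => //; left.
rewrite layered_cons => /subseq_catP[s1 [s2 [es h1 h2]]].
move: so; rewrite es sorted_gtn_cat => /and3P[so1 so2 /allrelP s12].
have [s20|] := eqVneq s2 [::].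
  right => /=; apply/orP; left; rewrite s20 cats0.
  by have := size_subseq h1; rewrite size_rev size_iota.
case: s2 {es} h2 so2 s12 => // a s2 h2 so2 s12 _.
case: s1 {so1} h1 s12 => [|b s1] h1 s12; last first.
  have : b \in rev (iota 1 x) by apply: (mem_subseq h1); rewrite inE eqxx.
  have /mapP[c cL ea] : a \in map (addn x) (layered e) by apply: (mem_subseq h2); rewrite inE eqxx.
  have := s12 b a; rewrite !inE !eqxx => /(_ isT isT) /=.
  by rewrite mem_rev mem_iota ea; lia.
move: h2; rewrite cat0s => /subseqP[m sm em].
case: (IH (size (a :: s2))) => [||h]; last by right => /=; rewrite h orbT.
  exists (mask m (layered e)); split; first exact: mask_subseq.
    have : sorted gtn (map (addn x) (mask m (layered e))) by rewrite map_mask -em.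
    by rewrite sorted_map; apply: sub_sorted => y z /=; rewrite ltn_add2l.
  by rewrite em -map_mask size_map.
by left.
Qed.

Lemma layered_dec_sub e x : x \in e -> dec_sub (layered e) x.
Proof.
rewrite -has_pred1 => /hasP[y ye /eqP <-] {x}; elim: e ye => //= x e IH.
rewrite inE layered_cons => /orP[/eqP->|/IH[s [ss so sz]]].
  exists (rev (iota 1 x)); rewrite prefix_subseq size_rev size_iota; split=> //.
  by rewrite rev_sorted; apply: iota_ltn_sorted.
exists (map (addn x) s); split; last by rewrite size_map.
  by apply: subseq_trans (suffix_subseq _ _); apply: map_subseq.
by rewrite sorted_map; apply: sub_sorted so => a b /=; rewrite ltn_add2l.
Qed.

Lemma inc_sub_rev w k : inc_sub (rev w) k <-> dec_sub w k.
Proof.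
split=> -[s [ss so sz]]; exists (rev s); rewrite size_rev rev_sorted; split=> //.
  by rewrite -[w]revK subseq_rev.
by rewrite subseq_rev.
Qed.

Lemma dec_sub_knuth w w' k : knuth w w' -> dec_sub w k <-> dec_sub w' k.
Proof. by move/knuth_rev => h; rewrite -!inc_sub_rev; apply: inc_sub_knuth. Qed.

Lemma inc_sub_addn m w k : inc_sub (map (addn m) w) k <-> inc_sub w k.
Proof.
split=> -[s [ss so sz]].
  case/subseqP: ss => ms _; rewrite -map_mask => es; exists (mask ms w).
  rewrite mask_subseq -sz es size_map; split=> //; move: so; rewrite es sorted_map.
  by apply: sub_sorted => a b /=; rewrite ltn_add2l.
exists (map (addn m) s); rewrite map_subseq // size_map sorted_map; split=> //.
by apply: sub_sorted so => a b /=; rewrite ltn_add2l.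
Qed.

Lemma dec_sub_addn m w k : dec_sub (map (addn m) w) k <-> dec_sub w k.
Proof. by rewrite -!inc_sub_rev -map_rev; apply: inc_sub_addn. Qed.

Lemma inc_sub_skew x t k : above x t -> inc_sub (x ++ t) k -> inc_sub x k \/ inc_sub t k.
Proof.
move=> xt [s [/subseq_catP[s1 [s2 [-> h1 h2]]] + <-]].
rewrite sorted_ltn_cat => /and3P[so1 so2 /allrelP s12].
case: s1 h1 so1 s12 => [|a s1] h1 so1 s12; first by right; exists s2.
case: s2 h2 so2 s12 => [|b s2] h2 so2 s12; first by left; exists (a :: s1); rewrite cats0.
have := s12 a b; rewrite !inE !eqxx => /(_ isT isT).
have := xt a b; rewrite (mem_subseq h1) ?(mem_subseq h2) ?inE ?eqxx // => /(_ isT isT) /=.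
by lia.
Qed.

Lemma dec_sub_skew x t k j : above x t -> dec_sub x k -> dec_sub t j ->
  dec_sub (x ++ t) (k + j).
Proof.
move=> xt [s1 [h1 so1 <-]] [s2 [h2 so2 <-]]; exists (s1 ++ s2).
rewrite cat_subseq // size_cat sorted_gtn_cat so1 so2; split=> //=.
by apply/allrelP => a b /(mem_subseq h1) ax /(mem_subseq h2) bt; apply: xt.
Qed.

(** * Skew decompositions of layered classes *)

(** Longest increasing subsequences force one of the two factors to be a single
    layer, and longest decreasing subsequences make its neighbour the largest
    layer of the other factor. *)
Lemma layered_skew e x t : composition e -> knuth (x ++ t) (layered e) ->
  above x t -> x != [::] -> t != [::] ->
  exists e1 u v e2,
  [/\ e = e1 ++ (u + v) :: e2, 0 < u, 0 < v, size t = sumn e1 + u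
    & [/\ knuth t (layered (rcons e1 u)),
          knuth x (map (addn (size t)) (layered (v :: e2))),
          e1 = [::] \/ e2 = [::],
          e2 = [::] -> all (leq^~ u) e1
        & e1 = [::] -> all (leq^~ v) e2]].
Proof.
move=> ce k xt x0 t0; have sL := layered_standard e.
have sxt : standard (sumn e) (x ++ t) by rewrite (standard_knuth _ k).
have szn := standard_size sxt; rewrite size_cat in szn.
have px : 0 < size x by rewrite lt0n size_eq0.
have pt : 0 < size t by rewrite lt0n size_eq0.
have std_t : std t = t /\ x = map (addn (size t)) (std x).
  have := std_id sxt; rewrite std_skew // => /eqP; rewrite eqseq_cat ?size_map //.
  by case/andP=> /eqP e1 /eqP e2.
case: std_t => et ex; have Ut : uniq t by have := standard_uniq sxt; rewrite cat_uniq => /and3P[].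
have Ux : uniq x by have := standard_uniq sxt; rewrite cat_uniq => /and3P[].
have st : standard (size t) t by rewrite -{2}et; apply: std_standard.
have sx := std_standard Ux.
have ha : 0 < size t < sumn e by lia.
have nb : ~~ bnd e (size t).
  rewrite -inv_desc_layered // -(inv_desc_knuth _ (standard_uniq sxt) k).
  apply: inv_desc_subseq; first exact: standard_uniq sxt.
  rewrite -[[:: _; _]]/([:: (size t).+1] ++ [:: size t]); apply: cat_subseq; rewrite sub1seq.
    rewrite ex; apply/mapP; exists 1; last by rewrite addn1.
    by rewrite (standard_mem _ sx) px.
  by rewrite (standard_mem _ st) leqnn pt.
have [e1 [u [v [e2 [ee u0 v0 ea]]]]] := bnd_split ce ha nb.
have := layered_split e1 u v e2; rewrite -ee -ea => -[f1 f2].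
have kt : knuth t (layered (rcons e1 u)).
  rewrite -f1; have := knuth_filter (p := leq^~ (size t)) _ k.
  rewrite filter_cat (_ : filter _ x = [::]); last first.
    apply: filter_none => y.
    by rewrite ex => /mapP[z]; rewrite (standard_mem _ sx) => hz -> /=; lia.
  rewrite (_ : filter _ t = t); last first.
    by apply/all_filterP/allP=> y; rewrite (standard_mem _ st) => /andP[].
  by apply=> a b c /=; lia.
have kx : knuth x (map (addn (size t)) (layered (v :: e2))).
  rewrite -f2; have := knuth_filter (p := ltn (size t)) _ k.
  rewrite filter_cat [X in _ ++ X](_ : _ = [::]); last first.
    apply: filter_none => y.
    by rewrite (standard_mem _ st) /=; lia.
  rewrite cats0 (_ : filter _ x = x); last first.
    apply/all_filterP/allP=> y.
    by rewrite ex => /mapP[z]; rewrite (standard_mem _ sx) => hz -> /=; lia.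
  by apply=> a b c /=; lia.
have c1 : composition (rcons e1 u).
  move: ce; rewrite ee /composition mem_cat mem_rcons !inE !negb_or => /and3P[-> _ _].
  by rewrite eq_sym -lt0n u0.
have c2 : composition (v :: e2).
  move: ce; rewrite ee /composition mem_cat !inE !negb_or => /and3P[_ _ ->].
  by rewrite eq_sym -lt0n v0.
exists e1, u, v, e2; split=> //; split=> //.
- have := layered_inc_sub ce; rewrite -(inc_sub_knuth _ k) => /(inc_sub_skew xt).
  rewrite (inc_sub_knuth _ kx) inc_sub_addn (inc_sub_knuth _ kt).
  case=> /inc_sub_layered; rewrite ee size_cat ?size_rcons /= => h.
    by left; apply: size0nil; move: h; clear; lia.
  by right; apply: size0nil; move: h; clear; lia.
- move=> e20; apply/allP => f fe /=.
  (* A part [f > u] yields a decreasing subword of length [v + f], hence a part [g]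
     at least that large; this cannot be repeated beyond the total. *)
  have [N] := ubnP (sumn e1 - f); elim: N f fe => // N IH f fe leN.
  have : dec_sub (layered e) (v + f).
    rewrite -(dec_sub_knuth _ k); apply: dec_sub_skew => //.
      by rewrite (dec_sub_knuth _ kx) dec_sub_addn; apply: layered_dec_sub; rewrite inE eqxx.
    by rewrite (dec_sub_knuth _ kt); apply: layered_dec_sub; rewrite mem_rcons inE fe orbT.
  case/dec_sub_layered => [|/hasP[g]]; first by move: v0; clear; lia.
  rewrite ee e20 mem_cat inE => /orP[ge1|/eqP->]; last by clear; lia.
  move=> fg; have gs := leq_sumn ge1; have lt : sumn e1 - g < N.
    by move: fg gs leN v0; clear; lia.
  by move: (IH g ge1 lt) fg; clear; lia.
- move=> e10; apply/allP => f fe /=.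
  have [N] := ubnP (sumn e2 - f); elim: N f fe => // N IH f fe leN.
  have : dec_sub (layered e) (f + u).
    rewrite -(dec_sub_knuth _ k); apply: dec_sub_skew => //.
      by rewrite (dec_sub_knuth _ kx) dec_sub_addn; apply: layered_dec_sub; rewrite inE fe orbT.
    by rewrite (dec_sub_knuth _ kt); apply: layered_dec_sub; rewrite mem_rcons inE eqxx.
  case/dec_sub_layered => [|/hasP[g]]; first by move: u0; clear; lia.
  rewrite ee e10 cat0s inE => /orP[/eqP->|ge2]; first by clear; lia.
  move=> fg; have gs := leq_sumn ge2; have lt : sumn e2 - g < N.
    by move: fg gs leN u0; clear; lia.
  by move: (IH g ge2 lt) fg; clear; lia.
Qed.

(** * Layered words contain every class *)

Lemma knuth_dec_past_inc D u m v : sorted gtn D -> sorted ltn u ->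
  all (ltn^~ m) u -> all (ltn m) D ->
  knuth (D ++ u ++ m :: v) (u ++ D ++ m :: v).
Proof.
move=> + su um; elim: D => //= M D IH sD /andP[mM mD].
have sD' : sorted gtn D by apply: path_sorted sD.
apply: KnuthTrans (knuth_cons M (IH sD' mD)) _.
case: D sD mD {IH sD'} => [|M' D] /=.
  by move=> _ _; apply/KnuthSym/knuth_max_left.
move=> /andP[MM' _] /andP[mM' _]; apply/KnuthSym/knuth_max_left => //.
by apply: sub_all um => x /= xm; apply: ltn_trans mM'.
Qed.

(** Adding one letter to each increasing row amounts to adding one decreasing column
    at the end: the letters added so far travel past the next row by
    [knuth_dec_past_inc]. *)
Lemma knuth_weave (rs : seq (seq nat * nat)) :
  all (fun p => sorted ltn p.1) rs -> sorted gtn (map snd rs) ->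
  (forall p q x, p \in rs -> q \in rs -> x \in p.1 -> x < q.2) ->
  knuth (flatten [seq rcons p.1 p.2 | p <- rs]) (flatten (map fst rs) ++ map snd rs).
Proof.
elim/last_ind: rs => [|rs [u m] IH] //.
rewrite all_rcons !map_rcons -[rcons (map snd rs) _]cats1 sorted_gtn_cat.
case/andP=> /= su sr /andP[so am] lt.
have lt' p q x : p \in rs -> q \in rs -> x \in p.1 -> x < q.2.
  by move=> pr qr; apply: lt; rewrite mem_rcons inE ?pr ?qr orbT.
have k := IH sr so lt'; rewrite !flatten_rcons -[rcons u m]cats1.
apply: KnuthTrans (knuth_catr _ k) _; rewrite -!catA; apply: knuth_catl.
apply: (@knuth_dec_past_inc _ u m [::]) => //.
  apply/allP => x xu; apply: (lt (u, m) (u, m)) => //; by rewrite mem_rcons inE eqxx.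
by apply/allP => x xs; apply: (allrelP am) => //; rewrite inE.
Qed.

Section Universal.
Variables (n : nat) (P : pred nat).
Let y j t := j * n.+1 + (n - t).
Let row s t := [seq y j t | j <- iota 0 s & (0 < j) || P t].
Let col j := [seq y j t | t <- iota 0 n & (0 < j) || P t].

Let y_col j t t' : t < t' < n -> y j t' < y j t.
Proof. by rewrite /y => h; rewrite ltn_add2l; lia. Qed.

Let y_layer j j' t t' : j < j' -> t' < n -> y j t < y j' t'.
Proof.
move=> jj tn; rewrite /y; apply: leq_trans (leq_addr _ _).
apply: leq_trans (leq_mul jj (leqnn n.+1)); rewrite mulSn addnC ltn_add2r; lia.
Qed.

Let row_sorted s t : t < n -> sorted ltn (row s t).
Proof.
move=> tn; rewrite /row; apply: (homo_sorted (e := ltn)) => [j j' jj|].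
  exact: y_layer.
by apply: sorted_filter; [exact: ltn_trans|exact: iota_ltn_sorted].
Qed.

Let col_sorted j : sorted gtn (col j).
Proof.
rewrite /col; apply: (homo_sorted_in (P := gtn n) (e := ltn)) => [t t' tn t'n tt||].
- by apply: y_col; apply/andP; split.
- by apply/allP => t; rewrite mem_filter mem_iota => /andP[].
by apply: sorted_filter; [exact: ltn_trans|exact: iota_ltn_sorted].
Qed.

(** The letters [y j t] fill an array; reading it by rows or by columns gives
    equivalent words, by induction on the number of columns. *)
Lemma rows_cols s : 0 < s ->
  knuth (flatten [seq row s t | t <- iota 0 n]) (flatten [seq col j | j <- iota 0 s]).
Proof.
elim: s => [//|[_ _|s /(_ isT) IH _]].
  rewrite /= cats0 /col /row /= (_ : flatten _ = [seq y 0 t | t <- iota 0 n & P t]) //.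
  elim: (iota 0 n) => //= t l ->; by case: (P t).
have es t : row s.+2 t = rcons (row s.+1 t) (y s.+1 t).
  by rewrite /row iota_rcons filter_rcons add0n /= map_rcons.
rewrite [in X in knuth _ X]iota_rcons map_rcons flatten_rcons add0n.
have ec : col s.+1 = [seq y s.+1 t | t <- iota 0 n].
  by rewrite /col (eq_filter (a2 := predT)) ?filter_predT.
rewrite ec; apply: KnuthTrans (knuth_catr _ IH).
pose rs := [seq (row s.+1 t, y s.+1 t) | t <- iota 0 n].
have e1 : map fst rs = [seq row s.+1 t | t <- iota 0 n] by rewrite /rs -map_comp.
have e2 : map snd rs = [seq y s.+1 t | t <- iota 0 n] by rewrite /rs -map_comp.
have e3 : [seq row s.+2 t | t <- iota 0 n] = [seq rcons p.1 p.2 | p <- rs].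
  by rewrite /rs -map_comp; apply: eq_map => t /=.
rewrite -e1 -e2 e3; apply: knuth_weave.
- by rewrite /rs; apply/allP => p /mapP[t]; rewrite mem_iota => tn ->; apply: row_sorted.
- by rewrite e2 -ec; apply: col_sorted.
move=> p q x /mapP[t _ ->] /mapP[t' t'n ->] /= /mapP[j].
rewrite mem_filter mem_iota => /andP[_ js] ->.
by apply: y_layer => //; rewrite mem_iota in t'n.
Qed.

Lemma cols_layers s : 0 < n -> has P (iota 0 n) ->
  layers [seq col j | j <- iota 0 s].
Proof.
move=> n0 hP; rewrite /layers; apply/and3P; split.
- apply/mapP => -[j _ /esym/eqP]; rewrite -size_eq0 size_map size_filter.
  rewrite -leqn0 leqNgt -has_count; apply/negP; rewrite negbK.
  case: (posnP j) => j0; first by rewrite (eq_has (a2 := P)) // => t; rewrite j0.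
  by apply/hasP; exists 0; rewrite ?mem_iota /= ?j0.
- by apply/allP => c /mapP[j _ ->].
rewrite pairwise_map; have := iota_ltn_sorted 0 s; rewrite (sorted_pairwise ltn_trans).
apply: sub_pairwise => j j' jj; apply/allrelP => a b /mapP[t _ ->] /mapP[t' t'n ->].
by move: t'n; rewrite mem_filter mem_iota => /andP[_ t'n]; apply: y_layer.
Qed.

Lemma cols_shape s : shape [seq col j | j <- iota 0 s.+1] =
  count P (iota 0 n) :: nseq s n.
Proof.
rewrite /= size_map size_filter; congr cons.
rewrite /shape -map_comp -[s in RHS](size_iota 1 s).
have : all (leq 1) (iota 1 s) by apply/allP => j; rewrite mem_iota; case/andP.
elim: (iota 1 s) => //= j l IH /andP[j0 /IH->]; rewrite size_map size_filter.
by rewrite (eq_count (a2 := predT)) ?count_predT ?size_iota // => t /=; rewrite j0.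
Qed.

Lemma subseq_rows s (g : nat -> nat) : (forall t, t < n -> g t < s) ->
  (forall t, t < n -> (0 < g t) || P t) ->
  subseq [seq y (g t) t | t <- iota 0 n] (flatten [seq row s t | t <- iota 0 n]).
Proof.
move=> gs gP; have : all (gtn n) (iota 0 n) by apply/allP => t; rewrite mem_iota.
elim: (iota 0 n) => //= t l IH /andP[tn al]; rewrite -cat1s; apply: cat_subseq; last exact: IH.
rewrite sub1seq; apply/mapP; exists (g t) => //.
by rewrite mem_filter mem_iota gP // gs.
Qed.
End Universal.

Lemma index_inv_desc a i : uniq a -> inv_desc a i -> index i.+1 a < index i a.
Proof.
move=> U /eqP h; have : subseq [:: i.+1; i] a by rewrite -h filter_subseq.
elim: a U {h} => //= c a IH /andP[ca U].
case: (eqVneq c i.+1) => [->|nc].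
  case: (eqVneq i.+1 i) => [e|_]; first by have := leqnn i; rewrite -{1}e ltnn.
  by [].
move=> s.
have ia : i \in a by apply: (mem_subseq s); rewrite !inE eqxx orbT.
have -> : (c == i) = false by apply: contraNF ca => /eqP->.
by rewrite ltnS; apply: IH.
Qed.

(** The index of the column that supplies the letter [v]: it grows exactly at the
    inverse ascents, so that letters of one column appear in decreasing order. *)
Definition asc_count (a : seq nat) (v : nat) : nat :=
  count (fun i => ~~ inv_desc a i) (iota 1 v.-1).

Lemma asc_count_le a v v' : v <= v' -> asc_count a v <= asc_count a v'.
Proof.
move=> vv; rewrite /asc_count (_ : v'.-1 = v.-1 + (v'.-1 - v.-1)); last by lia.
by rewrite iotaD count_cat leq_addr.
Qed.

Lemma asc_countS a v : 0 < v ->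
  asc_count a v.+1 = asc_count a v + ~~ inv_desc a v.
Proof.
case: v => // v _; rewrite /asc_count [v.+2.-1]/= iota_rcons.
by rewrite -cats1 count_cat /= addn0 add1n.
Qed.

(** One copy of the alphabet of layers is placed in each position of [a], so
    that [a] can be read off by choosing one letter per position; the first
    layer gets letters only where [a] needs them. *)
Lemma layered_universal n a : standard n a -> 0 < n ->
  exists w bs, [/\ knuth w (flatten bs), layers bs, has_pattern w a
    & shape bs = count (fun v => asc_count a v == 0) (iota 1 n)
                 :: nseq (asc_count a n) n].
Proof.
move=> sa n0; have U := standard_uniq sa.
pose P t := asc_count a (nth 0 a t) == 0.
pose s := (asc_count a n).+1.
exists (flatten [seq [seq j * n.+1 + (n - t) | j <- iota 0 s & (0 < j) || P t] | t <- iota 0 n]).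
exists [seq [seq j * n.+1 + (n - t) | t <- iota 0 n & (0 < j) || P t] | j <- iota 0 s].
have sz := standard_size sa.
have nthP t : t < n -> 0 < nth 0 a t <= n.
  by move=> tn; rewrite -(standard_mem _ sa) mem_nth // sz.
split.
- exact: rows_cols.
- apply: cols_layers => //; apply/hasP; exists (index 1 a).
    by rewrite mem_iota /= -sz index_mem (standard_mem _ sa).
  by rewrite /P nth_index // (standard_mem _ sa).
- pose f v := asc_count a v * n.+1 + (n - index v a).
  exists (map f a).
    have -> : map f a = [seq asc_count a (nth 0 a t) * n.+1 + (n - t) | t <- iota 0 n].
      rewrite -{1}(mkseq_nth 0 a) sz /mkseq -map_comp; apply/eq_in_map => t.
      by rewrite mem_iota /= => tn; rewrite /f index_uniq // sz.
    apply: subseq_rows => t /nthP /andP[v0 vn].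
      by rewrite ltnS asc_count_le.
    by rewrite /P; case: (asc_count _ _).
  apply: keq_map => v v' va v'a vv.
  have hv : index v a < n by rewrite -sz index_mem.
  have hv' : index v' a < n by rewrite -sz index_mem.
  rewrite /f; have := asc_count_le a (ltnW vv); rewrite leq_eqVlt => /orP[/eqP e|lt].
    rewrite e ltn_add2l; suff : index v' a < index v a by lia.
    move: va; rewrite (standard_mem _ sa) => /andP[v0 _].
    rewrite -(subnKC vv) in e *; elim: (v' - v.+1) e => [|d IH] e.
      rewrite addn0 asc_countS // in e *; apply: index_inv_desc => //.
      by move: e; case: (inv_desc a v) => //=; lia.
    rewrite addSn in IH; rewrite addnS addSn asc_countS // in e *.
    have h : asc_count a v.+1 <= asc_count a (v + d).+1 by apply: asc_count_le; lia.
    have h2 := asc_count_le a (leqnSn v).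
    have e2 : asc_count a v = asc_count a (v + d).+1 by lia.
    apply: ltn_trans (IH e2); apply: index_inv_desc => //.
    by move: e; rewrite e2; case: (inv_desc _ _) => //=; lia.
  apply: leq_trans (leq_addr _ _); apply: leq_trans (leq_mul lt (leqnn n.+1)).
  by rewrite mulSn addnC ltn_add2r; lia.
rewrite cols_shape; congr cons.
rewrite -(count_map (fun t => nth 0 a t) (fun v => asc_count a v == 0)).
by rewrite map_nth_iota0 ?sz // -sz take_size (seq.permP sa) sz.
Qed.

(** * Complements of standard words *)

Definition compl (n : nat) (w : seq nat) : seq nat := [seq n.+1 - x | x <- w].

Lemma complK n w : standard n w -> compl n (compl n w) = w.
Proof.
move=> sw; rewrite /compl -map_comp -[RHS]map_id; apply/eq_in_map => x.
by rewrite (standard_mem _ sw) /=; lia.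
Qed.

Lemma compl_standard n w : standard n w -> standard n (compl n w).
Proof.
move=> sw; apply: uniq_perm; last 1 first.
- move=> x; rewrite mem_iota add1n ltnS; apply/mapP/idP => [[y]|xn].
    by rewrite (standard_mem _ sw) => ? ->; lia.
  by exists (n.+1 - x); rewrite ?(standard_mem _ sw); lia.
- rewrite map_inj_in_uniq ?(standard_uniq sw) // => x y.
  by rewrite !(standard_mem _ sw); lia.
exact: iota_uniq.
Qed.

Lemma compl_rev n w : compl n (rev w) = rev (compl n w).
Proof. exact: map_rev. Qed.

Lemma compl_layered e : compl (sumn e) (layered e) = rev (layered (rev e)).
Proof.
elim: e => // x e IH; rewrite layered_cons rev_cons -cats1 layered_cat rev_cat.
rewrite /compl map_cat; congr (_ ++ _).
  rewrite layered_cons cats0 sumn_rev -map_rev revK.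
  apply: (@eq_from_nth _ 0) => [|i]; first by rewrite !size_map !size_rev !size_iota.
  rewrite size_map size_rev size_iota => ix.
  rewrite (nth_map 0) ?size_rev ?size_iota // nth_rev ?size_iota // nth_iota; last by lia.
  by rewrite (nth_map 0) ?size_iota // nth_iota //=; lia.
rewrite -IH /compl -map_comp; apply/eq_in_map => y.
by rewrite (standard_mem _ (layered_standard e)) /=; lia.
Qed.

Lemma keq_compl n w : standard n w -> keq (compl n w) (neg w).
Proof.
move=> sw; apply: keq_neg_map; first exact: standard_uniq sw.
by move=> x; rewrite (standard_mem _ sw); lia.
Qed.

Lemma forces_compl n a b : standard n a -> standard n b ->
  forces a b -> forces (compl n a) (compl n b).
Proof.
move=> sa sb /(forces_neg (standard_uniq sa) (standard_uniq sb)).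
by apply: forces_keq; apply/keq_sym/keq_compl.
Qed.

Lemma inv_desc_compl n w i : standard n w -> 0 < i < n ->
  inv_desc (compl n w) i = ~~ inv_desc w (n - i).
Proof.
move=> sw hi; have sc := compl_standard sw.
have swr : standard n (rev w) by rewrite /standard perm_rev.
have h w' : standard n w' -> inv_desc w' (n - i) -> inv_desc (compl n w') i = false.
  move=> sw' /eqP e; apply: inv_asc_subseq; first exact: standard_uniq (compl_standard sw').
  have -> : [:: i; i.+1] = compl n [:: (n - i).+1; n - i].
    by rewrite /compl /=; congr [:: _; _]; lia.
  by apply: map_subseq; rewrite -e filter_subseq.
have ni : 0 < n - i < n by lia.
case: (boolP (inv_desc w (n - i))) => [/(h _ sw)->//|nd] /=.
have := h _ swr; rewrite (inv_desc_rev sw ni) nd => /(_ isT).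
by rewrite compl_rev (inv_desc_rev sc hi) => /negbFE.
Qed.

(** * Words in the class of a layered word *)

Definition layerable (a : seq nat) : Prop := exists2 e, composition e & keq a (layered e).

Lemma keq_layers bs : layers bs -> keq (flatten bs) (layered (shape bs)).
Proof. by move=> L; rewrite -(std_layers L); apply: keq_sym; apply: keq_std. Qed.

Lemma keq_layered_inj e e' : composition e -> composition e' ->
  keq (layered e) (layered e') -> e = e'.
Proof.
move=> ce ce'; rewrite /keq (std_id (layered_standard e)) (std_id (layered_standard e')).
exact: layered_inj.
Qed.

Lemma layers_pattern bs a : layers bs -> has_pattern (flatten bs) a ->
  exists e, [/\ composition e, keq a (layered e) & embeds e (shape bs)].
Proof.
move=> L [s sw sa]; have [bs' [L' es em]] := layers_subseq L sw.
exists (shape bs'); split=> //; first exact: layers_composition.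
by apply: keq_trans (keq_layers L'); rewrite -es; apply: keq_sym.
Qed.

Lemma embeds_size e d : embeds e d -> size e <= size d.
Proof. by case=> d' /size_subseq sd; rewrite all2E => /andP[/eqP-> _]. Qed.

Lemma embeds_head x e d0 d : size e = size d -> embeds (x :: e) (d0 :: d) -> x <= d0.
Proof.
move=> se [d' sd]; rewrite all2E => /andP[/eqP sz].
have /esym := (size_subseq_leqif sd).2; rewrite /= -se -sz eqxx => /eqP-> /=.
by case/andP.
Qed.

(** The layered word of [layered_universal] contains only layered subwords, so an
    occurrence of [a] in it is excluded. *)
Lemma forces_universal n a b : standard n a -> 0 < n -> forces a b -> ~ layerable a ->
  exists e, [/\ composition e, keq b (layered e) &
    embeds e (count (fun v => asc_count a v == 0) (iota 1 n) :: nseq (asc_count a n) n)].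
Proof.
move=> sa n0 F nC; have [w [bs [k L hw <-]]] := layered_universal sa n0.
have := F _ _ (layers_uniq L) (KnuthSym k) hw; case=> /(layers_pattern L) [] // e [ce ae em].
  by case: nC; exists e.
by exists e.
Qed.

Lemma inv_desc_keq n a b i : standard n a -> standard n b -> keq a b ->
  inv_desc a i = inv_desc b i.
Proof.
move=> sa sb /(keq_standard sa sb); apply: inv_desc_knuth; exact: standard_uniq sa.
Qed.

Lemma keq_column n a b k : standard n a -> standard n b -> 0 < k <= n ->
  (forall i, 0 < i < n -> inv_desc a i = (i < k)) ->
  (forall i, 0 < i < n -> inv_desc b i = (i < k)) -> keq a b.
Proof.
move=> sa sb hk Da Db; apply/(keq_standard sa sb).
apply: insert_word_eq; [exact: standard_uniq sa|exact: standard_uniq sb|].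
by rewrite (classify_column sa hk Da) (classify_column sb hk Db).
Qed.

Lemma bnd_nseq1 m i : bnd (nseq m 1) i = (0 < i <= m).
Proof. by elim: m i => [|m IH] [|[|i]] //=; rewrite IH /=; lia. Qed.

Lemma composition_nseq m : composition (nseq m 1).
Proof. by rewrite /composition mem_nseq andbF. Qed.

Lemma sumn_nseq1 m : sumn (nseq m 1) = m.
Proof. by rewrite sumn_nseq mul1n. Qed.

Lemma inv_desc_hook t m i : 0 < t -> 0 < i < t + m ->
  inv_desc (layered (t :: nseq m 1)) i = (i < t).
Proof.
move=> t0 hi; rewrite inv_desc_layered /= ?sumn_nseq1 //.
  by rewrite bnd_nseq1; lia.
by rewrite composition_cons t0 composition_nseq.
Qed.

Lemma standard_layered_size n b e : standard n b -> keq b (layered e) -> sumn e = n.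
Proof.
move=> sb /keq_size; rewrite (standard_size sb) => ->.
by rewrite (standard_size (layered_standard e)).
Qed.

Lemma asc_count_full n a t : standard n a -> 0 < t <= n ->
  t <= count (fun v => asc_count a v == 0) (iota 1 n) -> asc_count a n = n - t ->
  forall i, 0 < i < n -> inv_desc a i = (i < t).
Proof.
move=> sa /andP[t0 tn] ct cn.
have a0 : asc_count a t = 0.
  apply/eqP; rewrite -leqn0 leqNgt; apply: contraL ct => at0; rewrite -ltnNge.
  have -> : iota 1 n = iota 1 t.-1 ++ iota t (n - t.-1).
    by rewrite -{2}(prednK t0) -add1n -iotaD; congr iota; lia.
  rewrite count_cat; have /eqP-> : count (fun v => asc_count a v == 0) (iota t (n - t.-1)) == 0.
    rewrite -leqn0 leqNgt -has_count; apply/hasPn => v; rewrite mem_iota => /andP[tv _].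
    by rewrite -lt0n (leq_trans at0) // asc_count_le.
  by rewrite addn0; apply: leq_ltn_trans (count_size _ _) _; rewrite size_iota; lia.
have : count (fun i => ~~ inv_desc a i) (iota t (n - t)) = n - t.
  move: cn; rewrite {1}/asc_count (_ : n.-1 = t.-1 + (n - t)); last by lia.
  by rewrite iotaD count_cat -/(asc_count a t) a0 add1n prednK.
move/eqP; rewrite -{2}(size_iota t (n - t)) -all_count => /allP hi i /andP[i0 iN].
case: (ltnP i t) => it; last by apply/negbTE/hi; rewrite mem_iota; lia.
move/eqP: a0; rewrite -leqn0 leqNgt -has_count => /hasPn /(_ i).
by rewrite mem_iota negbK => ->; lia.
Qed.

(** The runs of the universal word outnumber the inverse ascents of [a] by one. If
    [b] needed all of them, its first run would have to fit into the first one,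
    and the inverse descents of [a] would be those of the hook [b], which is in a
    layered class. *)
Lemma forces_column_asc n a b t m : standard n a -> standard n b -> forces a b ->
  ~ layerable a -> 0 < t -> keq b (layered (t :: nseq m 1)) -> m < asc_count a n.
Proof.
move=> sa sb F nC t0 bt.
have tn : t + m = n.
  by rewrite -(standard_layered_size sb bt) /= sumn_nseq1.
have n0 : 0 < n by lia.
have [e [ce be em]] := forces_universal sa n0 F nC.
have ct : composition (t :: nseq m 1) by rewrite composition_cons t0 composition_nseq.
have ee : t :: nseq m 1 = e.
  by apply: keq_layered_inj => //; apply: keq_trans be; apply: keq_sym.
rewrite -{e ce be}ee in em.
have := embeds_size em; rewrite /= !size_nseq ltnS leq_eqVlt => /orP[/eqP em'|//].
have := @embeds_head t _ _ (nseq (asc_count a n) n) _ em; rewrite !size_nseq => /(_ em') tc.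
case: nC; exists (t :: nseq m 1) => //; apply: keq_trans (bt).
have tn' : 0 < t <= n by lia.
apply: (keq_column sa sb tn'); first by apply: asc_count_full; lia.
move=> i hi; rewrite (inv_desc_keq i sb _ bt) ?inv_desc_hook //; first by lia.
by rewrite -tn -{1}(sumn_nseq1 m); apply: (layered_standard (t :: _)).
Qed.

(** * Classes that are both layered and reversed layered *)

Lemma asc_count_compl n a : standard n a ->
  asc_count (compl n a) n + asc_count a n = n.-1.
Proof.
move=> sa; rewrite /asc_count -[RHS](size_iota 1) addnC -(count_predC (inv_desc a)) addnC.
congr (_ + _); have si : standard n.-1 (iota 1 n.-1) by rewrite /standard.
rewrite -(seq.permP (compl_standard si)) count_map; apply: eq_in_count => i.
rewrite mem_iota => hi /=; rewrite inv_desc_compl // ?negbK; last by lia.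
by congr inv_desc; lia.
Qed.

Lemma layerable_rc n a : standard n a -> layerable (rev (compl n a)) -> layerable a.
Proof.
move=> sa [e ce ae]; have sr : standard n (rev (compl n a)).
  by rewrite /standard perm_rev; apply: compl_standard.
have se := standard_layered_size sr ae.
exists (rev e); first by rewrite /composition mem_rev.
have -> : a = rev (compl n (rev (compl n a))) by rewrite compl_rev revK complK.
have -> : layered (rev e) = rev (compl n (layered e)) by rewrite -se compl_layered revK.
have sl : standard n (layered e) by rewrite -se layered_standard.
apply: keq_rev; apply: keq_trans (keq_compl sr) _; apply: keq_trans (keq_sym (keq_compl sl)).
by apply: keq_neg ae; apply: standard_uniq sr.
Qed.

(** A word in neither kind of class forces no word in the class of a hook: the
    number of ascents of the inverse would be too large both for the word and
    for its complement. *)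
Lemma forces_hook_column n a b t m : standard n a -> standard n b -> forces a b ->
  ~ layerable a -> ~ layerable (rev a) -> 0 < t -> ~ keq b (layered (t :: nseq m 1)).
Proof.
move=> sa sb F nC nR t0 bt.
have tn : t + m = n by rewrite -(standard_layered_size sb bt) /= sumn_nseq1.
have m1 := forces_column_asc sa sb F nC t0 bt.
have sa' := compl_standard sa; have sb' := compl_standard sb.
have F' := forces_compl sa sb F.
have nC' : ~ layerable (compl n a).
  move=> h; apply: nR; apply: (@layerable_rc n); first by rewrite /standard perm_rev.
  by rewrite compl_rev revK.
have bt' : keq (compl n b) (layered (m.+1 :: nseq t.-1 1)).
  have e : sumn (m.+1 :: nseq t.-1 1) = n by rewrite /= sumn_nseq1; lia.
  have sl : standard n (layered (m.+1 :: nseq t.-1 1)) by rewrite -{1}e layered_standard.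
  apply: (@keq_column n _ _ m.+1) => // [|i hi|i hi]; first by lia.
    rewrite inv_desc_compl // (inv_desc_keq _ sb _ bt); last first.
      by rewrite -tn -{1}(sumn_nseq1 m); apply: (layered_standard (t :: _)).
    by rewrite inv_desc_hook; lia.
  by rewrite inv_desc_hook //; lia.
have := forces_column_asc sa' sb' F' nC' (ltn0Sn m) bt'.
by have := asc_count_compl sa; lia.
Qed.

Definition hook_comp (c : seq nat) : Prop :=
  exists m t, 0 < t /\ (c = t :: nseq m 1 \/ c = rcons (nseq m 1) t).

Lemma keq_rc n a b : standard n a -> standard n b -> keq a b ->
  keq (rev (compl n a)) (rev (compl n b)).
Proof.
move=> sa sb ab; apply: keq_rev; apply: keq_trans (keq_compl sa) _.
apply: keq_trans (keq_sym (keq_compl sb)); apply: keq_neg ab; exact: standard_uniq sa.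
Qed.

Lemma rc_layered n e : sumn e = n -> rev (compl n (layered e)) = layered (rev e).
Proof. by move=> <-; rewrite compl_layered revK. Qed.

Lemma rc_standard n a : standard n a -> standard n (rev (compl n a)).
Proof. by move=> sa; rewrite /standard perm_rev; apply: compl_standard. Qed.

Lemma forces_rc n a b : standard n a -> standard n b -> forces a b ->
  forces (rev (compl n a)) (rev (compl n b)).
Proof. by move=> sa sb F; apply/forces_rev/forces_compl. Qed.

Lemma forces_hook n a b e : standard n a -> standard n b -> forces a b ->
  ~ layerable a -> ~ layerable (rev a) -> keq b (layered e) -> ~ hook_comp e.
Proof.
move=> sa sb F nC nR be [m [t [t0 [|]]]] ee.
  by apply: (forces_hook_column sa sb F nC nR t0 (m := m)); rewrite -ee.
have se := standard_layered_size sb be.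
have sl : standard n (layered e) by rewrite -se layered_standard.
apply: (forces_hook_column (rc_standard sa) (rc_standard sb) (forces_rc sa sb F) _ _ t0 (m := m)).
- by move/(layerable_rc sa).
- rewrite -compl_rev => /layerable_rc; rewrite /standard perm_rev => /(_ sa); exact: nR.
apply: keq_trans (keq_rc sb sl be) _; rewrite (rc_layered se) ee rev_rcons.
by rewrite rev_nseq; apply: keq_refl.
Qed.

Lemma composition_cat c1 c2 : composition (c1 ++ c2) = composition c1 && composition c2.
Proof. by rewrite /composition mem_cat negb_or. Qed.

Lemma composition_size e : composition e -> size e <= sumn e.
Proof. by elim: e => // x e IH; rewrite composition_cons /= => /andP[x0 /IH]; lia. Qed.

Lemma composition_ones e : composition e -> sumn e <= size e -> e = nseq (size e) 1.
Proof.
elim: e => // x e IH; rewrite composition_cons /= => /andP[x0 ce] h.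
have h2 := composition_size ce; rewrite -IH //; last by lia.
by congr cons; lia.
Qed.

(** All parts except [x] are at least 1, so a total this small leaves nothing else
    for them. *)
Lemma composition_spike e x : composition e -> x \in e -> (sumn e).+1 <= x + size e ->
  exists p q, e = nseq p 1 ++ x :: nseq q 1.
Proof.
move=> ce /path.splitPr ex; case: ex ce => u v.
rewrite composition_cat composition_cons size_cat sumn_cat /=.
case/and3P=> cu _ cv; have := composition_size cu; have := composition_size cv => h1 h2 h.
exists (size u), (size v); rewrite -composition_ones //; last by lia.
by rewrite -composition_ones //; lia.
Qed.

Lemma count_bnd e : composition e -> 0 < size e ->
  (count (bnd e) (iota 1 (sumn e).-1)).+1 = size e.
Proof.
elim: e => // x [|y e] IH; rewrite composition_cons => /andP[x0 ce] _.
  rewrite /= addn0 (eq_in_count (a2 := pred0)) ?count_pred0 // => i.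
  by rewrite mem_iota /=; lia.
have := IH ce isT; have : 0 < size (y :: e) by [].
move: (y :: e) ce => {IH} {}e ce se IH; rewrite [RHS]/= -IH.
have e0 : 0 < sumn e by apply: leq_trans se _; apply: composition_size.
have -> : iota 1 (sumn (x :: e)).-1 = iota 1 x.-1 ++ x :: iota x.+1 (sumn e).-1.
  have -> : (sumn (x :: e)).-1 = x.-1 + (sumn e) by rewrite /=; lia.
  rewrite iotaD; congr (_ ++ _); rewrite add1n prednK //.
  by rewrite -{1}(prednK e0).
rewrite count_cat (eq_in_count (a2 := pred0)) ?count_pred0; last first.
  by move=> i; rewrite mem_iota /=; lia.
rewrite /= eqxx /= !add0n add1n; congr (_.+2).
rewrite -addn1 iotaDl count_map; apply: eq_in_count => i; rewrite mem_iota /= => hi.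
rewrite addKn; case: eqP => [h|_]; first by lia.
by rewrite leq_add2l; case/andP: hi => ->.
Qed.

Lemma layered_skew_layered_bnd e c i : composition e -> composition c -> sumn c = sumn e ->
  knuth (layered e) (skew_layered c) -> 0 < i < sumn e -> bnd c i = ~~ bnd e i.
Proof.
move=> ce cc sc k hi; have U := standard_uniq (layered_standard e).
have sc' := layered_standard c; rewrite sc in sc'.
rewrite -inv_desc_layered // (inv_desc_knuth _ U k) /skew_layered (inv_desc_rev sc' hi).
by rewrite inv_desc_layered ?negbK ?sc.
Qed.

Lemma size_dual e c : composition e -> composition c -> sumn c = sumn e -> 0 < size e ->
  knuth (layered e) (skew_layered c) -> size e + size c = (sumn e).+1.
Proof.
move=> ce cc sc e0 k; have s0 : 0 < sumn e := leq_trans e0 (composition_size ce).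
have c0 : 0 < size c by move: s0; rewrite -sc; case: (c).
rewrite -(count_bnd ce e0) -(count_bnd cc c0) sc.
rewrite (@eq_in_count _ (bnd c) (predC (bnd e))) => [|i]; last first.
  by rewrite mem_iota => hi; apply: layered_skew_layered_bnd => //; lia.
by rewrite addSn addnS count_predC size_iota; lia.
Qed.

Lemma bnd_spike p x q i : 0 < x -> bnd (nseq p 1 ++ x :: nseq q 1) i =
  (0 < i <= p) || (p + x <= i <= p + x + q).
Proof.
move=> x0; elim: p i => [|p IH] i; last by rewrite /= IH; lia.
by rewrite /= bnd_nseq1; lia.
Qed.

(** Increasing and decreasing subwords of the common class show that each of
    [e] and [c] has a part equal to the number of parts of the other, so all
    other parts are 1; the position of that part is then read off the inverse
    descents. *)
Lemma layered_skew_layered_hook e c : composition e -> composition c ->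
  knuth (layered e) (skew_layered c) -> 0 < size e -> hook_comp c.
Proof.
move=> ce cc k e0.
have sc : sumn c = sumn e.
  have := knuth_size k; rewrite (standard_size (layered_standard e)).
  by rewrite (standard_size (skew_layered_standard c)).
have c0 : 0 < size c.
  have := leq_trans e0 (composition_size ce); rewrite -sc; by case: (c).
have sz := size_dual ce cc sc e0 k.
have [y yc ey] : exists2 y, y \in c & size e <= y.
  have : dec_sub (layered c) (size e).
    rewrite -inc_sub_rev -(inc_sub_knuth _ k); exact: layered_inc_sub.
  by case/dec_sub_layered => [|/hasP//]; lia.
have [x xe cx] : exists2 x, x \in e & size c <= x.
  have : dec_sub (layered e) (size c).
    rewrite (dec_sub_knuth _ k) -inc_sub_rev revK; exact: layered_inc_sub.
  by case/dec_sub_layered => [|/hasP//]; lia.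
have [p [q eq_c]] : exists p q, c = nseq p 1 ++ y :: nseq q 1.
  by apply: composition_spike => //; lia.
have [p' [q' eq_e]] : exists p q, e = nseq p 1 ++ x :: nseq q 1.
  by apply: composition_spike => //; lia.
have y0 : 0 < y by apply: leq_trans ey.
case: p eq_c => [|p] eq_c; first by exists q, y; split=> //; left.
case: q eq_c => [|q] eq_c; first by exists p.+1, y; split=> //; right; rewrite -cats1.
have sy : sumn c = p.+1 + y + q.+1 by rewrite eq_c sumn_cat /= !sumn_nseq1; lia.
have sx : sumn e = p' + x + q' by rewrite eq_e sumn_cat /= !sumn_nseq1; lia.
have zx : size e = p' + q'.+1 by rewrite eq_e size_cat /= !size_nseq.
have zy : size c = p.+1 + q.+2 by rewrite eq_c size_cat /= !size_nseq.
have x0 : 0 < x by lia.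
have h1 : 0 < 1 < sumn e by rewrite -sc sy; move: y0; clear; lia.
have h2 : 0 < (sumn e).-1 < sumn e by move: h1; clear; lia.
have b1 := layered_skew_layered_bnd ce cc sc k h1.
have b2 := layered_skew_layered_bnd ce cc sc k h2.
rewrite {1}eq_e {1}eq_c !bnd_spike // in b1; rewrite {2}eq_e {1}eq_c !bnd_spike // in b2.
have y1 : y = 1 by move: b1 b2 sy sx zx zy sz sc y0 cx; clear; lia.
exists (p.+1 + q.+1), 1; split=> //; left; rewrite eq_c y1.
have -> : 1 :: nseq q.+1 1 = nseq q.+2 1 by [].
by rewrite -nseqD addnS.
Qed.

(** * Layered words that unfold a core *)

Lemma knuth_max_right_seq a E M v : sorted gtn E -> all (ltn^~ a) E -> sorted ltn (a :: M) ->
  knuth (a :: E ++ M ++ v) (a :: M ++ E ++ v).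
Proof.
move=> sE; elim: M a => // m M IH a aE /= /andP[am sM].
apply: KnuthTrans (knuth_max_right _ sE aE am) _; apply: knuth_cons; apply: IH => //.
by apply: sub_all aE => x /= /ltn_trans; apply.
Qed.

Lemma layered_rev_iota x : layered [:: x] = rev (iota 1 x).
Proof. by rewrite layered_cons cats0. Qed.

Lemma layered_ones m : layered (nseq m 1) = iota 1 m.
Proof.
elim: m => // m IH; rewrite -[nseq _ _]/(1 :: nseq m 1) layered_cons IH /=.
by rewrite -iotaDl.
Qed.

Lemma layers_singles D : sorted ltn D -> layers (singles D).
Proof.
move=> sD; apply/and3P; split; first by apply/mapP=> -[].
  by apply/allP => b /mapP[x _ ->].
rewrite pairwise_map; move: sD; rewrite (sorted_pairwise ltn_trans).
by apply: sub_pairwise => x y xy; rewrite /= /allrel /= xy.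
Qed.

Lemma flatten_singles (D : seq nat) : flatten (singles D) = D.
Proof. by elim: D => //= x D ->. Qed.

Lemma shape_singles (D : seq nat) : shape (singles D) = nseq (size D) 1.
Proof. by elim: D => //= x D ->. Qed.

(** The run [M] climbs over the decreasing run between it and [a]; what results is
    the reversed layered word of three groups of runs. *)
Lemma keq_skew_core a D x M J :
  sorted ltn (x :: J) -> sorted ltn (a :: M) -> sorted gtn D ->
  allrel ltn (x :: J) (D ++ a :: M) -> allrel ltn D (a :: M) ->
  keq (a :: D ++ x :: M ++ J)
      (skew_layered ((size J).+1 :: rcons (nseq (size D) 1) (size M).+1)).
Proof.
move=> sJ sM sD lJ lD.
have [/allrelP lJD /allrelP lJM] : allrel ltn (x :: J) D /\ allrel ltn (x :: J) (a :: M).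
  by apply/andP; rewrite -allrel_catr.
pose bs := rev (x :: J) :: rcons (singles (rev D)) (rev (a :: M)).
have L : layers bs.
  rewrite layers_cons -size_eq0 size_rev /= rev_sorted sJ /=.
  have srD : sorted ltn (rev D) by rewrite rev_sorted.
  have /and3P[s1 s2 s3] := layers_singles srD.
  apply/andP; split.
    rewrite all_rcons; apply/andP; split.
      by apply/allrelP => y z; rewrite !mem_rev; apply: lJM.
    apply/allP => b /mapP[d]; rewrite mem_rev => dD ->; apply/allrelP => y z.
    by rewrite mem_rev => yJ; rewrite inE => /eqP->; apply: lJD.
  apply/and3P; split.
  - by rewrite mem_rcons inE negb_or s1 andbT eq_sym -size_eq0 size_rev.
  - by rewrite all_rcons s2 rev_sorted (sM : sorted _ _).
  rewrite pairwise_rcons s3 andbT; apply/allP => b /mapP[d]; rewrite mem_rev => dD ->.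
  apply/allrelP => y z; rewrite inE => /eqP->; rewrite !mem_rev => zM.
  exact: (allrelP lD).
have := keq_rev (keq_layers L); rewrite /bs /= flatten_rcons flatten_singles.
rewrite size_rev /shape map_rcons -/(shape _) shape_singles !size_rev => h.
apply: keq_trans h; rewrite !rev_cat !revK /=.
have U : uniq (a :: M ++ D ++ x :: J).
  have := layers_uniq L; rewrite -rev_uniq /bs /= flatten_rcons flatten_singles.
  by rewrite !rev_cat !revK /= -catA.
rewrite -catA.
have -> : D ++ x :: M ++ J = (D ++ [:: x]) ++ M ++ J by rewrite -catA.
have -> : D ++ x :: J = (D ++ [:: x]) ++ J by rewrite -catA.
have k : knuth (a :: (D ++ [:: x]) ++ M ++ J) (a :: M ++ (D ++ [:: x]) ++ J).
  apply: knuth_max_right_seq => //.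
    rewrite sorted_gtn_cat sD /=; apply/allrelP => d y dD; rewrite inE => /eqP->.
    by apply: lJD; rewrite ?inE ?eqxx.
  rewrite all_cat; apply/andP; split; last first.
    by rewrite /= andbT; apply: lJM; rewrite inE eqxx.
  by apply/allP => d dD; apply: (allrelP lD) => //; rewrite inE eqxx.
by apply: keq_sym; apply: knuth_keq; [rewrite -catA|apply: KnuthSym].
Qed.

(** In each pair the larger letter jumps over the increasing run, and the smaller
    one joins the run. *)
Lemma knuth_weave_pairs r o J : sorted ltn J -> all (leq^~ o) J -> exists M' M,
  [/\ knuth (J ++ map (addn o) (layered (nseq r 2))) (M' ++ J ++ M),
    sorted ltn M', all (ltn o) M' & size M' = r].
Proof.
elim: r o J => [|r IH] o J sJ Jo; first by exists [::], [::]; rewrite !cats0.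
have sJ1 : sorted ltn (rcons J o.+1).
  by rewrite -cats1 sorted_ltn_cat sJ /= allrel1r; apply: sub_all Jo => x /=; rewrite ltnS.
have aJ1 : all (leq^~ o.+2) (rcons J o.+1).
  by rewrite all_rcons leqnSn; apply: sub_all Jo => x /= h; rewrite !leqW.
have [M' [M [k sM' oM' sz]]] := IH o.+2 _ sJ1 aJ1.
exists (o.+2 :: M'), (o.+1 :: M); split.
- have -> : nseq r.+1 2 = 2 :: nseq r 2 by [].
  rewrite layered_cons map_cat -map_comp.
  have -> : map (addn o) (rev (iota 1 2)) = [:: o.+2; o.+1] by rewrite /= addn1 addn2.
  rewrite (eq_map (g := addn o.+2)) => [|x /=]; last by rewrite addnA addn2.
  apply: KnuthTrans (knuth_max_left _ sJ _ _) _ => //.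
  by apply: knuth_cons; rewrite -!cats1 -!catA in k.
- by rewrite /= (path_sortedE ltn_trans) oM'.
- by rewrite /= leqnSn; apply: sub_all oM' => x /=; lia.
by rewrite /= sz.
Qed.

(** All but the last letter of the long run pass the initial increasing run, then
    the larger letters of the pairs are pulled forward; dropping the smaller ones
    leaves the core. *)
Lemma core_wide k m r : exists2 w,
  knuth (layered (nseq k 1 ++ m.+2 :: nseq r 2)) w &
  has_pattern w (skew_layered (k.+1 :: rcons (nseq m 1) r.+1)).
Proof.
set J := iota 2 k; pose o := k + m.+2.
have sJ : sorted ltn J by apply: iota_ltn_sorted.
have Jo : all (leq^~ o) J by apply/allP => x; rewrite mem_iota /o; lia.
have [M' [M [kM sM' oM' sz]]] := knuth_weave_pairs r sJ Jo.
pose D := rev (iota k.+2 m); pose a := k.+2 + m.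
have aD : a :: D = rev (iota k.+2 m.+1) by rewrite iota_rcons rev_rcons.
exists (a :: D ++ 1 :: M' ++ J ++ M).
  rewrite layered_cat layered_ones sumn_nseq1 layered_cons map_cat -map_comp.
  have -> : map (addn k) (rev (iota 1 m.+2)) = (a :: D) ++ [:: k.+1].
    rewrite map_rev -iotaDl addn1 (_ : iota k.+1 m.+2 = k.+1 :: rcons (iota k.+2 m) a).
      by rewrite rev_cons rev_rcons cats1.
    by rewrite -iota_rcons.
  rewrite -!catA (eq_map (g := addn o)) => [|x /=]; last by rewrite /o addnA.
  apply: KnuthTrans (KnuthSym (@knuth_dec_past_inc (a :: D) (iota 1 k) k.+1 _ _ _ _ _)) _.
  - by rewrite aD rev_sorted iota_ltn_sorted.
  - exact: iota_ltn_sorted.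
  - by apply/allP => x; rewrite mem_iota /=; lia.
  - by apply/allP => x; rewrite inE mem_rev mem_iota /a /=; lia.
  apply: (@knuth_catl (a :: D)).
  by rewrite -cat_rcons (_ : rcons _ _ = 1 :: J); [apply: knuth_cons kM|rewrite /J -(iota_rcons 1)].
exists (a :: D ++ 1 :: M' ++ J).
  have -> : a :: D ++ 1 :: M' ++ J ++ M = (a :: D ++ 1 :: M' ++ J) ++ M.
    by rewrite /= -!catA /= -catA.
  exact: prefix_subseq.
have aM : sorted ltn (a :: M').
  rewrite /= (path_sortedE ltn_trans) sM' andbT; apply: sub_all oM' => x /=.
  by rewrite /o /a; lia.
have := @keq_skew_core a D 1 M' J; rewrite size_iota size_rev size_iota sz; apply => //.
- exact: (iota_ltn_sorted 1 k.+1).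
- by rewrite rev_sorted iota_ltn_sorted.
- apply/allrelP => x y xJ; have {xJ} : 0 < x < k.+2.
    by move: xJ; rewrite inE mem_iota; lia.
  rewrite mem_cat inE mem_rev mem_iota => xk /or3P[|/eqP->|/(allP oM')] /=.
  + by lia. + by rewrite /a; lia. by rewrite /o; lia.
apply/allrelP => x y; rewrite mem_rev mem_iota inE => hx /orP[/eqP->|/(allP oM')] /=.
  by rewrite /a; lia.
by rewrite /o; lia.
Qed.

(** The last but one letter of the long run witnesses one move and is then dropped. *)
Lemma core_two m r : exists2 w,
  knuth (layered (1 :: m.+3 :: nseq r.+1 1)) w &
  has_pattern w (skew_layered (2 :: rcons (nseq m 1) r.+2)).
Proof.
pose D := rev (iota 4 m); pose a := 4 + m; pose b := m.+4.+1; pose M := iota b.+1 r.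
have aD : a :: D = rev (iota 4 m.+1) by rewrite iota_rcons rev_rcons.
pose w := (a :: D) ++ [:: 1; 3; b; 2] ++ M.
have kw : knuth (layered (1 :: m.+3 :: nseq r.+1 1)) w.
  have -> : layered (1 :: m.+3 :: nseq r.+1 1) = [:: 1] ++ (a :: D) ++ 3 :: 2 :: b :: M.
    rewrite layered_cons; congr (_ ++ _).
    rewrite layered_cons map_cat -map_comp layered_ones map_rev -iotaDl.
    rewrite (_ : iota _ _ = [:: 2; 3] ++ iota 4 m.+1) // rev_cat -aD -catA.
    congr (_ ++ _); rewrite [RHS]/= /M; do 2!congr cons.
    rewrite (eq_map (g := addn m.+4)) => [|x /=]; last by lia.
    by rewrite -iotaDl addn1.
  apply: KnuthTrans (KnuthSym (@knuth_dec_past_inc (a :: D) [:: 1] 3 _ _ _ _ _)) _ => //.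
  - by rewrite aD rev_sorted iota_ltn_sorted.
  - by rewrite aD; apply/allP => x; rewrite mem_rev mem_iota /=; lia.
  apply: knuth_catl; apply: (@knuth_cons 1).
  by apply: (@KnuthL [::] M 2 3 b).
exists w => //; have sw : subseq ((a :: D) ++ [:: 1; b; 2] ++ M) w.
  by apply: cat_subseq => //=; rewrite ?eqxx; apply: subseq_refl.
exists ((a :: D) ++ [:: 1; b; 2] ++ M) => //.
have U := subseq_uniq sw; rewrite -(knuth_uniq kw) in U.
have {}U := U (standard_uniq (layered_standard _)).
apply: keq_trans (knuth_keq U _) _.
  apply: knuth_catl; apply: (@knuth_cons 1); apply: KnuthSym.
  by have := @knuth_min_left b M 2 [::]; rewrite cats0; apply => //; exact: (iota_ltn_sorted b r.+1).
have := @keq_skew_core a D 1 (b :: M) [:: 2].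
rewrite /D size_rev size_iota -/D /= size_iota -cats1; apply => //.
- by apply/andP; split; [rewrite /a /b; lia|apply: (iota_ltn_sorted b r.+1)].
- by rewrite rev_sorted iota_ltn_sorted.
- by apply/allrelP => x y; rewrite mem_cat !inE mem_rev !mem_iota /a /b /=; lia.
by apply/allrelP => x y; rewrite !inE mem_rev !mem_iota /a /b /=; lia.
Qed.

Lemma core_single j : exists2 w,
  knuth (layered (2 :: rcons (nseq j 1) 3)) w &
  has_pattern w (skew_layered [:: 1; j.+2; 1]).
Proof.
pose I := iota 3 j; pose a := j + 3.
have sI : sorted ltn I by apply: iota_ltn_sorted.
have Ia : all (ltn^~ a) I by apply/allP => x; rewrite mem_iota /a /=; lia.
exists (a.+2 :: 2 :: a.+1 :: 1 :: I ++ [:: a]).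
  have -> : layered (2 :: rcons (nseq j 1) 3) = 2 :: (1 :: I) ++ [:: a.+2; a.+1; a].
    rewrite layered_cons -cats1 layered_cat layered_ones sumn_nseq1 layered_rev_iota.
    rewrite map_cat -map_comp -iotaDl /I /a -[2 :: (1 :: _) ++ _]/([:: 2; 1] ++ _).
    by congr (_ ++ (_ ++ _)); rewrite /=; congr [:: _; _; _]; lia.
  have s1 : sorted ltn (1 :: I).
    by rewrite /= (path_sortedE ltn_trans) sI andbT; apply/allP=> x; rewrite mem_iota; lia.
  have a1 k : a < k -> all (ltn^~ k) (1 :: I).
    move=> ak; rewrite /=; apply/andP; split; first by rewrite /a in ak; lia.
    by apply: sub_all Ia => x /= xa; apply: ltn_trans ak.
  apply: KnuthTrans (knuth_cons 2 (knuth_max_left _ s1 (a1 a.+1 _) _)) _ => //.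
  apply: KnuthTrans (knuth_cons 2 (knuth_cons a.+2 (knuth_max_left [::] s1 _ _))) _ => //.
    by rewrite /= Ia andbT /a; lia.
  by apply: (@KnuthR [::] _ 2 a.+1 a.+2); rewrite /a; lia.
exists (a.+2 :: 2 :: 1 :: I ++ [:: a]).
  by apply: (@cat_subseq _ [:: a.+2; 2] _ [:: a.+2; 2]); [apply: subseq_refl|apply: subseq_cons].
have eI : 2 :: rcons I a = iota 2 j.+2 by rewrite -[RHS]/(2 :: iota 3 j.+1) iota_rcons /a addnC.
pose K := iota 2 j.+2; have szK : size K = j.+2 by rewrite size_iota.
have sK : sorted ltn K by apply: iota_ltn_sorted.
pose bs := [:: [:: 1]; rev K; [:: a.+2]].
have L : layers bs.
  have n0 : rev K != [::] by rewrite -size_eq0 size_rev szK.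
  rewrite !layers_cons n0 rev_sorted sK /= !andbT.
  by apply/andP; split=> //; apply/allrelP => x y; rewrite !inE mem_rev mem_iota /a; lia.
have e := keq_rev (keq_layers L); have U := layers_uniq L; rewrite -rev_uniq in U.
have ef : rev (flatten bs) = a.+2 :: K ++ [:: 1].
  by rewrite /bs /= rev_cons rev_cat revK -cats1.
rewrite ef in U; rewrite /= size_rev szK in e; apply: keq_trans e.
change (keq (a.+2 :: 2 :: 1 :: I ++ [:: a]) (rev (flatten bs))).
rewrite ef; apply/keq_sym/knuth_keq => //; apply: knuth_cons.
rewrite /K -eI (cats1 I a); have := @knuth_min_left 2 (rcons I a) 1 [::].
by rewrite cats0; apply => //; rewrite eI; apply: iota_ltn_sorted.
Qed.

(** * Sandwiches *)

Lemma size_layered e : size (layered e) = sumn e.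
Proof. exact: standard_size (layered_standard e). Qed.

Lemma size_skew_layered e : size (skew_layered e) = sumn e.
Proof. exact: standard_size (skew_layered_standard e). Qed.

Lemma std_layered e : std (layered e) = layered e.
Proof. exact: std_id (layered_standard e). Qed.

Lemma keq_addn m w : keq (map (addn m) w) w.
Proof. by apply: keq_map; apply: addn_homo. Qed.

Lemma keq_layered_skew e x t : composition e -> keq (x ++ t) (layered e) ->
  above x t -> x != [::] -> t != [::] ->
  exists e1 u v e2,
  [/\ e = e1 ++ (u + v) :: e2, 0 < u, 0 < v &
    [/\ keq t (layered (rcons e1 u)), keq x (layered (v :: e2)),
        e1 = [::] \/ e2 = [::],
        e2 = [::] -> all (leq^~ u) e1
      & e1 = [::] -> all (leq^~ v) e2]].
Proof.
move=> ce k xt x0 t0; have := k; rewrite /keq std_layered (std_skew xt) => k'.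
have U : uniq (x ++ t) by rewrite (keq_uniq k) (standard_uniq (layered_standard e)).
have [Ux _ Ut] := and3P (etrans (esym (cat_uniq x t)) U).
have a : above (map (addn (size t)) (std x)) (std t).
  move=> i j /mapP[i' ix ->] jt; move: ix jt.
  rewrite (standard_mem _ (std_standard Ux)) (standard_mem _ (std_standard Ut)).
  move=> /andP[i0 _] /andP[_ jt]; apply: leq_ltn_trans jt _.
  by rewrite -[X in X < _]addn0 ltn_add2l.
have x0' : map (addn (size t)) (std x) != [::] by rewrite -size_eq0 !size_map size_eq0.
have t0' : std t != [::] by rewrite -size_eq0 size_map size_eq0.
have [e1 [u [v [e2 [-> u0 v0 st [kt kx h1 h2 h3]]]]]] := layered_skew ce k' a x0' t0'.
exists e1, u, v, e2; split=> //; split=> //.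
  by rewrite /keq std_layered.
have Ux' : uniq (map (addn (size t)) (std x)).
  by rewrite map_inj_uniq ?std_uniq //; apply: addnI.
apply: keq_trans (keq_addn (size (std t)) _); apply: keq_trans (knuth_keq Ux' kx).
by apply: keq_sym; apply: keq_trans (keq_addn _ _) (keq_std x).
Qed.

(** How [e] can be placed in a sandwich with middle part [d] and outer parts of sizes
    [p] below and [q] above: inside the middle, or with its last or its first run
    partly outside. *)
Definition fits (p q : nat) (d e : seq nat) : Prop :=
  [\/ embeds e d,
      exists e1 u v, [/\ e = rcons e1 (u + v), embeds (rcons e1 u) d,
        all (leq^~ u) e1, 0 < u & 0 < v <= q]
    | exists u v e2, [/\ e = (u + v) :: e2, embeds (v :: e2) d,
        all (leq^~ v) e2, 0 < v & 0 < u <= p]].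

Lemma above_addn m u v : 0 \notin u -> all (leq^~ m) v -> above (map (addn m) u) v.
Proof.
move=> u0 /allP vm x y /mapP[z zu ->] /vm /= ym; case: z zu => [zu|z _]; first by rewrite zu in u0.
by apply: leq_ltn_trans ym _; rewrite -[X in X < _]addn0 ltn_add2l.
Qed.

Lemma above_sub u v u' v' : above u v -> {subset u' <= u} -> {subset v' <= v} -> above u' v'.
Proof. by move=> a us vs x y /us xu /vs; apply: a. Qed.

Lemma above_catl u1 u2 v : above u1 v -> above u2 v -> above (u1 ++ u2) v.
Proof. by move=> h1 h2 x y; rewrite mem_cat => /orP[/h1|/h2]; apply. Qed.

Lemma above_catr u v1 v2 : above u v1 -> above u v2 -> above u (v1 ++ v2).
Proof. by move=> h1 h2 x y xu; rewrite mem_cat => /orP[/(h1 _ _ xu)|/(h2 _ _ xu)]. Qed.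

Lemma above_uniq u v : above u v -> uniq (u ++ v) = uniq u && uniq v.
Proof.
move=> a; rewrite cat_uniq; case: hasP => // -[x xv xu].
by have := a _ _ xu xv; rewrite ltnn.
Qed.

Lemma standard_all n w : standard n w -> all (leq^~ n) w.
Proof. by move=> sw; apply/allP => x; rewrite (standard_mem _ sw) => /andP[]. Qed.

Lemma standard_n0 n w : standard n w -> 0 \notin w.
Proof. by move=> sw; rewrite (standard_mem _ sw). Qed.

Section Core.
Variables (lo core hi d : seq nat).
Hypotheses (clo : composition lo) (cco : composition core) (chi : composition hi).
Hypotheses (cd : composition d) (core_n : ~ hook_comp core) (core0 : 0 < sumn core).
Hypothesis d_small : all (gtn (sumn core)) d.

Let top := map (addn (sumn lo + sumn d)) (skew_layered hi).
Let bot := skew_layered lo.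
Let sandwich w := top ++ map (addn (sumn lo)) w ++ bot.

Lemma sandwich_knuth w : knuth (layered d) w -> knuth (sandwich (layered d)) (sandwich w).
Proof.
move=> k; apply/knuth_catl/knuth_catr/knuth_map => // x y; by rewrite ltn_add2l.
Qed.

Lemma sandwich_above w : standard (sumn d) w ->
  above (map (addn (sumn lo)) w) bot /\ above top (map (addn (sumn lo)) w ++ bot).
Proof.
move=> sw; have sl := skew_layered_standard lo; have sh := skew_layered_standard hi.
split; first by apply: above_addn (standard_n0 sw) (standard_all sl).
apply: above_addn (standard_n0 sh) _; rewrite all_cat; apply/andP; split; last first.
  by apply: sub_all (standard_all sl) => x /=; lia.
by apply/allP => x /mapP[z zw ->] /=; rewrite leq_add2l; apply: (allP (standard_all sw)).
Qed.

Lemma sandwich_pattern w : standard (sumn d) w -> has_pattern w (skew_layered core) ->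
  has_pattern (sandwich w) (skew_layered (lo ++ core ++ hi)).
Proof.
move=> sw [s ss sk]; have [a1 a2] := sandwich_above sw.
exists (sandwich s); first by do 2!(apply: cat_subseq => //); apply: map_subseq.
have sc := skew_layered_standard core; have sh := skew_layered_standard hi.
have sub : {subset map (addn (sumn lo)) s <= map (addn (sumn lo)) w}.
  by apply: mem_subseq; apply: map_subseq.
rewrite !skew_layered_cat map_cat -catA; apply: keq_skew.
- by apply: above_sub a2 _ _ => // x; rewrite !mem_cat => /orP[/sub->|->]; rewrite ?orbT.
- rewrite -map_comp; apply: above_catr.
    move=> x y /mapP[x' xh ->] /mapP[y' yc ->] /=; move: xh yc.
    by rewrite (standard_mem _ sc) (standard_mem _ sh); lia.
  rewrite (eq_map (g := addn (sumn lo + sumn core))) => [|x /=]; last by rewrite addnA.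
  apply: above_addn (standard_n0 sh) _.
  by apply: sub_all (standard_all (skew_layered_standard lo)) => x /=; lia.
- apply: keq_trans (keq_addn _ _) _; apply: keq_sym.
  by apply: keq_trans (keq_addn _ _) (keq_addn _ _).
apply: keq_skew.
- exact: above_sub a1 sub _.
- exact: above_addn (standard_n0 sc) (standard_all (skew_layered_standard lo)).
- apply: keq_trans (keq_addn _ _) _; apply: keq_trans sk _; apply: keq_sym; exact: keq_addn.
exact: keq_refl.
Qed.

Lemma sandwich_uniq : uniq (sandwich (layered d)).
Proof.
have [a1 a2] := sandwich_above (layered_standard d).
rewrite (above_uniq a2) (above_uniq a1) !map_inj_uniq; try exact: addnI.
by rewrite !(standard_uniq (skew_layered_standard _)) (standard_uniq (layered_standard d)).
Qed.

Lemma sandwich_split (p : seq nat) : subseq p (sandwich (layered d)) ->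
  exists x y z f : seq nat, [/\ p = x ++ y ++ z, above x (y ++ z), above y z
    & [/\ size x <= sumn hi, size z <= sumn lo, std y = layered f,
          composition f & embeds f d]].
Proof.
case/subseq_catP=> x [yz [-> sx /subseq_catP[y [z [-> sy sz]]]]].
have [a1 a2] := sandwich_above (layered_standard d).
have [bs [L ey em]] : exists bs, [/\ layers bs, y = map (addn (sumn lo)) (flatten bs)
    & embeds (shape bs) d].
  case/subseqP: sy => m; rewrite size_map => sm ->; rewrite -map_mask.
  have := layers_subseq (blocks_layers 0 cd) (mask_subseq m (layered d)).
  by case=> bs [L -> em]; exists bs; rewrite shape_blocks in em.
exists x, y, z, (shape bs); split=> //.
- apply: above_sub a2 (mem_subseq sx) _; apply: mem_subseq; exact: cat_subseq.
- exact: above_sub a1 (mem_subseq sy) (mem_subseq sz).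
split=> //.
- by have := size_subseq sx; rewrite size_map size_skew_layered.
- by have := size_subseq sz; rewrite size_skew_layered.
- by rewrite ey std_map ?std_layers //; apply: addn_homo.
exact: layers_composition.
Qed.

(** An occurrence of the whole word has at most as many letters in the outer parts
    as these have, so the values of the core come from the layered middle part. *)
Lemma core_not_layered (x y z f : seq nat) : uniq (x ++ y ++ z) -> above x (y ++ z) -> above y z ->
  size x <= sumn hi -> size z <= sumn lo -> std y = layered f -> composition f ->
  ~ keq (x ++ y ++ z) (skew_layered (lo ++ core ++ hi)).
Proof.
move=> U a1 a2 sx sz sy cf k; set c := lo ++ core ++ hi in k.
have szp := keq_size k; rewrite size_skew_layered !size_cat /c !sumn_cat in szp.
have [Ux _ Uyz] := and3P (etrans (esym (cat_uniq x (y ++ z))) U).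
have [_ _ Uz] := and3P (etrans (esym (cat_uniq y z)) Uyz).
pose P v := sumn lo < v <= sumn lo + sumn core.
have pC : forall u v w, u < v < w -> P u -> P w -> P v by move=> u v w; rewrite /P; lia.
have := knuth_filter pC k; rewrite (std_id (skew_layered_standard _)) !std_skew // sy.
have sc := skew_layered_standard core; have sh := skew_layered_standard hi.
have sl := skew_layered_standard lo.
rewrite !skew_layered_cat map_cat !filter_cat.
rewrite [filter P (map _ (std x))]filter_none; last first.
  move=> i /mapP[j]; rewrite (standard_mem _ (std_standard Ux)) size_cat => hj ->.
  by rewrite /P; move: hj szp sx; clear; lia.
rewrite [filter P (std z)]filter_none; last first.
  move=> i; rewrite (standard_mem _ (std_standard Uz)) => hj.
  by apply: contraL (leq_trans (proj2 (andP hj)) sz) => /andP[h _]; rewrite -ltnNge.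
rewrite -map_comp [filter P (map _ (skew_layered hi))]filter_none; last first.
  move=> i /mapP[j]; rewrite (standard_mem _ sh) => hj ->.
  by rewrite /P /=; move: hj; clear; lia.
rewrite [filter P (skew_layered lo)]filter_none; last first.
  by move=> i; rewrite (standard_mem _ sl) /P; clear; lia.
rewrite (_ : filter P (map _ (skew_layered core)) = map (addn (sumn lo)) (skew_layered core)); last first.
  apply/all_filterP/allP => i /mapP[j]; rewrite (standard_mem _ sc) => hj ->.
  by rewrite /P; move: hj; clear; lia.
rewrite !cats0 /= filter_map => k'.
have [bs [L ebs _]] := layers_subseq (blocks_layers 0 cf) (filter_subseq (preim (addn (size z)) P) (layered f)).
rewrite -/(layered f) in ebs; rewrite {}ebs in k'.
have Ub : uniq (map (addn (size z)) (flatten bs)).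
  by rewrite map_inj_uniq ?layers_uniq //; apply: addnI.
have k2 : keq (layered (shape bs)) (skew_layered core).
  apply: keq_trans (keq_sym (keq_layers L)) _; apply: keq_trans (keq_sym (keq_addn _ _)) _.
  by apply: keq_trans (knuth_keq Ub k') (keq_addn _ _).
apply: core_n; apply: layered_skew_layered_hook (layers_composition L) cco _ _.
  by move: k2; rewrite /keq std_layered (std_id sc).
have := keq_size k2; rewrite size_layered size_skew_layered => e.
by rewrite lt0n; apply: contraTneq core0 => /size0nil se; rewrite -e se.
Qed.

Lemma part_small b f : composition f -> embeds f d -> 0 < b ->
  keq (layered f) (layered [:: b]) -> b < sumn core.
Proof.
move=> cf em b0 k; have cb : composition [:: b] by rewrite composition_cons b0.
have ef := keq_layered_inj cf cb k; rewrite {}ef {f cf k} in em.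
case: em => d' sd; rewrite all2E => /andP[/eqP]; case: d' sd => [|x [|]] //= sx _ /andP[bx _].
by apply: leq_ltn_trans bx _; apply: (allP d_small x); rewrite -sub1seq.
Qed.

(** The sandwich is equivalent to a word that contains the first word, but by
    [core_not_layered] it contains no word of that class itself. So it contains
    [layered e] up to equivalence, and the occurrence cannot leave the middle
    part on both sides. *)
Lemma core_fits e : composition e -> sumn e = sumn (lo ++ core ++ hi) ->
  (exists2 w, knuth (layered d) w & has_pattern w (skew_layered core)) ->
  forces (skew_layered (lo ++ core ++ hi)) (layered e) -> fits (sumn lo) (sumn hi) d e.
Proof.
move=> ce se [w kw pw] F.
have sw : standard (sumn d) w by rewrite -(standard_knuth _ kw) layered_standard.
case: (F _ _ sandwich_uniq (sandwich_knuth kw) (sandwich_pattern sw pw)) => -[p sp kp].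
  have [x [y [z [f [ep a1 a2 [sx sz sy cf _]]]]]] := sandwich_split sp.
  have U := subseq_uniq sp sandwich_uniq; rewrite {}ep in kp U.
  by case: (core_not_layered U a1 a2 sx sz sy cf kp).
have [x [y [z [f [ep a1 a2 [sx sz sy cf em]]]]]] := sandwich_split sp.
have kf : keq y (layered f) by rewrite -sy; apply/keq_sym/keq_std.
rewrite {p}ep in kp sp.
have szp := keq_size kp; rewrite size_layered !size_cat se !sumn_cat in szp.
(* A single run in the middle is shorter than the core, and the outer parts have
   too few letters to make up for it. *)
have small b : keq y (layered [:: b]) -> False.
  move=> ky; have szy := keq_size ky; rewrite size_layered /= addn0 in szy.
  case: (posnP b) => [b0|b0]; first by move: szp core0 sx sz; rewrite szy b0; clear; lia.
  have lt := part_small cf em b0 (keq_trans (keq_sym kf) ky).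
  by move: szp lt sx sz; rewrite szy; clear; lia.
have ny : y != [::].
  by apply/eqP => y0; move: szp core0 sx sz; rewrite y0 /=; clear; lia.
have fe g : composition g -> keq y (layered g) -> embeds g d.
  move=> cg kg; rewrite -(keq_layered_inj cf cg) //; apply: keq_trans kg; exact: keq_sym.
case: (eqVneq z [::]) => [z0|nz].
  subst z; rewrite cats0 in a1 kp.
  case: (eqVneq x [::]) => [x0|nx].
    by subst x; constructor 1; apply: fe.
  have [e1 [u [v [e2 [ee u0 v0 [ky kx h12 h2 h1]]]]]] := keq_layered_skew ce kp a1 nx ny.
  case: h12 => e0; first by rewrite e0 in ky; case: (small u).
  have szx := keq_size kx; rewrite e0 size_layered /= addn0 in szx.
  constructor 2; exists e1, u, v; rewrite h2 // u0 v0 -szx; split=> //.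
    by rewrite ee e0 cats1 szx.
  apply: fe ky; move: ce; rewrite ee -cats1 !composition_cat !composition_cons u0.
  by case/and3P=> ->.
case: (eqVneq x [::]) => [x0|nx].
  subst x; rewrite cat0s in kp.
  have [e1 [u [v [e2 [ee u0 v0 [kz ky h12 h2 h1]]]]]] := keq_layered_skew ce kp a2 ny nz.
  case: h12 => e0; last by rewrite e0 in ky; case: (small v).
  have szz := keq_size kz; rewrite e0 size_layered /= addn0 in szz.
  constructor 3; exists u, v, e2; rewrite h1 // u0 v0 -szz; split=> //.
    by rewrite ee e0 szz.
  apply: fe ky; move: ce; rewrite ee composition_cat !composition_cons v0.
  by case/and3P.
(* With letters on both sides the middle part would be a single run. *)
have axy : above x y by apply: above_sub a1 _ _ => // i iy; rewrite mem_cat iy.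
have az : above (x ++ y) z.
  by apply: above_catl a2; apply: above_sub a1 _ _ => // i iz; rewrite mem_cat iz orbT.
have nxy : x ++ y != [::] by case: (x) nx.
rewrite catA in kp.
have [e1 [u [v [e2 [ee u0 v0 [kz kxy h12 h2 h1]]]]]] := keq_layered_skew ce kp az nxy nz.
have cv : composition (v :: e2).
  by move: ce; rewrite ee composition_cat !composition_cons v0 => /and3P[].
have [f1 [u' [v' [f2 [ff u0' v0' [ky kx g12 g2 g1]]]]]] := keq_layered_skew cv kxy axy nx ny.
exfalso; case: f1 ff ky g12 g2 {g1} => [|w1 f1] ff ky g12 g2; first exact: (small u').
case: g12 => // f20; rewrite f20 in ff; case: ff => vw ee2.
have vu := allP (g2 f20) v; rewrite vw inE eqxx in vu.
case: h12 => e0; last by rewrite e0 in ee2; case: (f1) ee2.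
have := allP (h1 e0) (u' + v'); rewrite ee2 mem_cat inE eqxx orbT => /(_ isT).
by move: (vu isT) v0' => /=; rewrite vw; clear; lia.
Qed.

End Core.

(** * Compositions that fit into a sandwich *)

Lemma embeds_count h e d : embeds e d -> count (leq h) e <= count (leq h) d.
Proof.
case=> d' sd ed; apply: leq_trans (leq_count_subseq _ sd).
elim: e d' ed {sd} => [|x e IH] [|y d'] //= /andP[xy ed].
by apply: leq_add (IH _ ed); case: (leqP h x) => // hx; rewrite (leq_trans hx).
Qed.

(** A run that leaves the middle part is at least as long inside it as all other
    runs, so a second long run would show up in the middle as well. *)
Lemma fits_count h p q d e : count (leq h) d <= 1 -> fits p q d e -> count (leq h) e <= 1.
Proof.
move=> cd; case=> [em|[e1 [u [v [-> em au u0 vq]]]]|[u [v [e2 [-> em av v0 up]]]]].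
- exact: leq_trans (embeds_count h em) cd.
- have := leq_trans (embeds_count h em) cd; rewrite -!cats1 !count_cat /= !addn0 => c1.
  rewrite leqNgt; apply/negP => c2; have : 0 < count (leq h) e1 by move: c2; case: (h <= u + v); lia.
  rewrite -has_count => /hasP[x xe hx]; have xu := allP au x xe.
  by move: c1; rewrite (leq_trans hx xu) addn1 ltnS leqn0 eqn0Ngt -has_count => /hasP[]; exists x.
have := leq_trans (embeds_count h em) cd; rewrite /= => c1.
rewrite leqNgt; apply/negP => c2; have : 0 < count (leq h) e2 by move: c2; case: (h <= u + v); lia.
rewrite -has_count => /hasP[x xe hx]; have xv := allP av x xe.
by move: c1; rewrite (leq_trans hx xv) add1n ltnS leqn0 eqn0Ngt -has_count => /hasP[]; exists x.
Qed.

Lemma subseq_nth (y : nat) s d : subseq (y :: s) d ->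
  exists i, nth 0 d i = y /\ size s + i < size d.
Proof.
elim: d => // x d IH /=; case: eqP => [-> sd|_ /IH[i [e lt]]].
  by exists 0; split=> //; rewrite addn0 ltnS size_subseq.
by exists i.+1; split=> //; rewrite addnS ltnS.
Qed.

Lemma embeds_spike x b k m r : 0 < k -> 0 < r ->
  embeds (x :: nseq b 1) (nseq k 1 ++ m.+2 :: nseq r 2) -> x + b < k + m + r + 2.
Proof.
move=> k0 r0 [[|y d'] sd]; rewrite all2E //= size_nseq => /and3P[/eqP[sb] xy _].
have [i [ey]] := subseq_nth sd; rewrite -sb size_cat /= !size_nseq.
move: ey; rewrite nth_cat size_nseq nth_nseq; case: (ltnP i k) => ik; first by move=> ey; lia.
case: (i - k) (subnK ik) => [|j] ei /=; first by move=> ey; lia.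
by rewrite nth_nseq; case: ifP => _ ey; lia.
Qed.

Lemma fits_not_hook lo hi k m r e : 0 < k -> 0 < r -> sumn e = lo + (k + m + r + 2) + hi ->
  fits lo hi (nseq k 1 ++ m.+2 :: nseq r 2) e -> forall x b, e <> x :: nseq b 1.
Proof.
move=> k0 r0 se h x b ee; rewrite ee /= sumn_nseq1 in se.
case: h => [em|[e1 [u [v [e_ em au u0 vq]]]]|[u [v [e2 [e_ em av v0 up]]]]].
- by rewrite ee in em; have := embeds_spike k0 r0 em; move: se; clear; lia.
- rewrite ee in e_; case: b ee se e_ => [|b] ee se e_.
    case: e1 e_ em {au} => [[ex] em|y [|]//].
    by have := embeds_spike (b := 0) k0 r0 em; move: se vq; rewrite ex; clear; lia.
  have : u + v = 1.
    have := congr1 (last 0) e_; rewrite last_rcons /= => <-.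
    by rewrite -[last 1 _]/(last 0 (nseq b.+1 1)) -nth_last size_nseq nth_nseq ltnSn.
  by move: u0 vq; clear; lia.
rewrite ee in e_; case: e_ => ex e2e; rewrite -e2e in em.
by have := embeds_spike k0 r0 em; move: se up; rewrite ex; clear; lia.
Qed.

Lemma all2_ones j f : composition f -> all2 leq f (rcons (nseq j 1) 3) ->
  exists z, 0 < z <= 3 /\ f = rcons (nseq j 1) z.
Proof.
elim: j f => [|j IH] [|x f] //=; rewrite composition_cons => /andP[x0 cf] /andP[x1 af].
  by case: f cf af => //= _ _; exists x; rewrite x0.
by have [z [hz ->]] := IH f cf af; exists z; split=> //; congr cons; lia.
Qed.

Lemma all2_sumn f d : all2 leq f d -> sumn f <= sumn d.
Proof. by elim: f d => [|x f IH] [|y d] //= /andP[xy /IH]; apply: leq_add. Qed.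

Lemma subseq_nseq (s : seq nat) j : subseq s (nseq j 1) -> exists2 i, i <= j & s = nseq i 1.
Proof.
move=> ss; exists (size s); first by rewrite -[j](size_nseq j 1) size_subseq.
by apply/all_pred1P/allP => x /(mem_subseq ss); rewrite mem_nseq => /andP[_ /eqP->] /=.
Qed.

(** The total of [f] forces both end parts of the target to be used and allows at
    most one part 1 to be skipped. *)
Lemma embeds_single f j : composition f -> j + 4 <= sumn f ->
  embeds f (2 :: rcons (nseq j 1) 3) -> exists x i z,
  [/\ f = x :: rcons (nseq i 1) z, 0 < x <= 2, 0 < z <= 3 &
      i = j \/ [/\ i.+1 = j, x = 2 & z = 3]].
Proof.
move=> cf sf [d']; rewrite -cats1 -cat1s.
case/subseq_catP=> s1 [s23 [-> h1 /subseq_catP[s2 [s3 [-> /subseq_nseq[i ij ->] h3]]]]] al.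
have e1 : s1 = [::] \/ s1 = [:: 2].
  by case: s1 h1 {al} => [|x s1] /=; [left|case: (x =P 2) => [-> /eqP->|_ /eqP //]; right].
have e3 : s3 = [::] \/ s3 = [:: 3].
  by case: s3 h3 {al} => [|x s3] /=; [left|case: (x =P 3) => [-> /eqP->|_ /eqP //]; right].
have := leq_trans sf (all2_sumn al); rewrite !sumn_cat sumn_nseq1.
case: e1 al {h1} => ->; first by case: e3 => -> _ /=; lia.
case: e3 {h3} => -> /=; first by move=> _; lia.
case: f cf sf => // x f; rewrite composition_cons => /andP[x0 cf] sf /andP[x2].
rewrite cats1 => /(all2_ones cf)[z [hz ef]] le.
exists x, i, z; rewrite x0 ef; split=> //.
have := sf; rewrite ef -cats1 /= sumn_cat sumn_nseq1 /= => le2.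
case: (ltnP i j) => lt; [right|left; lia].
by split; lia.
Qed.

Lemma embeds_head2 z f j : 0 < size f -> embeds (z :: f) (2 :: rcons (nseq j 1) 3) -> z <= 2.
Proof.
move=> f0 [[|y d'] sd]; rewrite all2E //= => /and3P[/eqP[sb] zy _].
have [i [ey]] := subseq_nth sd; rewrite -sb /= size_rcons size_nseq => lt.
apply: leq_trans zy _; rewrite -ey; case: i lt {ey} => //= i lt.
by rewrite nth_rcons size_nseq nth_nseq (_ : i < j) //; lia.
Qed.

Lemma fits_single p q k e : composition e -> sumn e = p + q + k + 4 ->
  fits p q (2 :: rcons (nseq k 1) 3) e -> exists x i z,
  e = x :: rcons (nseq i 1) z /\
  [\/ [/\ x <= 2, z <= 3 & i = k \/ [/\ i.+1 = k, x = 2 & z = 3]],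
      exists u v, [/\ z = u + v, 0 < v <= q, x <= 2 &
        [/\ u <= 3, x <= u & i = k \/ [/\ i.+1 = k, x = 2 & u = 3]]]
    | exists u v, [/\ x = u + v, 0 < u <= p, z <= v, v <= 2 & i = k]].
Proof.
move=> ce se; case=> [em|[e1 [u [v [e_ em au u0 vq]]]]|[u [v [e2 [e_ em av v0 up]]]]].
- have [|x [i [z [-> /andP[_ x2] /andP[_ z3] h]]]] := embeds_single ce _ em; first by lia.
  by exists x, i, z; split=> //; constructor 1.
- have c1 : composition (rcons e1 u).
    by move: ce; rewrite e_ -!cats1 !composition_cat /= => /andP[-> _]; rewrite composition_cons u0.
  have s1 : k + 4 <= sumn (rcons e1 u).
    by move: se; rewrite e_ -!cats1 !sumn_cat /=; lia.
  have [x [i [z [ee x2 z3 h]]]] := embeds_single c1 s1 em.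
  move: ee; rewrite -rcons_cons => /rcons_inj[ee uz].
  exists x, i, (u + v); split; first by rewrite e_ ee.
  constructor 2; exists u, v; rewrite -uz in z3 h.
  have [[_ x2'] [_ u3]] := (andP x2, andP z3); do 2!split=> //.
  by apply: (allP au); rewrite ee inE eqxx.
have c2 : composition (v :: e2).
  by move: ce; rewrite e_ !composition_cons v0 => /andP[].
have s2 : k + 4 <= sumn (v :: e2) by move: se; rewrite e_ /=; lia.
have [x [i [z [[vx ee] x2 z3 h]]]] := embeds_single c2 s2 em.
exists (u + v), i, z; split; first by rewrite e_ ee.
have zv : z <= v by apply: (allP av); rewrite ee mem_rcons inE eqxx.
by constructor 3; exists u, v; split=> //; case: h => [//|[]]; lia.
Qed.

Lemma fits_rev_single p q k x i z :
  fits q p (2 :: rcons (nseq k 1) 3) (z :: rcons (nseq i 1) x) ->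
  z <= 2 \/ exists u v, [/\ z = u + v, v <= 2, x <= v & u <= q].
Proof.
have sz y : 0 < size (rcons (nseq i 1) y) by rewrite size_rcons.
case=> [em|[e1 [u [v [e_ em au u0 vq]]]]|[u [v [e2 [[ez e_] em av v0 up]]]]].
- by left; apply: embeds_head2 em.
- left; move: e_; rewrite -rcons_cons => /rcons_inj[ee _]; rewrite -ee in em.
  by apply: embeds_head2 em.
right; exists u, v; rewrite -e_ in em av; split=> //; last by case/andP: up.
  exact: embeds_head2 em.
by apply: (allP av); rewrite mem_rcons inE eqxx.
Qed.

(** Both sandwiches bound the end parts of [e]; the bounds together with the total
    leave a single composition. *)
Lemma single_shape p q k e : composition e -> sumn e = p + q + k + 4 ->
  fits p q (2 :: rcons (nseq k 1) 3) e -> fits q p (2 :: rcons (nseq k 1) 3) (rev e) ->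
  e = p.+2 :: rcons (nseq k 1) q.+2 /\ (p = 0 \/ q = 0).
Proof.
move=> ce se fe; have [x [i [z [ee h]]]] := fits_single ce se fe.
have re : rev e = z :: rcons (nseq i 1) x by rewrite ee rev_cons rev_rcons rev_nseq.
rewrite re => /fits_rev_single h'; rewrite ee.
have s1 : x + i + z = p + q + k + 4.
  by rewrite -se ee -cats1 /= sumn_cat sumn_nseq1 /=; lia.
suff : [/\ x = p.+2, i = k, z = q.+2 & p = 0 \/ q = 0] by case=> -> -> -> hpq.
have {h' ee re fe ce se} := h'; case: h => [[x2 z3 hi]|[u [v [zu vq x2 [u3 xu hi]]]]|[u [v [xu up zv v2 hi]]]].
- by case: hi => [ik|[ik x_ z_]]; case=> [z2|[u' [v' [zu v2 xv uq]]]]; split; lia.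
- by case: hi => [ik|[ik x_ z_]]; case=> [z2|[u' [v' [zu' v2 xv uq]]]]; split; lia.
by case=> [z2|[u' [v' [zu' v2' xv uq]]]]; split; lia.
Qed.

(** * Pairs of compositions that force each other *)

Lemma ones_prefix c : composition c -> (exists p, c = nseq p 1) \/
  exists p k c', c = nseq p 1 ++ k.+2 :: c' /\ composition c'.
Proof.
elim: c => [_|x c IH]; first by left; exists 0.
rewrite composition_cons => /andP[x0 cc]; case: x x0 => [//|[|x]] _.
  case: (IH cc) => [[p ->]|[p [k [c' [-> cc']]]]]; first by left; exists p.+1.
  by right; exists p.+1, k, c'.
by right; exists 0, x, c.
Qed.

Definition single_core (c : seq nat) : Prop :=
  exists p k q, c = nseq p.+1 1 ++ k.+2 :: nseq q.+1 1.

Definition multi_core (c : seq nat) : Prop :=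
  exists lo k m l hi, [/\ c = lo ++ (k.+2 :: rcons (nseq m 1) l.+2) ++ hi,
    composition lo & composition hi].

Lemma core_cases c : composition c -> 0 < size c ->
  [\/ hook_comp c, single_core c | multi_core c].
Proof.
move=> cc; case: (ones_prefix cc) => [[[|p] ->] //|[p [k [c' [-> cc']]]]] _.
  by constructor 1; exists p, 1; split=> //; left.
case: (ones_prefix cc') => [[q ->]|[m [l [hi [-> chi]]]]].
  case: q => [|q]; first by constructor 1; exists p, k.+2; split=> //; right; rewrite cats1.
  case: p => [|p]; first by constructor 1; exists q.+1, k.+2; split=> //; left.
  by constructor 2; exists p, k, q.
constructor 3; exists (nseq p 1), k, m, l, hi; split=> //; last exact: composition_nseq.
by rewrite /= cat_rcons.
Qed.

Lemma single_core_not_hook k : ~ hook_comp [:: 1; k.+2; 1].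
Proof. by case=> -[|[|[|m]]] [t [_ [|]]]. Qed.

Lemma multi_core_not_hook k m l : ~ hook_comp (k.+2 :: rcons (nseq m 1) l.+2).
Proof.
case=> m' [t [_ [[_ e]|e]]].
  have : l.+2 \in nseq m' 1 by rewrite -e mem_rcons inE eqxx.
  by rewrite mem_nseq andbF.
have := congr1 (head 0) e; case: m' e => [|m'] // e _.
by have := congr1 size e; rewrite /= size_rcons.
Qed.

Lemma composition_core k m l : composition (k.+2 :: rcons (nseq m 1) l.+2).
Proof. by rewrite -cats1 composition_cons composition_cat composition_nseq. Qed.

Lemma sumn_core k m l : sumn (k :: rcons (nseq m 1) l) = k + m + l.
Proof. by rewrite -cats1 /= sumn_cat sumn_nseq1 /=; lia. Qed.

(** The reversed complement of a layered word is the layered word of the reversed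
    composition. *)
Lemma forces_mirror c e : sumn c = sumn e -> forces (skew_layered c) (layered e) ->
  forces (skew_layered (rev c)) (layered (rev e)).
Proof.
move=> sc F; have sl := layered_standard e; have ss := skew_layered_standard c.
rewrite sc in ss; have := forces_rc ss sl F.
by rewrite (rc_layered (erefl _)) /skew_layered compl_rev rc_layered.
Qed.

Lemma fits_of_single p q k e : composition e ->
  let c := nseq p.+1 1 ++ k.+2 :: nseq q.+1 1 in
  sumn e = sumn c -> forces (skew_layered c) (layered e) ->
  fits p q (2 :: rcons (nseq k 1) 3) e.
Proof.
move=> ce c se F.
have ec : c = nseq p 1 ++ [:: 1; k.+2; 1] ++ nseq q 1 by rewrite /c -addn1 nseqD -catA.
rewrite -{1}(sumn_nseq1 p) -(sumn_nseq1 q); rewrite ec in se F.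
apply: (core_fits (core := [:: 1; k.+2; 1])) => //.
- exact: composition_nseq.
- exact: composition_nseq.
- by rewrite composition_cons -cats1 composition_cat composition_nseq.
- exact: single_core_not_hook.
- by rewrite /= all_rcons all_nseq /=; lia.
exact: core_single.
Qed.

Lemma fits_of_wide lo hi k m l e : composition e ->
  let c := lo ++ (k.+2 :: rcons (nseq m 1) l.+2) ++ hi in
  composition lo -> composition hi -> sumn e = sumn c -> forces (skew_layered c) (layered e) ->
  fits (sumn lo) (sumn hi) (nseq k.+1 1 ++ m.+2 :: nseq l.+1 2) e.
Proof.
move=> ce c clo chi se F; apply: (core_fits (core := k.+2 :: rcons (nseq m 1) l.+2)) => //.
- exact: composition_core.
- by rewrite composition_cat composition_cons composition_nseq /composition mem_nseq.
- exact: multi_core_not_hook.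
- by rewrite sumn_core all_cat /= !all_nseq /=; lia.
exact: core_wide.
Qed.

Lemma fits_of_two lo hi m l e : composition e ->
  let c := lo ++ (2 :: rcons (nseq m 1) l.+2) ++ hi in
  composition lo -> composition hi -> sumn e = sumn c -> forces (skew_layered c) (layered e) ->
  fits (sumn lo) (sumn hi) (1 :: m.+3 :: nseq l.+1 1) e.
Proof.
move=> ce c clo chi se F; apply: (core_fits (core := 2 :: rcons (nseq m 1) l.+2)) => //.
- exact: (composition_core 0).
- by rewrite !composition_cons composition_nseq.
- exact: (@multi_core_not_hook 0).
- by rewrite sumn_core /= !all_nseq /=; lia.
exact: core_two.
Qed.

Lemma rev_core lo hi k m l : rev (lo ++ (k :: rcons (nseq m 1) l) ++ hi) =
  rev hi ++ (l :: rcons (nseq m 1) k) ++ rev lo.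
Proof. by rewrite !rev_cat rev_cons rev_rcons rev_nseq catA. Qed.

Lemma count_core h lo hi k m l : h <= k -> h <= l ->
  2 <= count (leq h) (lo ++ (k :: rcons (nseq m 1) l) ++ hi).
Proof. by move=> hk hl; rewrite !count_cat -cats1 /= count_cat /= hk hl; lia. Qed.

Section Pair.
Variables c e : seq nat.
Hypotheses (ce : composition e) (se : sumn e = sumn c).
Hypothesis F : forces (skew_layered c) (layered e).

Lemma multi_count3 : multi_core c -> count (leq 3) e <= 1.
Proof.
case=> lo [k [m [l [hi [ec clo chi]]]]]; have se' := se; have F' := F; rewrite ec in se' F'.
apply: fits_count (fits_of_wide ce clo chi se' F').
by rewrite count_cat /= !count_nseq /=; case: (2 < m.+2); lia.
Qed.

Lemma two_count2 lo m l hi : composition lo -> composition hi ->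
  c = lo ++ (2 :: rcons (nseq m 1) l.+2) ++ hi -> count (leq 2) e <= 1.
Proof.
move=> clo chi ec; have se' := se; have F' := F; rewrite ec in se' F'.
by apply: fits_count (fits_of_two ce clo chi se' F'); rewrite /= !count_nseq.
Qed.

Lemma multi_not_column : multi_core c -> forall x b, e <> x :: nseq b 1.
Proof.
case=> lo [k [m [l [hi [ec clo chi]]]]]; have se' := se; have F' := F; rewrite ec in se' F'.
apply: fits_not_hook (fits_of_wide ce clo chi se' F') => //.
by rewrite se' !sumn_cat sumn_core; lia.
Qed.
End Pair.

Lemma multi_core_rev c : multi_core c -> multi_core (rev c).
Proof.
case=> lo [k [m [l [hi [-> clo chi]]]]]; exists (rev hi), l, m, k, (rev lo).
by rewrite rev_core /composition !mem_rev.
Qed.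

Definition paired (c e : seq nat) : Prop := exists p k q,
  [/\ c = nseq p.+1 1 ++ k.+2 :: nseq q.+1 1,
      e = p.+2 :: rcons (nseq k 1) q.+2 & p = 0 \/ q = 0].

Lemma single_paired c e : composition e -> sumn e = sumn c -> single_core c ->
  forces (skew_layered c) (layered e) -> paired c e.
Proof.
move=> ce se [p [k [q ec]]] F; have F' := forces_mirror (esym se) F.
have ec' : rev c = nseq q.+1 1 ++ k.+2 :: nseq p.+1 1.
  by rewrite ec rev_cat rev_cons !rev_nseq cat_rcons.
have cre : composition (rev e) by rewrite /composition mem_rev.
have se' : sumn (rev e) = sumn (rev c) by rewrite !sumn_rev.
rewrite ec' in F' se'; have fr := fits_of_single cre se' F'.
rewrite ec in F se; have f := fits_of_single ce se F.
have sz : sumn e = p + q + k + 4 by rewrite se sumn_cat /= !sumn_nseq1; lia.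
by have [ee pq] := single_shape ce sz f fr; exists p, k, q.
Qed.

Lemma multi_not_hook c e : composition e -> sumn e = sumn c -> multi_core c ->
  forces (skew_layered c) (layered e) -> ~ hook_comp e.
Proof.
move=> ce se mc F [m [t [_ [ee|ee]]]]; first exact: (@multi_not_column c e ce se F mc t m ee).
have F' := forces_mirror (esym se) F.
have cre : composition (rev e) by rewrite /composition mem_rev.
have se' : sumn (rev e) = sumn (rev c) by rewrite !sumn_rev.
apply: (@multi_not_column (rev c) (rev e) cre se' F' (multi_core_rev mc) t m).
by rewrite ee rev_rcons rev_nseq.
Qed.

(** By [multi_count3] one of the two large parts of the core of [e] is 2. Exchanging
    the roles of [c] and [e] then shows that [c] has at most one part other than
    1, which its own core contradicts. *)
Lemma multi_not_multi c e : composition c -> composition e -> sumn e = sumn c ->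
  multi_core c -> multi_core e ->
  forces (skew_layered c) (layered e) -> forces (skew_layered e) (layered c) -> False.
Proof.
move=> cc ce se mc me F F'; have := multi_count3 ce se F mc.
have [lo [k [m [l [hi [ee clo chi]]]]]] := me.
have c2 : 1 < count (leq 2) c.
  by have [lo' [k' [m' [l' [hi' [-> _ _]]]]]] := mc; apply: count_core.
case: k ee => [|k] ee; first by have := two_count2 cc (esym se) F' clo chi ee; rewrite leqNgt c2.
case: l ee => [|l] ee; last by rewrite ee leqNgt count_core.
have F2 := forces_mirror se F'.
have crc : composition (rev c) by rewrite /composition mem_rev.
have sr : sumn (rev c) = sumn (rev e) by rewrite !sumn_rev.
have er : rev e = rev hi ++ (2 :: rcons (nseq m 1) k.+3) ++ rev lo by rewrite ee rev_core.
by have := two_count2 crc sr F2 _ _ er; rewrite /composition !mem_rev => /(_ chi clo); rewrite count_rev leqNgt c2.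
Qed.

Lemma forces_paired c e : composition c -> composition e -> sumn e = sumn c ->
  0 < sumn c -> ~ hook_comp c ->
  forces (skew_layered c) (layered e) -> forces (skew_layered e) (layered c) ->
  paired c e \/ paired e c.
Proof.
move=> cc ce se s0 nh F F'.
have c0 : 0 < size c by case: (c) s0.
have e0 : 0 < size e by rewrite -se in s0; case: (e) s0.
case: (core_cases cc c0) => // [sc|mc]; first by left; apply: single_paired.
case: (core_cases ce e0) => [he|sc|me].
- by case: (multi_not_hook ce se mc F he).
- by right; apply: single_paired.
by case: (multi_not_multi cc ce se mc me F F').
Qed.

(** * Pairs of words that force each other *)

Definition inner_descents (n : nat) (J : pred nat) : Prop :=
  (exists2 k, 2 <= k <= n - 2 & forall i, 0 < i < n -> J i = (k <= i <= n - 2)) \/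
  (exists2 k, 4 <= k <= n & forall i, 0 < i < n -> J i = (2 <= i <= k - 2)).

Definition has_descents (n : nat) (a : seq nat) (J : pred nat) : Prop :=
  forall i, 0 < i < n -> inv_desc a i = J i.

Definition exceptional_words (n : nat) (a b : seq nat) : Prop := exists J : pred nat,
  [/\ inner_descents n J \/ inner_descents n (predC J), has_descents n a J
    & has_descents n b J].

Definition hook_descents (n : nat) (a : seq nat) : Prop :=
  exists2 k, 0 < k <= n & has_descents n a (gtn k) \/ has_descents n a (leq k).

Lemma hook_descents_rev n a : standard n a -> hook_descents n (rev a) -> hook_descents n a.
Proof.
move=> sa [k hk h]; exists k => //; case: h => h; [right|left] => i hi.
  by have := h i hi; rewrite (inv_desc_rev sa hi) /= => /(congr1 negb); rewrite negbK -leqNgt.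
by have := h i hi; rewrite (inv_desc_rev sa hi) /= => /(congr1 negb); rewrite negbK -ltnNge.
Qed.

Lemma exceptional_rev n a b : standard n a -> standard n b ->
  exceptional_words n (rev a) (rev b) -> exceptional_words n a b.
Proof.
move=> sa sb [J [hJ ha hb]]; exists (predC J); split.
- case: hJ => h; [right|by left].
  have e : forall i, predC (predC J) i = J i by move=> i; rewrite /= negbK.
  by case: h => -[k hk h]; [left|right]; exists k => // i hi; rewrite e; apply: h.
- by move=> i hi /=; rewrite -ha // (inv_desc_rev sa hi) negbK.
by move=> i hi /=; rewrite -hb // (inv_desc_rev sb hi) negbK.
Qed.

Lemma standard_layered n e : sumn e = n -> standard n (layered e).
Proof. by move=> <-; apply: layered_standard. Qed.

Lemma hook_descents_layered n a e : standard n a -> composition e -> keq a (layered e) ->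
  hook_comp e -> hook_descents n a.
Proof.
move=> sa ce ae [m [t [t0 h]]]; have sn := standard_layered_size sa ae.
have sl := standard_layered sn; case: h => ee.
  have tn : t + m = n by rewrite -sn ee /= sumn_nseq1.
  exists t; first by lia.
  left=> i hi; rewrite (inv_desc_keq i sa sl ae) ee inv_desc_hook //; lia.
have tn : m + t = n by rewrite -sn ee -cats1 sumn_cat sumn_nseq1 /= addn0.
exists m.+1; first by lia.
right=> i hi; rewrite (inv_desc_keq i sa sl ae) inv_desc_layered ?sn //.
by rewrite ee -cats1 (bnd_spike m 0) //; lia.
Qed.

Lemma paired_inner c e : paired c e ->
  inner_descents (sumn c) (predC (bnd c)) /\
  (forall i, 0 < i < sumn c -> bnd c i = ~~ bnd e i).
Proof.
move=> [p [k [q [ec ee pq]]]].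
have sc : sumn c = p + k + q + 4 by rewrite ec sumn_cat /= !sumn_nseq1; lia.
have bc i : 0 < i < sumn c -> bnd c i = ~~ (p.+2 <= i <= p.+2 + k).
  by move=> hi; rewrite ec bnd_spike //; lia.
split; last first.
  by move=> i hi; rewrite bc // ee /= -cats1 (bnd_spike k 0) //; lia.
case: pq => h; [right; exists (k + 4)|left; exists p.+2]; try lia.
  by move=> i hi; rewrite /= bc // negbK; lia.
by move=> i hi; rewrite /= bc // negbK; lia.
Qed.

Lemma exceptional_of_paired n a b c e : standard n a -> standard n b ->
  composition c -> composition e -> keq (rev a) (layered c) -> keq b (layered e) ->
  paired c e \/ paired e c -> exceptional_words n a b.
Proof.
move=> sa sb cc ce ac be pr.
have sra : standard n (rev a) by rewrite /standard perm_rev.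
have nc := standard_layered_size sra ac; have ne := standard_layered_size sb be.
have da i : 0 < i < n -> inv_desc a i = bnd c i.
  move=> hi; have := inv_desc_rev sa hi.
  rewrite (inv_desc_keq i sra (standard_layered nc) ac) inv_desc_layered ?nc //.
  by move/negb_inj.
have db i : 0 < i < n -> inv_desc b i = ~~ bnd e i.
  by move=> hi; rewrite (inv_desc_keq i sb (standard_layered ne) be) inv_desc_layered ?ne.
case: pr => /paired_inner[inn h].
  rewrite nc in inn h; exists (bnd c); split=> //; first by right.
  by move=> i hi; rewrite db // h // negbK.
rewrite ne in inn h; exists (predC (bnd e)); split=> //; first by left.
by move=> i hi; rewrite da //= h // negbK.
Qed.

Lemma layered_both_hook a e c : composition e -> composition c ->
  keq a (layered e) -> keq (rev a) (layered c) -> 0 < size a -> hook_comp e.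
Proof.
move=> ce cc ae rc a0; have k : knuth (layered c) (skew_layered e).
  have := keq_trans (keq_sym rc) (keq_rev ae).
  by rewrite /keq std_layered (std_id (skew_layered_standard e)).
apply: (layered_skew_layered_hook cc ce k).
have := keq_size rc; rewrite size_rev size_layered => sa.
by move: a0; rewrite sa; case: (c).
Qed.

Lemma skew_forces a b c e : keq (rev a) (layered c) -> keq b (layered e) ->
  forces a b -> forces (skew_layered c) (layered e).
Proof.
by move=> ac be; apply: forces_keq => //; have := keq_rev ac; rewrite revK.
Qed.

Lemma forces_not_layerable n a b : standard n a -> standard n b -> 0 < n ->
  forces a b -> forces b a -> ~ layerable a ->
  hook_descents n a \/ exceptional_words n a b.
Proof.
move=> sa sb n0 F F' nC; have [e [ce be _]] := forces_universal sa n0 F nC.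
have sra : standard n (rev a) by rewrite /standard perm_rev.
have srb : standard n (rev b) by rewrite /standard perm_rev.
have b0 : 0 < size b by rewrite (standard_size sb).
case: (classic (layerable (rev a))) => [[c cc ac]|nR]; last first.
  have [c [cc bc _]] := forces_universal sra n0 (forces_rev F) nR.
  by case: (forces_hook sa sb F nC nR be); apply: layered_both_hook ce cc be bc b0.
have nc := standard_layered_size sra ac; have ne := standard_layered_size sb be.
case: (classic (hook_comp c)) => hc.
  by left; apply: hook_descents_rev => //; apply: hook_descents_layered ac hc.
right; apply: (exceptional_of_paired sa sb cc ce ac be).
apply: forces_paired => //; rewrite ?nc //.
  exact: (skew_forces ac be F).
apply: (@skew_forces (rev b) (rev a)) => //; last exact: forces_rev.
by rewrite revK.
Qed.

Lemma forces_hook_or_exceptional n a b : standard n a -> standard n b -> 0 < n ->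
  forces a b -> forces b a -> hook_descents n a \/ exceptional_words n a b.
Proof.
move=> sa sb n0 F F'.
have sra : standard n (rev a) by rewrite /standard perm_rev.
have srb : standard n (rev b) by rewrite /standard perm_rev.
case: (classic (layerable a)) => [[e ce ae]|nC]; last exact: forces_not_layerable.
case: (classic (layerable (rev a))) => [[c cc ac]|nR].
  left; apply: (hook_descents_layered sa ce ae).
  by apply: (layered_both_hook ce cc ae ac); rewrite (standard_size sa).
case: (forces_not_layerable sra srb n0 (forces_rev F) (forces_rev F') nR) => h.
  by left; apply: hook_descents_rev.
by right; apply: exceptional_rev.
Qed.

(** * Permutations as standard words *)

Lemma size_one_line n (pi : 'S_n) : size (one_line pi) = n.
Proof. by rewrite size_map size_enum_ord. Qed.

Lemma nth_map_enum n (F : 'I_n -> nat) (i : 'I_n) :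
  nth 0 [seq F j | j <- enum 'I_n] i = F i.
Proof. by rewrite (nth_map i) ?size_enum_ord // nth_ord_enum. Qed.

Lemma nth_one_line n (pi : 'S_n) (i : 'I_n) : nth 0 (one_line pi) i = (pi i).+1.
Proof. exact: nth_map_enum. Qed.

Lemma one_line_standard n (pi : 'S_n) : standard n (one_line pi).
Proof.
apply: uniq_perm; last 1 first.
- move=> x; rewrite mem_iota add1n ltnS; apply/mapP/andP => [[i _ ->]|[x0 xn]].
    by rewrite ltn_ord.
  have hx : x.-1 < n by lia.
  by exists ((pi^-1)%g (Ordinal hx)); rewrite ?mem_enum // permKV /= prednK.
- by rewrite map_inj_uniq ?enum_uniq // => i j [] /val_inj/perm_inj.
exact: iota_uniq.
Qed.

Lemma one_line_surj n w : standard n w -> exists pi : 'S_n, one_line pi = w.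
Proof.
move=> sw; have sz := standard_size sw.
have lt (i : 'I_n) : (nth 0 w i).-1 < n.
  have : nth 0 w i \in w by rewrite mem_nth ?sz.
  by rewrite (standard_mem _ sw); lia.
have pos (i : 'I_n) : 0 < nth 0 w i.
  have : nth 0 w i \in w by rewrite mem_nth ?sz.
  by rewrite (standard_mem _ sw) => /andP[].
pose f i := Ordinal (lt i).
have f_inj : injective f.
  move=> i j [e]; apply/val_inj/eqP.
  rewrite -(nth_uniq 0 _ _ (standard_uniq sw)) ?sz ?ltn_ord //.
  by rewrite -(prednK (pos i)) -(prednK (pos j)) e.
exists (perm f_inj); apply: (@eq_from_nth _ 0); first by rewrite size_one_line sz.
move=> i; rewrite size_one_line => iN.
by rewrite (nth_one_line _ (Ordinal iN)) permE /= prednK // (pos (Ordinal iN)).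
Qed.

Lemma subseq_enum n (s : seq 'I_n) : sorted (fun i j : 'I_n => i < j) s ->
  subseq s (enum 'I_n).
Proof.
have tr : transitive (fun i j : 'I_n => i < j) by move=> j i k; apply: ltn_trans.
have ir : irreflexive (fun i j : 'I_n => i < j) by move=> i; rewrite /= ltnn.
have se : sorted (fun i j : 'I_n => i < j) (enum 'I_n).
  by have := iota_ltn_sorted 0 n; rewrite -val_enum_ord sorted_map.
move=> ss; rewrite (_ : s = filter (mem s) (enum 'I_n)) ?filter_subseq //.
apply: (irr_sorted_eq tr ir) => //; first exact: sorted_filter.
by move=> i; rewrite mem_filter mem_enum andbT.
Qed.

Lemma sorted_enum n : sorted (fun i j : 'I_n => i < j) (enum 'I_n).
Proof. by have := iota_ltn_sorted 0 n; rewrite -val_enum_ord sorted_map. Qed.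

Lemma std_eq (u : seq nat) (w : seq nat) : size u = size w -> standard (size w) w ->
  (forall i j, i < size w -> j < size w -> (nth 0 w i < nth 0 w j) = (nth 0 u i < nth 0 u j)) ->
  std u = w.
Proof.
move=> sz sw h; rewrite -(std_id sw).
apply: (@eq_from_nth _ 0); first by rewrite !size_std.
rewrite size_std => i iu; rewrite !(nth_map 0) -?sz //.
have cnt v : rank v (nth 0 v i) = count (fun j => nth 0 v j <= nth 0 v i) (iota 0 (size v)).
  by rewrite /rank -[X in count _ X](mkseq_nth 0 v) /mkseq count_map.
rewrite !cnt sz; apply: eq_in_count => j; rewrite mem_iota => /= jw.
by rewrite leqNgt [RHS]leqNgt h // -sz.
Qed.

Lemma pattern_in_word m k (pi : 'S_m) (sigma : 'S_k) :
  pattern_in pi sigma <-> exists2 s, subseq s (one_line sigma) & std s = one_line pi.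
Proof.
split=> [/existsP[f /forallP fP]|[s ss es]].
  exists [seq (sigma (f i)).+1 | i <- enum 'I_m].
    rewrite /one_line (map_comp (fun i => (sigma i).+1) f); apply: map_subseq.
    apply: subseq_enum; rewrite sorted_map; apply: sub_sorted (sorted_enum m) => i j /= ij.
    by have /forallP/(_ j)/andP[/implyP h _] := fP i; apply: h.
  apply: std_eq.
  - by rewrite size_map size_enum_ord size_one_line.
  - by rewrite size_one_line one_line_standard.
  rewrite size_one_line => i j im jm; pose I := Ordinal im; pose J := Ordinal jm.
  rewrite -[i]/(val I) -[j]/(val J) !nth_one_line.
  rewrite !(nth_map_enum (fun i => (sigma (f i)).+1)) !ltnS.
  by have /forallP/(_ J)/andP[_ /eqP] := fP I.
have sz : size s = m by rewrite -size_std es size_one_line.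
have /subseqP[msk smsk emsk] := ss.
have Us := subseq_uniq ss (standard_uniq (one_line_standard sigma)).
pose g := mask msk (enum 'I_k).
have eg : s = [seq (sigma i).+1 | i <- g] by rewrite emsk /one_line map_mask.
have sg : size g = m by rewrite -sz eg size_map.
case: m pi es sz sg => [|m] pi es sz sg.
  have f : 'I_0 -> 'I_k by case.
  by apply/existsP; exists (finfun f); apply/forallP => -[].
have d0 : 'I_k by case: (g) sg => // d0.
apply/existsP; exists [ffun i : 'I_m.+1 => nth d0 g i].
apply/forallP => i; apply/forallP => j; rewrite !ffunE; apply/andP; split.
  apply/implyP => ij; have sgs : sorted (fun a b : 'I_k => a < b) g.
    apply: subseq_sorted (sorted_enum k); first by move=> b a c; apply: ltn_trans.
    exact: mask_subseq.
  apply: (sorted_ltn_nth (leT := fun a b : 'I_k => a < b)) => //.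
  - by move=> b a c; apply: ltn_trans.
  - by rewrite inE sg.
  by rewrite inE sg.
have nths (t : 'I_m.+1) : nth 0 s t = (sigma (nth d0 g t)).+1.
  by rewrite eg (nth_map d0) // sg.
apply/eqP; rewrite -[LHS]ltnS -!(nth_one_line pi) -es !(nth_map 0) ?sz //.
by rewrite rank_mono ?mem_nth ?sz // !nths ltnS.
Qed.

(** * Knuth classes as sets of words *)

Lemma row_word_standard n T : is_SYT n T -> standard n (row_word T).
Proof. by move/is_SYT_tableau=> /andP[_]; apply: perm_trans; apply: perm_row_word. Qed.

Lemma insert_SYT n T : is_SYT n T -> insert_word (row_word T) = T.
Proof. by move/is_SYT_tableau=> /andP[/insert_row_word]. Qed.

Lemma insert_word_SYT n w : standard n w -> is_SYT n (insert_word w).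
Proof.
move=> sw; have [t k] := insert_word_tableau (standard_uniq sw).
apply/is_SYT_tableau; rewrite t /=; apply: perm_trans sw.
by apply: perm_trans (knuth_perm k); rewrite perm_sym perm_row_word.
Qed.

Lemma insert_word_row_word n w T : is_SYT n T -> standard n w ->
  insert_word w = T <-> knuth w (row_word T).
Proof.
move=> hT sw; rewrite -{1}(insert_SYT hT); split.
  by apply: insert_word_eq; [exact: standard_uniq sw|exact: standard_uniq (row_word_standard hT)].
by apply: insert_word_knuth; apply: standard_uniq sw.
Qed.

Lemma in_knuth_class n (pi : 'S_n) T :
  (pi \in knuth_class n T) = (insert_word (one_line pi) == T).
Proof. by rewrite inE. Qed.

Lemma knuth_class_word n T w : is_SYT n T -> standard n w -> knuth w (row_word T) ->
  exists2 pi : 'S_n, one_line pi = w & pi \in knuth_class n T.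
Proof.
move=> hT sw /(insert_word_row_word hT sw) e; have [pi ew] := one_line_surj sw.
by exists pi; rewrite // in_knuth_class ew e.
Qed.

Lemma knuth_class_inj n S T : is_SYT n S -> knuth_class n S = knuth_class n T -> S = T.
Proof.
move=> hS e; have := knuth_class_word hS (row_word_standard hS) (KnuthRefl _).
by case=> pi _ h; move: (h); rewrite e in_knuth_class; move: h; rewrite in_knuth_class => /eqP-> /eqP.
Qed.

Lemma has_pattern_std w a : uniq w -> has_pattern (std w) a <-> has_pattern w a.
Proof.
move=> U; split=> [[s] | [s sw sa]]; last first.
  exists (map (rank w) s); first exact: map_subseq.
  apply: keq_trans sa; apply: keq_map => x y /(mem_subseq sw) xw /(mem_subseq sw) yw.
  by rewrite rank_mono.
case/subseqP=> m sm ->; rewrite /std -map_mask => sa; exists (mask m w); first exact: mask_subseq.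
apply: keq_trans sa; apply: keq_sym; apply: keq_map => x y /mem_mask xw /mem_mask yw.
by rewrite rank_mono.
Qed.

Lemma in_bigcup_seq n (C : seq tableau) (F : tableau -> {set 'S_n}) x :
  (x \in \bigcup_(U <- C) F U) = has (fun U => x \in F U) C.
Proof.
elim: C => [|U C IH]; first by rewrite big_nil inE.
by rewrite big_cons inE IH.
Qed.

(** * Closed sets of permutations and forcing *)

(** If [w] contained neither class, it would avoid the whole set, and so would
    every word of its Knuth class. *)
Lemma closed_forces n S T (Pi : {set 'S_n}) : is_SYT n S -> is_SYT n T ->
  Pi = knuth_class n S :|: knuth_class n T -> pattern_knuth_closed Pi ->
  forces (row_word S) (row_word T).
Proof.
move=> hS hT ePi cl w w' U k hw'; apply: NNPP => nw.
have U' : uniq w' by rewrite -(knuth_uniq k).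
have sw := std_standard U; have sw' := std_standard U'; rewrite -(knuth_size k) in sw'.
have [sg esg] := one_line_surj sw; have [sg' esg'] := one_line_surj sw'.
have [C [hC eC]] := cl (size w).
have sgA : sg \in avoiders Pi (size w).
  rewrite inE; apply/forall_inP => pi pPi; apply/negP => /pattern_in_word[s ss es].
  rewrite esg in ss; have spi := one_line_standard pi; case: nw.
  have hs a : knuth (one_line pi) a -> uniq a -> std a = a -> has_pattern w a.
    move=> ka _ ea; apply/(has_pattern_std _ U); exists s => //.
    by rewrite /keq es ea.
  move: pPi; rewrite ePi inE !in_knuth_class => /orP[]/eqP.
    move/(insert_word_row_word hS spi) => ka; left; apply: hs => //.
      exact: standard_uniq (row_word_standard hS).
    exact: std_id (row_word_standard hS).
  move/(insert_word_row_word hT spi) => ka; right; apply: hs => //.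
    exact: standard_uniq (row_word_standard hT).
  exact: std_id (row_word_standard hT).
have sgA' : sg' \in avoiders Pi (size w).
  move: sgA; rewrite eC !in_bigcup_seq => /hasP[V VC]; rewrite in_knuth_class => hV.
  apply/hasP; exists V => //; rewrite in_knuth_class esg' -(eqP hV) esg eq_sym.
  by apply/eqP; apply: insert_word_knuth (knuth_std U k); rewrite std_uniq.
case/(has_pattern_std _ U'): hw' => s ss sa.
have Us : uniq s by apply: subseq_uniq ss _; rewrite std_uniq.
have ks : knuth (std s) (row_word S) by move: sa; rewrite /keq (std_id (row_word_standard hS)).
have sts : standard n (std s) by rewrite (standard_knuth _ ks) row_word_standard.
have [pi epi pS] := knuth_class_word hS sts ks.
move: sgA'; rewrite inE => /forall_inP /(_ pi); rewrite ePi inE pS => /(_ isT)/negP; apply.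
by apply/pattern_in_word; exists s; rewrite ?esg'.
Qed.

Section SwapClosed.
Variable M : seq nat -> Prop.
Hypothesis M_knuth : forall s s', uniq s -> knuth s s' -> M (std s) -> M (std s').
Hypothesis M_swap : forall u p q v, uniq (u ++ p :: q :: v) ->
  has (fun x => (p < x < q) || (q < x < p)) (u ++ v) ->
  M (std (u ++ p :: q :: v)) -> M (std (u ++ q :: p :: v)).

Definition contains (w : seq nat) : Prop := exists2 s, subseq s w & M (std s).

(** As no other letter separates [p] from [q] in value, replacing one of them by
    [y] changes no comparison. *)
Lemma std_replace u p q v y : uniq (u ++ p :: q :: v) ->
  (p < y < q) || (q < y < p) ->
  ~~ has (fun x => (p < x < q) || (q < x < p)) (u ++ v) ->
  std (u ++ y :: q :: v) = std (u ++ p :: q :: v) /\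
  std (u ++ p :: y :: v) = std (u ++ p :: q :: v).
Proof.
move=> U hy nh; have far x : x \in u ++ p :: q :: v -> x = p \/ x = q \/
    x <> p /\ x <> q /\ ~~ ((p < x < q) || (q < x < p)).
  case: (eqVneq x p) => [|np]; first by left.
  case: (eqVneq x q) => [|nq]; first by right; left.
  rewrite mem_cat !inE (negPf np) (negPf nq) /= -mem_cat => xs; right; right.
  split; [exact/eqP|split; first exact/eqP].
  by apply: contra nh => h; apply/hasP; exists x.
have pq : p != q by case: eqP hy => // ->; lia.
have [np nq] : p \notin u ++ v /\ q \notin u ++ v.
  have : uniq (p :: q :: u ++ v).
    by rewrite -(perm_uniq (s1 := u ++ p :: q :: v)) // (perm_catCA u [:: p; q] v).
  by rewrite /= inE negb_or => /and3P[/andP[_ ->] -> _].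
have idm c z : c \notin u ++ v -> map (fun x => if x == c then z else x) u = u /\
    map (fun x => if x == c then z else x) v = v.
  move=> nc; split; rewrite -[RHS]map_id; apply/eq_in_map => x xs;
    case: eqP => // xc; by rewrite mem_cat -xc xs ?orbT in nc.
have homo c : c = p \/ c = q -> {in u ++ p :: q :: v &,
    {homo (fun x => if x == c then y else x) : a b / a < b}}.
  move=> hc a b /far ha /far hb ab.
  case: (eqVneq a c) => [ac|nac]; case: (eqVneq b c) => [bc|nbc] //.
  - by move: ab; rewrite ac bc ltnn.
  - by move/eqP: nbc => nbc; move: ha hb hc hy ab ac nbc; clear; lia.
  by move/eqP: nac => nac; move: ha hb hc hy ab bc nac; clear; lia.
split.
  rewrite -(std_map (homo p (or_introl erefl))); have [e1 e2] := idm p y np.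
  by rewrite map_cat /= e1 e2 eqxx eq_sym (negPf pq).
rewrite -(std_map (homo q (or_intror erefl))); have [e1 e2] := idm q y nq.
by rewrite map_cat /= e1 e2 eqxx (negPf pq).
Qed.

(** An occurrence meets the triple in a subword of it; only the pair [p q] that the
    move exchanges is a problem. If a letter of the occurrence separates [p] from
    [q] in value they can be swapped, otherwise [y] replaces one of them. *)
Lemma contains_triple t t' p q y u v :
  (forall m, subseq m t -> [\/ subseq m t', m = t | m = [:: p; q]]) ->
  knuth t t' -> subseq [:: q; p] t' -> subseq [:: y; q] t' \/ subseq [:: p; y] t' ->
  (p < y < q) || (q < y < p) -> uniq (u ++ t ++ v) ->
  contains (u ++ t ++ v) -> contains (u ++ t' ++ v).
Proof.
move=> ht k hqp hy y_pq U [s /[dup] ss /subseq_catP[s1 [s' [es hs1 /subseq_catP[m [s2 [es' hm hs2]]]]]] Ms].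
have Us := subseq_uniq ss U; rewrite {}es {}es' in Us Ms.
have sub m' : subseq m' t' -> subseq (s1 ++ m' ++ s2) (u ++ t' ++ v).
  by move=> h; do 2!(apply: cat_subseq => //).
case: (ht m hm) => [h|em|em].
- by exists (s1 ++ m ++ s2); first exact: sub.
- exists (s1 ++ t' ++ s2); first exact: sub.
  by apply: M_knuth Ms => //; rewrite em; apply/knuth_catl/knuth_catr.
rewrite {}em /= in Us Ms.
case: (boolP (has (fun x => (p < x < q) || (q < x < p)) (s1 ++ s2))) => h.
  exists (s1 ++ [:: q; p] ++ s2); first exact: sub.
  exact: M_swap.
have [e1 e2] := std_replace Us y_pq h.
case: hy => /sub hy; [exists (s1 ++ [:: y; q] ++ s2)|exists (s1 ++ [:: p; y] ++ s2)] => //=.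
  by rewrite e1.
by rewrite e2.
Qed.

Lemma subseq3 (m : seq nat) a b c : subseq m [:: a; b; c] ->
  m = [:: a; b; c] \/ m = [:: b; c] \/ m = [:: a; c] \/ m = [:: a; b] \/
  m = [:: a] \/ m = [:: b] \/ m = [:: c] \/ m = [::].
Proof.
case/subseqP=> -[|x1 [|x2 [|x3 [|]]]] // _ ->.
by case: x1; case: x2; case: x3 => /=; tauto.
Qed.

Lemma contains_knuth w w' : knuth w w' -> uniq w -> contains w <-> contains w'.
Proof.
have side x y z : x < y < z -> [/\ x != y, y != z & x != z].
  by move=> h; split; lia.
elim=> {w w'} [u v x y z xyz|u v x y z xyz|w|w w' k IH|w1 w2 w3 k1 IH1 k2 IH2] U.
- have k : knuth [:: y; x; z] [:: y; z; x] by apply: (@KnuthL [::] [::]).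
  have [/negPf nxy /negPf nyz /negPf nxz] := side _ _ _ xyz.
  have E := (eqxx, nxy, nyz, nxz, etrans (eq_sym y x) nxy, etrans (eq_sym z y) nyz,
    etrans (eq_sym z x) nxz).
  have U' : uniq (u ++ [:: y; z; x] ++ v).
    by rewrite -(knuth_uniq (knuth_catl u (knuth_catr v k))).
  split; [apply: (contains_triple (y := y) (p := x) (q := z) _ k) U
         |apply: (contains_triple (y := y) (p := z) (q := x) _ (KnuthSym k)) U'];
    rewrite ?xyz ?orbT //; try (by do 5 rewrite ?E /=);
    try (by [left; do 5 rewrite ?E /=|right; do 5 rewrite ?E /=]);
    move=> m /subseq3; do 7![case=> [->|]|]=> [| | | | | | |->];
      by [constructor 2|constructor 3|constructor 1; do 5 rewrite ?E /=].
- have k : knuth [:: x; z; y] [:: z; x; y] by apply: (@KnuthR [::] [::]).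
  have [/negPf nxy /negPf nyz /negPf nxz] := side _ _ _ xyz.
  have E := (eqxx, nxy, nyz, nxz, etrans (eq_sym y x) nxy, etrans (eq_sym z y) nyz,
    etrans (eq_sym z x) nxz).
  have U' : uniq (u ++ [:: z; x; y] ++ v).
    by rewrite -(knuth_uniq (knuth_catl u (knuth_catr v k))).
  split; [apply: (contains_triple (y := y) (p := x) (q := z) _ k) U
         |apply: (contains_triple (y := y) (p := z) (q := x) _ (KnuthSym k)) U'];
    rewrite ?xyz ?orbT //; try (by do 5 rewrite ?E /=);
    try (by [left; do 5 rewrite ?E /=|right; do 5 rewrite ?E /=]);
    move=> m /subseq3; do 7![case=> [->|]|]=> [| | | | | | |->];
      by [constructor 2|constructor 3|constructor 1; do 5 rewrite ?E /=].
- by [].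
- by have [h1 h2] := IH (etrans (knuth_uniq k) U); split.
have [h1 h2] := IH1 U; have [h3 h4] := IH2 (etrans (esym (knuth_uniq k1)) U).
by split; auto.
Qed.
End SwapClosed.

(** * Swaps *)

Lemma one_line_swap n (pi : 'S_n) (i j : 'I_n) u p q v : j = i.+1 :> nat ->
  one_line pi = u ++ p :: q :: v -> size u = i ->
  one_line (tperm i j * pi)%g = u ++ q :: p :: v.
Proof.
move=> ji e su; have szn : n = size (u ++ p :: q :: v) by rewrite -e size_one_line.
apply: (@eq_from_nth _ 0) => [|t]; rewrite size_one_line.
  by rewrite szn !size_cat.
move=> tn; rewrite (nth_one_line _ (Ordinal tn)) permM.
have pv (s : 'I_n) : (pi s).+1 = nth 0 (u ++ p :: q :: v) s by rewrite -e nth_one_line.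
case: tpermP => [/(congr1 val)|/(congr1 val)|/eqP ni /eqP nj] /=.
- by move=> ->; rewrite pv ji !nth_cat su ltnn subnn ltnNge leqnSn subSnn.
- by move=> ->; rewrite pv ji !nth_cat su ltnn subnn ltnNge leqnSn subSnn.
rewrite pv /= !nth_cat; case: ltnP => // ut.
have : (t - size u) != 0 by rewrite subn_eq0 -ltnNge ltn_neqAle ut andbT su eq_sym.
have : (t - size u) != 1.
  by apply: contra nj => /eqP h; apply/eqP/val_inj; rewrite /= ji -su; lia.
by case: (t - size u) => [|[|]].
Qed.

Lemma one_line_split n (pi : 'S_n) (i j : 'I_n) : j = i.+1 :> nat ->
  exists u v, one_line pi = u ++ (pi i).+1 :: (pi j).+1 :: v /\ size u = i.
Proof.
move=> ji; exists (take i (one_line pi)), (drop j.+1 (one_line pi)).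
have jn : j < size (one_line pi) by rewrite size_one_line.
have i_n : i < size (one_line pi) by rewrite size_one_line.
split; last by rewrite size_takel // ltnW.
by rewrite -!nth_one_line -(drop_nth 0 jn) ji -(drop_nth 0 i_n) cat_take_drop.
Qed.

Lemma swap_closed_word n (Pi : {set 'S_n}) (pi : 'S_n) u p q v : swap_closed Pi ->
  pi \in Pi -> one_line pi = u ++ p :: q :: v -> (p.+1 < q) || (q.+1 < p) ->
  exists2 pi' : 'S_n, pi' \in Pi & one_line pi' = u ++ q :: p :: v.
Proof.
move=> sw pP e pq; have szn : n = size (u ++ p :: q :: v) by rewrite -e size_one_line.
rewrite size_cat /= in szn.
have hi : size u < n by lia.
have hj : (size u).+1 < n by lia.
pose i := Ordinal hi; pose j := Ordinal hj.
exists (tperm i j * pi)%g; last exact: one_line_swap e _.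
apply: sw => //; have := pq.
have -> : p = (pi i).+1 by rewrite -nth_one_line e nth_cat /= ltnn subnn.
by have -> : q = (pi j).+1 by rewrite -nth_one_line e nth_cat /= ltnNge leqnSn subSnn.
Qed.

Lemma swap_closed_knuth n S T (Pi : {set 'S_n}) : is_SYT n S -> is_SYT n T ->
  Pi = knuth_class n S :|: knuth_class n T -> swap_closed Pi -> pattern_knuth_closed Pi.
Proof.
move=> hS hT ePi sw k.
pose M w := exists2 pi : 'S_n, pi \in Pi & one_line pi = w.
have Mk s s' : uniq s -> knuth s s' -> M (std s) -> M (std s').
  move=> U kss [pi pP e]; have ks := knuth_std U kss.
  have st : standard n (std s') by rewrite -(standard_knuth _ ks) -e one_line_standard.
  have [pi' e'] := one_line_surj st; exists pi' => //; move: pP.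
  by rewrite ePi !in_setU !in_knuth_class e e' (insert_word_knuth _ ks) ?std_uniq.
have Ms u p q v : uniq (u ++ p :: q :: v) ->
    has (fun x => (p < x < q) || (q < x < p)) (u ++ v) ->
    M (std (u ++ p :: q :: v)) -> M (std (u ++ q :: p :: v)).
  set w := u ++ p :: q :: v => U /hasP[x xs hx] [pi pP e].
  have -> : std (u ++ q :: p :: v) = map (rank w) (u ++ q :: p :: v).
    rewrite /std; apply: eq_map => y; apply/seq.permP.
    by rewrite perm_cat2l; apply/permPl; apply: (perm_catCA [:: q] [:: p] v).
  rewrite map_cat /=; have e' : one_line pi = map (rank w) u ++ rank w p :: rank w q :: map (rank w) v.
    by rewrite e /std map_cat.
  apply: (swap_closed_word sw pP e').
  have xw : x \in w.
    by move: xs; rewrite /w !mem_cat !inE => /orP[->|->]; rewrite ?orbT.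
  have qw : q \in w by rewrite /w mem_cat !inE eqxx !orbT.
  have pw : p \in w by rewrite /w mem_cat !inE eqxx !orbT.
  case/orP: hx => /andP[h1 h2]; apply/orP; [left|right].
    exact: leq_ltn_trans (rank_lt xw h1) (rank_lt qw h2).
  exact: leq_ltn_trans (rank_lt xw h1) (rank_lt pw h2).
have avoid sg : sg \in avoiders Pi k <-> ~ contains M (one_line sg).
  rewrite inE; split=> [/forall_inP h [s ss [pi pP e]]|h].
    by have /negP := h pi pP; apply; apply/pattern_in_word; exists s.
  apply/forall_inP => pi pP; apply/negP => /pattern_in_word[s ss es]; apply: h.
  by exists s => //; exists pi.
exists [seq insertion_tableau sg | sg <- enum (avoiders Pi k)]; split.
  by move=> U /mapP[sg _ ->]; apply: (insert_word_SYT (one_line_standard sg)).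
apply/setP => sg; rewrite in_bigcup_seq; apply/idP/hasP => [sgA|[U /mapP[sg']]].
  exists (insertion_tableau sg); last by rewrite inE.
  by apply: map_f; rewrite mem_enum.
rewrite mem_enum => /avoid nc ->; rewrite inE => /eqP e; apply/avoid => h; apply: nc.
have Usg := standard_uniq (one_line_standard sg).
have kn : knuth (one_line sg) (one_line sg').
  by apply: insert_word_eq e => //; apply: standard_uniq (one_line_standard sg').
by have [h1 _] := contains_knuth Mk Ms kn Usg; apply: h1.
Qed.

(** * Inverse descent classes *)

Lemma Des_inv n (pi : 'S_n) (i : 'I_n) :
  (i \in Des (pi^-1)%g) = (0 < i) && inv_desc (one_line pi) i.
Proof.
have U := standard_uniq (one_line_standard pi).
have pair (s t : 'I_n) : s < t -> subseq [:: (pi s).+1; (pi t).+1] (one_line pi).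
  move=> st; have := @map_subseq _ _ (fun x => (pi x).+1) _ _ (@subseq_enum n [:: s; t] _).
  by apply; rewrite /= st.
rewrite inE; apply/existsP/andP => [[j /andP[/eqP ji lt]]|[i0 d]].
  split; first by rewrite -ji.
  by apply: inv_desc_subseq => //; have := pair _ _ lt; rewrite !permKV ji.
have hj : i.-1 < n by apply: leq_ltn_trans (leq_pred _) (ltn_ord i).
exists (Ordinal hj); rewrite /= prednK // eqxx /= ltnNge leq_eqVlt negb_or.
apply/andP; split.
  apply/eqP => /val_inj/perm_inj/(congr1 val) /=; lia.
apply/negP => /pair; rewrite !permKV /= prednK // => /(inv_asc_subseq U).
by rewrite d.
Qed.

Lemma inv_descent_classP n (J : {set 'I_n}) (P : pred nat) (pi : 'S_n) :
  (forall i : 'I_n, (i \in J) = (0 < i) && P i) ->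
  reflect (has_descents n (one_line pi) P) (pi \in inv_descent_class J).
Proof.
move=> hJ; apply: (iffP imsetP) => [[s]|h].
  rewrite inE => /eqP eJ -> i /andP[i0 iN].
  have := Des_inv (s^-1)%g (Ordinal iN); rewrite invgK eJ hJ /= i0 /=.
  by move->.
exists (pi^-1)%g; last by rewrite invgK.
rewrite inE; apply/eqP/setP => i; rewrite Des_inv hJ; case: posnP => //= i0.
by rewrite h // i0 ltn_ord.
Qed.

Lemma inv_desc_swap u p q v i : (p.+1 < q) || (q.+1 < p) ->
  inv_desc (u ++ p :: q :: v) i = inv_desc (u ++ q :: p :: v) i.
Proof.
move=> pq; rewrite /inv_desc !filter_cat /=.
by do 2 case: ifP => //; lia.
Qed.

Lemma inv_descent_class_swap n (J : {set 'I_n}) (pi : 'S_n) (i j : 'I_n) :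
  pi \in inv_descent_class J -> j = i.+1 :> nat ->
  ((pi i).+1 < pi j) || ((pi j).+1 < pi i) -> (tperm i j * pi)%g \in inv_descent_class J.
Proof.
case/imsetP=> s; rewrite inE => /eqP eJ es ji h; apply/imsetP.
exists ((tperm i j * pi)^-1)%g; last by rewrite invgK.
rewrite inE -eJ; apply/eqP/setP => t; have [u [v [e su]]] := one_line_split pi ji.
rewrite -(invgK s) -es !Des_inv (one_line_swap ji e su) e; congr (_ && _).
by apply/esym/inv_desc_swap; rewrite !ltnS in h *.
Qed.

(** * Inverse descents read off a tableau *)

Definition row_of (T : tableau) (x : nat) : nat := find (fun r : seq nat => x \in r) T.

Lemma row_of_cons r T x : row_of (r :: T) x = if x \in r then 0 else (row_of T x).+1.
Proof. by []. Qed.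

Lemma row_of_singles C x : row_of (singles C) x = index x C.
Proof.
rewrite /row_of find_map; apply: eq_find => y /=.
by rewrite inE eq_sym.
Qed.

Lemma index_iota_if a m x : index x (iota a m) = if a <= x < a + m then x - a else m.
Proof.
case: ifP => h; last by rewrite memNindex ?size_iota // mem_iota h.
have e : x = nth 0 (iota a m) (x - a) by rewrite nth_iota; lia.
by rewrite {1}e index_uniq ?iota_uniq ?size_iota //; lia.
Qed.

(** Lower rows are read first, and every row is read in increasing order. *)
Lemma row_word_inv_desc T i : all (sorted ltn) T -> uniq (flatten T) ->
  i \in flatten T -> i.+1 \in flatten T ->
  inv_desc (row_word T) i = (row_of T i < row_of T i.+1).
Proof.
elim: T => // r T IH; rewrite [all _ _]/= [flatten _]/= => /andP[sr sT] U; have Uw : uniq (row_word (r :: T)).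
  by rewrite (perm_uniq (perm_row_word _)).
rewrite row_word_cons in Uw *; rewrite !row_of_cons !mem_cat.
have mT x : (x \in row_word T) = (x \in flatten T) by rewrite (perm_mem (perm_row_word T)).
move: U; rewrite cat_uniq => /and3P[_ disj UT].
have dT x : x \in r -> x \notin row_word T.
  by rewrite mT => xr; apply: contra disj => xT; apply/hasP; exists x.
case: (boolP (i \in r)) => ir /=; case: (boolP (i.+1 \in r)) => i1r //= iT i1T.
- apply/negbTE/eqP; rewrite filter_cat (_ : filter _ (row_word T) = [::]) => [/= e|].
    have : sorted ltn [:: i.+1; i] by rewrite -e; apply: sorted_filter => //; apply: ltn_trans.
    by rewrite /= ltnNge leqnSn.
  apply: filter_none => x xT.
  apply/negP => hx; have : x = i \/ x = i.+1 by lia.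
  by case=> ex; move: xT; rewrite ex; apply/negP; apply: dT.
- by apply: inv_desc_subseq => //; apply: (@cat_subseq _ [:: i.+1] [:: i]); rewrite sub1seq ?mT.
- by apply: inv_asc_subseq => //; apply: (@cat_subseq _ [:: i] [:: i.+1]); rewrite sub1seq ?mT.
rewrite ltnS -IH // /inv_desc filter_cat [X in _ ++ X](_ : _ = [::]) ?cats0 //.
apply: filter_none => x xr.
apply/negP => hx; have : x = i \/ x = i.+1 by lia.
by case=> ex; rewrite ex ?(negPf ir) ?(negPf i1r) in xr.
Qed.

Lemma SYT_has_descents n T w : is_SYT n T -> standard n w -> insert_word w = T ->
  has_descents n w (fun i => row_of T i < row_of T i.+1).
Proof.
move=> hT sw e i hi; have U := standard_uniq sw; have [_ _ sT _ pT] := hT.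
have := (insert_word_row_word hT sw).1 e => k; rewrite (inv_desc_knuth _ U k).
by apply: row_word_inv_desc; rewrite ?(perm_uniq pT) ?(perm_mem pT) ?iota_uniq ?mem_iota //; lia.
Qed.

Definition row_hook (n k : nat) : tableau := iota 1 k :: singles (iota k.+1 (n - k)).
Definition column_hook (n k : nat) : tableau :=
  (1 :: iota k.+1 (n - k)) :: singles (iota 2 k.-1).

Ltac rows := rewrite ?row_of_cons ?row_of_singles -?cats1 ?index_cat ?mem_cat ?index_iota_if
    /= ?index_iota_if ?inE ?mem_iota ?size_iota; repeat (case: ifP => //); lia.

Lemma row_hook_rows n k i : 0 < k <= n -> 0 < i < n ->
  (row_of (row_hook n k) i < row_of (row_hook n k) i.+1) = (k <= i).
Proof. move=> hk hi; rewrite /row_hook. rows. Qed.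

Lemma column_hook_rows n k i : 0 < k <= n -> 0 < i < n ->
  (row_of (column_hook n k) i < row_of (column_hook n k) i.+1) = (i < k).
Proof. move=> hk hi; rewrite /column_hook. rows. Qed.

Lemma typeA_hook_rows n k i : 2 <= k <= n - 2 -> 0 < i < n ->
  (row_of (typeA_hook n k) i < row_of (typeA_hook n k) i.+1) = (k <= i <= n - 2).
Proof. move=> hk hi; rewrite /typeA_hook /column /index_iota. rows. Qed.

Lemma typeA_nonhook_rows n k i : 2 <= k <= n - 2 -> 0 < i < n ->
  (row_of (typeA_nonhook n k) i < row_of (typeA_nonhook n k) i.+1) = (k <= i <= n - 2).
Proof. move=> hk hi; rewrite /typeA_nonhook /column /index_iota. rows. Qed.

Lemma typeB_hook_rows n k i : 4 <= k <= n -> 0 < i < n ->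
  (row_of (typeB_hook n k) i < row_of (typeB_hook n k) i.+1) = (2 <= i <= k - 2).
Proof. move=> hk hi; rewrite /typeB_hook /column /index_iota. rows. Qed.

Lemma typeB_nonhook_rows n k i : 4 <= k <= n -> 0 < i < n ->
  (row_of (typeB_nonhook n k) i < row_of (typeB_nonhook n k) i.+1) = (2 <= i <= k - 2).
Proof. move=> hk hi; rewrite /typeB_nonhook /column /index_iota. rows. Qed.

Lemma typeA_hook_tr_rows n k i : 2 <= k <= n - 2 -> 0 < i < n ->
  let U := transpose (typeA_hook n k) in
  (row_of U i < row_of U i.+1) = ~~ (k <= i <= n - 2).
Proof. move=> hk hi; rewrite transpose_typeA_hook //=. rows. Qed.

Lemma typeA_nonhook_tr_rows n k i : 2 <= k <= n - 2 -> 0 < i < n ->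
  let U := transpose (typeA_nonhook n k) in
  (row_of U i < row_of U i.+1) = ~~ (k <= i <= n - 2).
Proof. move=> hk hi; rewrite transpose_typeA_nonhook //=. rows. Qed.

Lemma typeB_hook_tr_rows n k i : 4 <= k <= n -> 0 < i < n ->
  let U := transpose (typeB_hook n k) in
  (row_of U i < row_of U i.+1) = ~~ (2 <= i <= k - 2).
Proof. move=> hk hi; rewrite transpose_typeB_hook //=. rows. Qed.

Lemma typeB_nonhook_tr_rows n k i : 4 <= k <= n -> 0 < i < n ->
  let U := transpose (typeB_nonhook n k) in
  (row_of U i < row_of U i.+1) = ~~ (2 <= i <= k - 2).
Proof. move=> hk hi; rewrite transpose_typeB_nonhook //=. rows. Qed.

(** * Descent classes of the tableaux *)

Lemma knuth_class_descents n U (pi : 'S_n) P : is_SYT n U -> pi \in knuth_class n U ->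
  (forall i, 0 < i < n -> (row_of U i < row_of U i.+1) = P i) -> has_descents n (one_line pi) P.
Proof.
move=> hU; rewrite in_knuth_class => /eqP e h i hi.
by rewrite (SYT_has_descents hU (one_line_standard pi) e hi) h.
Qed.

Lemma in_interval n a b (i : 'I_n) : (i \in interval n a b) = (a <= i <= b).
Proof. by rewrite inE. Qed.

Lemma row_hook_class n k : 0 < k <= n -> is_SYT n (row_hook n k) ->
  inv_descent_class (interval n k n.-1) = knuth_class n (row_hook n k).
Proof.
move=> hk hT; have hJ (i : 'I_n) : (i \in interval n k n.-1) = (0 < i) && (k <= i).
  by rewrite in_interval; have := ltn_ord i; lia.
apply/setP => pi; apply/(@inv_descent_classP _ _ (fun i => k <= i) pi hJ)/idP => [h|h].
  by rewrite in_knuth_class (classify_row (one_line_standard pi) hk h).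
by apply: (knuth_class_descents hT h) => i; apply: row_hook_rows.
Qed.

Lemma column_hook_class n k : 0 < k <= n -> is_SYT n (column_hook n k) ->
  inv_descent_class (interval n 1 k.-1) = knuth_class n (column_hook n k).
Proof.
move=> hk hT; have hJ (i : 'I_n) : (i \in interval n 1 k.-1) = (0 < i) && (i < k).
  by rewrite in_interval; have := ltn_ord i; lia.
apply/setP => pi; apply/(@inv_descent_classP _ _ (fun i => i < k) pi hJ)/idP => [h|h].
  by rewrite in_knuth_class (classify_column (one_line_standard pi) hk h).
by apply: (knuth_class_descents hT h) => i; apply: column_hook_rows.
Qed.

Lemma pair_class n (J : {set 'I_n}) (P : pred nat) U V : is_SYT n U -> is_SYT n V ->
  (forall i : 'I_n, (i \in J) = (0 < i) && P i) ->
  (forall i, 0 < i < n -> (row_of U i < row_of U i.+1) = P i) ->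
  (forall i, 0 < i < n -> (row_of V i < row_of V i.+1) = P i) ->
  (forall w, standard n w -> has_descents n w P -> insert_word w = U \/ insert_word w = V) ->
  inv_descent_class J = knuth_class n U :|: knuth_class n V.
Proof.
move=> hU hV hJ dU dV cl; apply/setP => pi.
apply/(@inv_descent_classP _ _ P pi hJ)/idP => [h|].
  rewrite in_setU !in_knuth_class.
  by case: (cl _ (one_line_standard pi) h) => ->; rewrite eqxx ?orbT.
by rewrite in_setU => /orP[h|h]; [apply: (knuth_class_descents hU h dU)|apply: (knuth_class_descents hV h dV)].
Qed.

(** A tableau is determined by its shape and its entries in reading order. *)
Lemma superstandard_hook_cases n S : is_SYT n S -> superstandard_hook S ->
  exists2 k, 0 < k <= n & S = row_hook n k \/ S = column_hook n k.
Proof.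
move=> hS [[a [b sh]] ss]; have [n0 _ _ _ pS] := hS.
have szS : size (flatten S) = n by rewrite (perm_size pS) size_iota.
case: S hS sh ss n0 pS szS => // r S hS [ra sS]; rewrite inE negb_or => ss /andP[r0 _] pS szS.
have eS : S = singles (flatten S).
  elim: S b sS {hS ss pS szS} => // s S IH [|b] //= [s1 /IH {1}->].
  by case: s s1 => // x [|].
move: (flatten S) eS => C eS; rewrite {}eS in hS ss szS pS *.
have fl (D : seq nat) : flatten (singles D) = D by exact: flatten_singles.
rewrite /= fl size_cat in szS; case: ss => [ss|].
  move: ss; rewrite /row_superstandard /= fl size_cat iotaD => /eqP.
  rewrite eqseq_cat ?size_iota // => /andP[/eqP er /eqP eC].
  exists (size r); first by rewrite lt0n size_eq0 eq_sym r0 -szS leq_addr.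
  by left; rewrite /row_hook {1}er {1}eC -szS addKn.
case: r r0 ra pS szS hS => // x R _ ra pS szS hS.
rewrite /column_superstandard transpose_hook /row_superstandard /= fl size_cat iotaD.
move=> [x1] /eqP; rewrite eqseq_cat ?size_iota // => /andP[/eqP eC /eqP eR].
exists (size C).+1; first by rewrite -szS /=; lia.
have e : n - (size C).+1 = size R by rewrite -szS /= addSn subSS addnK.
by right; rewrite /column_hook x1 e -[(size C).+2]add2n -eR -eC.
Qed.

Lemma row_hook_superstandard n k : 0 < k <= n -> superstandard_hook (row_hook n k).
Proof.
move=> hk; split.
  by exists k, (n - k); rewrite /row_hook /= size_iota shape_singles size_iota.
left; rewrite /row_superstandard /row_hook /= flatten_singles size_cat !size_iota.
by rewrite -iotaD.
Qed.

Lemma column_hook_superstandard n k : 0 < k <= n -> superstandard_hook (column_hook n k).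
Proof.
move=> hk; split.
  by exists (n - k).+1, k.-1; rewrite /column_hook /= size_iota shape_singles size_iota.
right; rewrite /column_superstandard /column_hook transpose_hook.
rewrite /row_superstandard /= flatten_singles size_cat !size_iota.
by rewrite iotaD; congr (_ :: _ ++ iota _ _); lia.
Qed.

Lemma hook_descents_superstandard n S : is_SYT n S -> hook_descents n (row_word S) ->
  superstandard_hook S.
Proof.
move=> hS [k hk h]; have sw := row_word_standard hS; rewrite -(insert_SYT hS).
case: h => h; last by rewrite (classify_row sw hk h); apply: row_hook_superstandard.
by rewrite (classify_column sw hk h); apply: column_hook_superstandard.
Qed.

Lemma pair_of_two (S T U V : tableau) : S <> T -> S = U \/ S = V -> T = U \/ T = V ->
  unordered_pair_eq S T U V.
Proof.
move=> ST [eS|eS] [eT|eT].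
- by case: ST; rewrite eS eT.
- by left.
- by right.
by case: ST; rewrite eS eT.
Qed.

(** * The equivalence *)

Section Equivalence.
Variables (n : nat) (S T : tableau) (Pi : {set 'S_n}).
Hypotheses (hS : is_SYT n S) (hT : is_SYT n T) (hST : S <> T).
Hypothesis hPi : Pi = knuth_class n S :|: knuth_class n T.

Let by_descents : Prop := exists J L : {set 'I_n},
  Pi = inv_descent_class J :|: inv_descent_class L /\
  ((J <> L /\ end_interval J /\ end_interval L) \/
   (J = L /\ exceptional_descent_set J)).

Let by_tableaux : Prop := (superstandard_hook S /\ superstandard_hook T) \/
  exceptional_pair n S T \/
  (exists U V : tableau, exceptional_pair n U V /\ S = transpose U /\ T = transpose V).

Lemma descents_swap_closed : by_descents -> swap_closed Pi.
Proof.
case=> J [L [-> _]] pi i j; rewrite !in_setU => /orP[h|h] ji sw; apply/orP; [left|right].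
  exact: inv_descent_class_swap.
exact: inv_descent_class_swap.
Qed.

Lemma hook_end_interval U : is_SYT n U -> superstandard_hook U ->
  exists2 J : {set 'I_n}, end_interval J & inv_descent_class J = knuth_class n U.
Proof.
move=> hU sU; have [k hk [eU|eU]] := superstandard_hook_cases hU sU; rewrite eU in hU *.
  by exists (interval n k n.-1); [right; exists k|apply: row_hook_class].
by exists (interval n 1 k.-1); [left; exists k.-1 => //; lia|apply: column_hook_class].
Qed.

Lemma exceptional_class (J : {set 'I_n}) U V : is_SYT n U -> is_SYT n V ->
  unordered_pair_eq S T U V ->
  inv_descent_class J = knuth_class n U :|: knuth_class n V -> 
  exceptional_descent_set J -> by_descents.
Proof.
move=> hU hV uv e eJ; exists J, J; split; last by right.
by rewrite setUid e hPi; case: uv => [[-> ->]|[-> ->]] //; rewrite setUC.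
Qed.

Lemma in_compl_interval a b (i : 'I_n) :
  (i \in interval n 1 n.-1 :\: interval n a b) = (0 < i) && ~~ (a <= i <= b).
Proof. by rewrite in_setD !in_interval andbC; have := ltn_ord i; lia. Qed.

Lemma tableaux_descents : by_tableaux -> by_descents.
Proof.
case=> [[sS sT]|[exc|[U [V [exc [eS eT]]]]]].
- have [J eJ cJ] := hook_end_interval hS sS; have [L eL cL] := hook_end_interval hT sT.
  exists J, L; rewrite cJ cL; split=> //; left; split=> // JL; apply: hST.
  by apply: (knuth_class_inj hS); rewrite -cJ -cL JL.
- have SYT2 U V : unordered_pair_eq S T U V -> is_SYT n U /\ is_SYT n V.
    by case=> -[<- <-].
  case: exc => -[k hk uv]; have [hU hV] := SYT2 _ _ uv.
    apply: (exceptional_class (J := interval n k (n - 2)) hU hV uv); last by left; left; exists k.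
    apply: (pair_class (P := fun i => k <= i <= n - 2)) => // [i|i|i|w sw h].
    + by rewrite in_interval; lia.
    + exact: typeA_hook_rows.
    + exact: typeA_nonhook_rows.
    exact: classify_typeA.
  apply: (exceptional_class (J := interval n 2 (k - 2)) hU hV uv); last by left; right; exists k.
  apply: (pair_class (P := fun i => 2 <= i <= k - 2)) => // [i|i|i|w sw h].
  + by rewrite in_interval; lia.
  + exact: typeB_hook_rows.
  + exact: typeB_nonhook_rows.
  exact: classify_typeB.
have tr A B : unordered_pair_eq U V A B -> unordered_pair_eq S T (transpose A) (transpose B).
  by rewrite eS eT; case=> -[-> ->]; [left|right].
have SYT2 A B : unordered_pair_eq S T A B -> is_SYT n A /\ is_SYT n B.
  by case=> -[<- <-].
case: exc => -[k hk /tr uv]; have [hU hV] := SYT2 _ _ uv.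
  apply: (exceptional_class (J := interval n 1 n.-1 :\: interval n k (n - 2)) hU hV uv).
    apply: (pair_class (P := fun i => ~~ (k <= i <= n - 2))) => // [i|i|i|w sw h].
    + exact: in_compl_interval.
    + exact: typeA_hook_tr_rows.
    + exact: typeA_nonhook_tr_rows.
    exact: classify_typeA_tr.
  by right; exists (interval n k (n - 2)) => //; left; exists k.
apply: (exceptional_class (J := interval n 1 n.-1 :\: interval n 2 (k - 2)) hU hV uv).
  apply: (pair_class (P := fun i => ~~ (2 <= i <= k - 2))) => // [i|i|i|w sw h].
  + exact: in_compl_interval.
  + exact: typeB_hook_tr_rows.
  + exact: typeB_nonhook_tr_rows.
  exact: classify_typeB_tr.
by right; exists (interval n 2 (k - 2)) => //; right; exists k.
Qed.

Lemma exceptional_words_tableaux : exceptional_words n (row_word S) (row_word T) -> by_tableaux.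
Proof.
have sS := row_word_standard hS; have sT := row_word_standard hT.
case=> J [inner dS dT]; right; rewrite -[S](insert_SYT hS) -[T](insert_SYT hT).
have neq : insert_word (row_word S) <> insert_word (row_word T).
  by rewrite (insert_SYT hS) (insert_SYT hT).
have desc w P : has_descents n w J -> (forall i, 0 < i < n -> J i = P i) ->
    has_descents n w P.
  by move=> dw h i hi; rewrite dw ?h.
case: inner => -[[k hk h]|[k hk h]].
- left; left; exists k => //.
  by apply: pair_of_two neq _ _; apply: classify_typeA => //; apply: desc h.
- left; right; exists k => //.
  by apply: pair_of_two neq _ _; apply: classify_typeB => //; apply: desc h.
- have h' i : 0 < i < n -> J i = ~~ (k <= i <= n - 2) by move/h => /= <-; rewrite negbK.
  right; have uv := pair_of_two neq (classify_typeA_tr sS hk (desc _ _ dS h'))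
    (classify_typeA_tr sT hk (desc _ _ dT h')).
  case: uv => -[e1 e2]; do 2!eexists; (split; [|split; [exact: e1|exact: e2]]).
    by left; exists k => //; left.
  by left; exists k => //; right.
have h' i : 0 < i < n -> J i = ~~ (2 <= i <= k - 2) by move/h => /= <-; rewrite negbK.
right; have uv := pair_of_two neq (classify_typeB_tr sS hk (desc _ _ dS h'))
  (classify_typeB_tr sT hk (desc _ _ dT h')).
case: uv => -[e1 e2]; do 2!eexists; (split; [|split; [exact: e1|exact: e2]]).
  by right; exists k => //; left.
by right; exists k => //; right.
Qed.

Lemma closed_tableaux : pattern_knuth_closed Pi -> by_tableaux.
Proof.
move=> cl; have F := closed_forces hS hT hPi cl.
have F' : forces (row_word T) (row_word S).
  by apply: (closed_forces hT hS _ cl); rewrite hPi setUC.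
have sS := row_word_standard hS; have sT := row_word_standard hT.
(* For [n = 0] both tableaux are empty. *)
have n0 : 0 < n.
  case: (posnP n) => // n0; case: hST; have nil U : is_SYT n U -> U = [::].
    case=> nU _ _ _ /perm_size; rewrite n0; case: U nU => // r U; rewrite inE negb_or.
    by case: r.
  by rewrite (nil S hS) (nil T hT).
case: (forces_hook_or_exceptional sS sT n0 F F') => [dS|]; last exact: exceptional_words_tableaux.
case: (forces_hook_or_exceptional sT sS n0 F' F) => [dT|[J [inner dT dS']]].
  by left; split; [apply: hook_descents_superstandard hS dS|apply: hook_descents_superstandard hT dT].
by apply: exceptional_words_tableaux; exists J.
Qed.
End Equivalence.

Theorem theorem5p13 (n : nat) (S T : tableau) (Pi : {set 'S_n})
    (hS : is_SYT n S) (hT : is_SYT n T) (hST : S <> T)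
    (hPi : Pi = knuth_class n S :|: knuth_class n T) :
  [<-> pattern_knuth_closed Pi;
       swap_closed Pi;
       exists J L : {set 'I_n},
         Pi = inv_descent_class J :|: inv_descent_class L /\
         ((J <> L /\ end_interval J /\ end_interval L) \/
          (J = L /\ exceptional_descent_set J));
       (superstandard_hook S /\ superstandard_hook T) \/
       exceptional_pair n S T \/
       (exists U V : tableau,
          exceptional_pair n U V /\ S = transpose U /\ T = transpose V)].
Proof.
have A : swap_closed Pi -> pattern_knuth_closed Pi := swap_closed_knuth hS hT hPi.
have B := tableaux_descents hS hT hST hPi.
have C := @descents_swap_closed n Pi.
have D := closed_tableaux hS hT hST hPi.
split; [by move/D/B/C|split; [by move/A/D/B|split; [by move/C/A/D|by move/B/C/A]]].
Qed.
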